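(* Let $M$ be a closed $C^0$-submanifold of a manifold $P$. Then $$\mu\mathrm{supp}(M) \subseteq C(M,M)^\top,$$ with equality if $\dim M = 1$.
   Context: Manifolds are real, finite-dimensional, smooth ($C^\infty$), paracompact and Hausdorff. A $C^0$-submanifold is a topological submanifold that is locally flatly embedded (its inclusion is locally homeomorphic to a linear inclusion $\mathbb{R}^m \hookrightarrow \mathbb{R}^p$). $\Bbbk$ is any fixed nonzero commutative ring of finite global dimension. Whitney cone: for subsets $A,B$ of $P$ and $p\in P$, $C_p(A,B)$ is the set of $u \in T_pP$ for which there are sequences $x_n \in A$, $y_n \in B$, $c_n \in \mathbb{R}_{>0}$ with $x_n \to p$, $y_n \to p$ and $c_n(y_n - x_n) \to u$ (computed in a chart at $p$; independent of the chart); $C(A,B) = \bigcup_p C_p(A,B) \subseteq TP$. For a subset $A$ of a vector space $V$, $A^\top = \{\xi \in V^* \mid \exists v \in A\setminus\{0\},\ \langle\xi,v\rangle = 0\}$; for subsets of vector bundles this is applied fiberwise. Microsupport: for $F$ in the bounded derived category $\mathrm{D}^{\mathrm b}(\Bbbk_P)$ of sheaves of $\Bbbk$-modules, $\mathrm{Ppg}(F)$ is the set of $(p,\xi) \in T^*P$ such that for every open neighborhood $U$ of $p$ and every $\phi \in C^\infty(U)$ with $\phi(p)=0$ and $d\phi(p)=\xi$ one has $(\mathrm{R}\Gamma_{\{\phi \geq 0\}}(F))_p = 0$; $\mu\mathrm{supp}(F) = \overline{T^*P \setminus \mathrm{Ppg}(F)}$. For a locally closed $A \subseteq P$, $\mu\mathrm{supp}(A)$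 denotes the microsupport of the constant sheaf on $A$ with stalk $\Bbbk$ extended by zero to $P$. Inclusions and equalities between subsets of $T^*P$ concern nonzero as well as zero covectors, as literally written.
   Formalization: The inclusion is stated for M without 0-dimensional (isolated) points: at an isolated point p of M, C_p(M,M)={0}, so C(M,M)^⊤ is empty over p while μsupp(M) contains all of T*_pP; the equality for dim M = 1 is unchanged. *)

(* Defs.v *)
From HB Require Import structures.
From mathcomp Require Import all_boot all_order all_algebra.
From mathcomp Require Import all_classical all_reals all_analysis.

Set Implicit Arguments.
Unset Strict Implicit.
Unset Printing Implicit Defensive.

Import Order.TTheory GRing.Theory Num.Theory.
Import numFieldNormedType.Exports.

Local Open Scope classical_set_scope.
Local Open Scope ring_scope.

Section GlobalDimension.
Variable k : comNzRingType.

Definition projective_module (Q : lmodType k) : Prop :=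
  forall (A B : lmodType k) (g : {linear A -> B}) (h : {linear Q -> B}),
    (forall b, exists a, g a = b) ->
    exists l : {linear Q -> A}, forall q, g (l q) = h q.

Fixpoint projective_dimension_le (d : nat) (N : lmodType k) : Prop :=
  if d is d'.+1 then
    exists (K Q : lmodType k) (i : {linear K -> Q}) (f : {linear Q -> N}),
      [/\ projective_module Q,
          injective i,
          forall q, f q = 0 <-> exists a, i a = q,
          forall x, exists q, f q = x
        & projective_dimension_le d' K]
  else projective_module N.

Definition finite_global_dimension : Prop :=
  exists d, forall N : lmodType k, projective_dimension_le d N.

End GlobalDimension.

Section Smooth.
Variables (R : realType) (n : nat) (V : normedModType R).
Implicit Types (f : 'rV[R]_n -> V) (U : set 'rV[R]_n).

Fixpoint Ck (j : nat) f U : Prop :=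
  (forall x, U x -> {for x, continuous f}) /\
  if j is j'.+1 then
    forall i : 'I_n,
      (forall x, U x -> derivable f x (delta_mx 0 i)) /\
      Ck j' ('D_(delta_mx 0 i) f) U
  else True.

(* Only used on open sets U. *)
Definition smooth_on f U : Prop := forall j, Ck j f U.

End Smooth.

Definition paracompact (T : topologicalType) : Prop :=
  forall C : set (set T), C `<=` open -> \bigcup_(U in C) U = setT ->
  exists D : set (set T),
    [/\ D `<=` open,
        \bigcup_(V in D) V = setT,
        forall V, D V -> exists2 U, C U & V `<=` U
      & forall x : T, exists2 N, nbhs x N &
          finite_set [set V | D V /\ V `&` N !=set0]].

(* A homeomorphism from an open subset of T onto an open subset of R^n; the
   underlying maps are total, with irrelevant values outside ldom and lcod. *)
Record local_chart (R : realType) (T : topologicalType) (n : nat) :=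
  LocalChart {
  ldom : set T;
  lcod : set 'rV[R]_n;
  lmap :> T -> 'rV[R]_n;
  linv : 'rV[R]_n -> T;
  ldom_open : open ldom;
  lcod_open : open lcod;
  lmap_cod : forall x, ldom x -> lcod (lmap x);
  linv_dom : forall y, lcod y -> ldom (linv y);
  lmapK : forall x, ldom x -> linv (lmap x) = x;
  linvK : forall y, lcod y -> lmap (linv y) = y;
  lmap_continuous : forall x, ldom x -> {for x, continuous lmap};
  linv_continuous : forall y, lcod y -> {for y, continuous linv}
}.

(* The atlas need not be maximal. As part of the data every point p gets a
   preferred chart [chart_at p], through which T_pP and T*_pP are identified
   with R^n. *)
Record manifold (R : realType) (n : nat) := Manifold {
  mcarrier :> topologicalType;
  m_hausdorff : hausdorff_space mcarrier;
  m_paracompact : paracompact mcarrier;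
  atlas : set (local_chart R mcarrier n);
  chart_at : mcarrier -> local_chart R mcarrier n;
  chart_at_atlas : forall p, atlas (chart_at p);
  chart_at_dom : forall p, ldom (chart_at p) p;
  atlas_compatible : forall c d, atlas c -> atlas d ->
    smooth_on (d \o linv c) (lcod c `&` linv c @^-1` ldom d)
}.

Section ManifoldTheory.
Variables (R : realType) (n : nat) (P : manifold R n).

Definition smooth_function_on (phi : P -> R) (U : set P) : Prop :=
  forall c, atlas c ->
    smooth_on (phi \o linv c : 'rV[R]_n -> R^o) (lcod c `&` linv c @^-1` U).

Definition pairing (xi v : 'rV[R]_n) : R := \sum_(i < n) xi 0 i * v 0 i.

(* The vector, resp. covector, is given by its coordinates in [chart_at] of
   its base point. *)
Record tangent := Tangent { tbase : P; tvec : 'rV[R]_n }.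
Record cotangent := Cotangent { cbase : P; covec : 'rV[R]_n }.

(* The coordinates of a covector in any chart c around its base point q: the
   pull-back of its coordinates in [chart_at q] by the change of charts. *)
Definition covec_in (c : local_chart R P n) (w : cotangent) : 'rV[R]_n :=
  covec w *m (jacobian (chart_at (cbase w) \o linv c) (c (cbase w)))^T.

(* The topology of T*P for which the bundle charts are homeomorphisms. *)
Definition cotangent_open (W : set cotangent) : Prop :=
  forall c, atlas c -> forall w, W w -> ldom c (cbase w) ->
    \forall z \near (c (cbase w), covec_in c w),
      forall w', ldom c (cbase w') ->
        (c (cbase w'), covec_in c w') = z -> W w'.

Lemma cotangent_openT : cotangent_open setT.
Proof. by move=> c _ w _ _; near=> z. Unshelve. all: by end_near. Qed.

Lemma cotangent_openI : setI_closed cotangent_open.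
Proof.
move=> A B oA oB c ac w [Aw Bw] dw.
apply: filterS2 (oA c ac w Aw dw) (oB c ac w Bw dw) => z Az Bz w' dw' e.
by split; [exact: Az|exact: Bz].
Qed.

Lemma cotangent_open_bigU (I : Type) (f : I -> set cotangent) :
  (forall i, cotangent_open (f i)) -> cotangent_open (\bigcup_i f i).
Proof.
move=> of_ c ac w [i _ fw] dw.
by apply: filterS (of_ i c ac w fw dw) => z fz w' dw' e; exists i => //; exact: fz.
Qed.

HB.instance Definition _ := gen_eqMixin cotangent.
HB.instance Definition _ := gen_choiceMixin cotangent.
HB.instance Definition _ := isOpenTopological.Build cotangent
  cotangent_openT cotangent_openI cotangent_open_bigU.

Definition whitney_cone_at (A B : set P) (p : P) : set 'rV[R]_n :=
  [set u | exists (x y : nat -> P) (c : nat -> R),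
    [/\ forall i, A (x i),
        forall i, B (y i),
        forall i, 0 < c i
      & [/\ x @ \oo --> p, y @ \oo --> p
          & (fun i => c i *: (chart_at p (y i) - chart_at p (x i))) @ \oo
              --> u]]].

Definition whitney_cone (A B : set P) : set tangent :=
  [set t | whitney_cone_at A B (tbase t) (tvec t)].

(* The operation written A^\top. *)
Definition top_set (A : set tangent) : set cotangent :=
  [set w | exists v, [/\ A (Tangent (cbase w) v), v != 0
                       & pairing (covec w) v = 0]].

Definition locally_flat_at (M : set P) (m : nat) (p : P) : Prop :=
  (m <= n)%N /\ exists h : local_chart R P n, ldom h p /\
    forall x, ldom h x -> (M x <-> forall i : 'I_n, (m <= i)%N -> h x 0 i = 0).

(* The dimension m may depend on the point. *)
Definition C0_submanifold (M : set P) : Prop :=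
  forall p, M p -> exists m, locally_flat_at M m p.

Definition has_dimension (M : set P) (m : nat) : Prop :=
  forall p, M p -> locally_flat_at M m p.

End ManifoldTheory.

Record opens (T : topologicalType) := Opens {
  oset :> set T;
  opensP : open oset
}.

Record sheaf (k : comNzRingType) (T : topologicalType) := Sheaf {
  sec : opens T -> lmodType k;
  res : forall U V : opens T, V `<=` U -> {linear sec U -> sec V};
  res_id : forall (U : opens T) (UU : U `<=` U) s, res UU s = s;
  res_comp : forall (U V W : opens T) (VU : V `<=` U) (WV : W `<=` V)
    (WU : W `<=` U) s, res WV (res VU s) = res WU s;
  sheaf_sep : forall (I : Type) (U : opens T) (V : I -> opens T)
    (VU : forall i, V i `<=` U), U `<=` \bigcup_i V i ->
    forall s t : sec U, (forall i, res (VU i) s = res (VU i) t) -> s = t;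
  sheaf_glue : forall (I : Type) (U : opens T) (V : I -> opens T)
    (VU : forall i, V i `<=` U), U `<=` \bigcup_i V i ->
    forall s : (forall i, sec (V i)),
    (forall i j (W : opens T) (Wi : W `<=` V i) (Wj : W `<=` V j),
       res Wi (s i) = res Wj (s j)) ->
    exists t : sec U, forall i, res (VU i) t = s i
}.

Arguments res {k T F U V} VU : rename.

Record sheaf_hom (k : comNzRingType) (T : topologicalType) (F G : sheaf k T) :=
  SheafHom {
  happ :> forall U : opens T, {linear sec F U -> sec G U};
  happ_res : forall (U V : opens T) (VU : V `<=` U) s,
    happ V (res VU s) = res VU (happ U s)
}.

Section SheafTheory.
Variables (k : comNzRingType) (T : topologicalType).
Implicit Types F G H I : sheaf k T.

Definition sheaf_mono F G (f : sheaf_hom F G) : Prop :=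
  forall U : opens T, injective (f U).

Definition sheaf_exact F G H (f : sheaf_hom F G) (g : sheaf_hom G H) : Prop :=
  forall (U : opens T) (t : sec G U),
    g U t = 0 <->
    forall x, oset U x -> exists (V : opens T) (VU : V `<=` U) (s : sec F V),
      oset V x /\ f V s = res VU t.

Definition injective_sheaf I : Prop :=
  forall (A B : sheaf k T) (i : sheaf_hom A B) (f : sheaf_hom A I),
    sheaf_mono i ->
    exists g : sheaf_hom B I, forall (U : opens T) s, g U (i U s) = f U s.

Record injective_resolution F := InjectiveResolution {
  ires : nat -> sheaf k T;
  idiff : forall j, sheaf_hom (ires j) (ires j.+1);
  iaug : sheaf_hom F (ires 0%N);
  ires_inj : forall j, injective_sheaf (ires j);
  iaug_mono : sheaf_mono iaug;
  iaug_exact : sheaf_exact iaug (idiff 0%N);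
  idiff_exact : forall j, sheaf_exact (idiff j) (idiff j.+1)
}.

(* s belongs to Gamma_Z(V; F), where Z `&` V is closed in V: the section s
   vanishes on the open set V `\` Z. *)
Definition supported_in F (Z : set T) (V : opens T) (s : sec F V) : Prop :=
  forall (W : opens T) (WV : W `<=` V), W `&` Z = set0 -> res WV s = 0.

(* The stalk at p of the j-th cohomology sheaf of Gamma_Z(I), for Z closed in
   the open neighbourhood U of p. An element of this stalk is the germ of a
   cocycle supported in Z, and it vanishes if and only if the cocycle is, near
   p, the differential of a cochain supported in Z. *)
Definition local_cohomology_stalk_zero F (I : injective_resolution F)
    (U Z : set T) (p : T) (j : nat) : Prop :=
  forall (V : opens T) (s : sec (ires I j) V),
    V `<=` U -> oset V p -> supported_in Z s -> idiff I j V s = 0 ->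
  exists (W : opens T) (WV : W `<=` V), oset W p /\
    match j return sec (ires I j) W -> Prop with
    | 0%N => fun s' => s' = 0
    | j'.+1 => fun s' => exists t : sec (ires I j') W,
                 supported_in Z t /\ idiff I j' W t = s'
    end (res WV s).

(* (RGamma_Z(F))_p = 0, where RGamma_Z is computed on an injective resolution;
   the condition does not depend on the choice of the resolution. *)
Definition RGamma_stalk_zero F (U Z : set T) (p : T) : Prop :=
  exists I : injective_resolution F,
    forall j, local_cohomology_stalk_zero I U Z p j.

End SheafTheory.

Section ConstantSheaf.
Variables (k : comNzRingType) (T : topologicalType) (A : set T).

(* For A locally closed, the sections over U of the extension by zero of k_A
   are the locally constant functions on U `&` A whose support is closed in U.
   Extending them by zero outside of U `&` A, both conditions together say that
   near every point x of U, in A or not, the function is equal to its value at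
   x on the points of A. *)
Definition csec (U : opens T) : {pred (T -> k^o)} :=
  [pred f : T -> k^o | `[< (forall x, ~ (U `&` A) x -> f x = 0) /\
    (forall x, oset U x -> \forall y \near x, A y -> f y = f x) >]].

Lemma csec_submod U : submod_closed (csec U).
Proof.
split; first by apply/asboolP; split => // x _; near=> y.
move=> a f g /asboolP[f0 fc] /asboolP[g0 gc]; apply/asboolP; split=> x xU.
  by rewrite !fctE f0// g0// scaler0 addr0.
by apply: filterS2 (fc x xU) (gc x xU) => y fy gy Ay; rewrite !fctE fy// gy.
Unshelve. all: by end_near. Qed.

HB.instance Definition _ U := GRing.isSubmodClosed.Build k (T -> k^o) (csec U)
  (csec_submod U).

Record csec_type (U : opens T) := CSec {
  csec_fun :> T -> k^o;
  csec_funP : csec_fun \in csec U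
}.

HB.instance Definition _ U := [isSub of csec_type U for @csec_fun U].
HB.instance Definition _ U := [Choice of csec_type U by <:].
HB.instance Definition _ U :=
  [SubChoice_isSubLmodule of csec_type U by <:].

Lemma csec_out U (f : csec_type U) x : ~ (U `&` A) x -> f x = 0.
Proof. by have /asboolP[f0 _] := csec_funP f; exact: f0. Qed.

Lemma csec_near U (f : csec_type U) x : oset U x ->
  \forall y \near x, A y -> f y = f x.
Proof. by have /asboolP[_ fc] := csec_funP f; exact: fc. Qed.

Lemma csec_eq U (f g : csec_type U) : (forall x, oset U x -> f x = g x) -> f = g.
Proof.
move=> fg; apply/val_inj/funext => x /=.
have [/fg//|nUx] := pselect (oset U x).
by rewrite !csec_out// => -[].
Qed.

Lemma cres_subproof (U V : opens T) (VU : V `<=` U) (f : csec_type U) :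
  (fun x => if `[< oset V x >] then f x else 0) \in csec V.
Proof.
apply/asboolP; split=> x Vx.
  case: asboolP => // Vx'; apply: csec_out => -[_ Ax]; exact: Vx.
have nV : nbhs x V by apply: open_nbhs_nbhs; split; [exact: opensP|].
apply: filterS2 nV (csec_near f (VU _ Vx)) => y Vy fy Ay.
by rewrite !asboolT// fy.
Qed.

Definition cres (U V : opens T) (VU : V `<=` U) (f : csec_type U) :
  csec_type V := CSec (cres_subproof VU f).

Lemma cresE (U V : opens T) (VU : V `<=` U) f x : oset V x -> cres VU f x = f x.
Proof. by move=> Vx /=; rewrite asboolT. Qed.

Lemma cres_linear (U V : opens T) (VU : V `<=` U) : linear (cres VU).
Proof.
move=> a f g; apply: csec_eq => x Vx; rewrite cresE//.
have E W (f' g' : csec_type W) : (a *: f' + g') x = a *: f' x + g' x by [].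
by rewrite !E !cresE.
Qed.

HB.instance Definition _ (U V : opens T) (VU : V `<=` U) :=
  GRing.isLinear.Build k (csec_type U) (csec_type V) *:%R (cres VU)
    (cres_linear VU).

Lemma cglue (J : Type) (U : opens T) (V : J -> opens T)
    (VU : forall i, V i `<=` U) : U `<=` \bigcup_i V i ->
  forall s : (forall i, csec_type (V i)),
  (forall i j (W : opens T) (Wi : W `<=` V i) (Wj : W `<=` V j),
     cres Wi (s i) = cres Wj (s j)) ->
  exists t : csec_type U, forall i, cres (VU i) t = s i.
Proof.
move=> UV s sc.
have sE i j x : oset (V i) x -> oset (V j) x -> s i x = s j x.
  move=> Vix Vjx.
  have oW : open (V i `&` V j) by apply: openI; exact: opensP.
  have := sc i j (Opens oW) (@subIsetl _ _ _) (@subIsetr _ _ _).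
  by move=> /(congr1 (fun f => csec_fun f x)); rewrite !cresE.
pose g x : k^o := if pselect (exists i, oset (V i) x) is left h
                  then s (projT1 (cid h)) x else 0.
have gE i x : oset (V i) x -> g x = s i x.
  move=> Vx; rewrite /g; case: pselect => [h|[]]; last by exists i.
  by case: cid => j Vjx /=; exact: sE.
have gU : g \in csec U.
  apply/asboolP; split=> x.
    move=> nUA; rewrite /g; case: pselect => // h.
    case: cid => i Vix /=; apply: csec_out => -[_ Ax]; apply: nUA.
    by split => //; exact: VU Vix.
  move=> /UV[i _ Vix].
  have nV : nbhs x (V i) by apply: open_nbhs_nbhs; split; [exact: opensP|].
  apply: filterS2 nV (csec_near (s i) Vix) => y Vy sy Ay.
  by rewrite !(gE i)// sy.
exists (CSec gU) => i; apply: csec_eq => x Vx.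
by rewrite cresE//=; exact: gE.
Qed.

Lemma csep (J : Type) (U : opens T) (V : J -> opens T)
    (VU : forall i, V i `<=` U) : U `<=` \bigcup_i V i ->
  forall s t : csec_type U,
  (forall i, cres (VU i) s = cres (VU i) t) -> s = t.
Proof.
move=> UV s t st; apply: csec_eq => x /UV[i _ Vx].
by have /(congr1 (fun f => csec_fun f x)) := st i; rewrite !cresE.
Qed.

Lemma cres_id (U : opens T) (UU : U `<=` U) s : cres UU s = s.
Proof. by apply: csec_eq => x Ux; rewrite cresE. Qed.

Lemma cres_comp (U V W : opens T) (VU : V `<=` U) (WV : W `<=` V)
  (WU : W `<=` U) s : cres WV (cres VU s) = cres WU s.
Proof. by apply: csec_eq => x Wx; rewrite !cresE//; exact: WV. Qed.

Definition constant_sheaf : sheaf k T :=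
  @Sheaf k T (fun U => csec_type U)
    (fun U V VU => cres VU : {linear csec_type U -> csec_type V})
    cres_id cres_comp csep cglue.

End ConstantSheaf.

Section Microsupport.
Variables (R : realType) (n : nat) (P : manifold R n) (k : comNzRingType).

Definition has_differential (phi : P -> R) (w : cotangent P) : Prop :=
  let c := chart_at (cbase w) in
  forall v, 'd (phi \o linv c : 'rV[R]_n -> R^o) (c (cbase w)) v
            = pairing (covec w) v.

Definition Ppg (F : sheaf k P) : set (cotangent P) :=
  [set w | forall (U : set P) (phi : P -> R),
     open U -> U (cbase w) -> smooth_function_on phi U ->
     phi (cbase w) = 0 -> has_differential phi w ->
     RGamma_stalk_zero F U [set x | U x /\ 0 <= phi x] (cbase w)].

Definition musupp (F : sheaf k P) : set (cotangent P) := closure (~` Ppg F).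

(* Meaningful for A locally closed, like [constant_sheaf]. *)
Definition musupp_set (A : set P) : set (cotangent P) :=
  musupp (constant_sheaf k A).

End Microsupport.

(* Main.v *)
Require Import Defs.
From HB Require Import structures.
From mathcomp Require Import all_boot all_order all_algebra.
From mathcomp Require Import all_classical all_reals all_analysis.
From mathcomp Require Import ring.

Set Implicit Arguments.
Unset Strict Implicit.
Unset Printing Implicit Defensive.

Import Order.TTheory GRing.Theory Num.Theory.
Import numFieldNormedType.Exports.

(** Fix a covector xi at a point p of M, and let phi be a smooth function with
    phi p = 0 and differential xi at p.

    The inclusion. If xi kills no nonzero vector of C_p(M, M), compactness of
    the unit sphere yields a bound |<xi, y - x>| >= e |y - x| for all x, y in M
    near p ([noncharacteristicPn]). This bound does not depend on the chart and
    is an open condition on (p, xi), so it is enough to show that it forces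
    the propagation condition at (p, xi). As phi is strictly differentiable at
    p, the bound makes phi injective on M near p. A Euclidean space of
    dimension at least 2 has no continuous injective real function
    ([flat2_not_injective]); hence M is an arc near p, phi is monotone along
    it, and {phi >= 0} cuts out a closed half of the arc. The local cohomology of
    k_M with support in a half-arc vanishes at its end point
    ([half_arc_acyclic]).

    That vanishing is computed on a resolution by products of skyscraper
    sheaves at the points of M, whose fibres are products of the injective
    cogenerator Hom(k, Q/Z). Such sheaves are injective, flabby and zero off M,
    so that over a neighbourhood of an arc they only depend on the arc. On it,
    every cocycle over a subinterval extends to a cocycle over a larger one
    ([cocycles_extendP]), by induction on the degree: in degree 0 cocycles are
    constants, and a cocycle of degree j + 1 over an interval is the
    differential of a cochain ([primitive]), which extends by flabbiness. A
    cocycle supported in the half-arc has a primitive near the end point; this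
    primitive is a cocycle off the half-arc, and subtracting an extension of
    the latter gives a primitive supported in the half-arc.

    Equality for curves. Let v be nonzero in C_p(M, M) with <xi, v> = 0, a limit
    of multiples of secants y_i - x_i. A small change of xi gives covectors eta_i
    that kill y_i - x_i exactly ([tilted_covector]). Then eta_i takes the same
    value at the two ends of the arc of M from x_i to y_i, so inside this arc
    there is a point q which is a local minimum of eta_i, or from which eta_i
    decreases on both sides ([interior_extremum]). With phi = eta_i - eta_i(q),
    in the first case {phi >= 0} contains M near q, and the constant section 1
    is a nonzero class of degree 0; in the second case the complement of
    {phi >= 0} has points of M on both sides of q, and the section equal to 0 on
    one side and 1 on the other gives a nonzero class of degree 1, on whatever
    injective resolution, since injective sheaves are flabby. So (q, eta_i) lies
    outside the propagation set, and these covectors tend to (p, xi). *)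

Local Open Scope classical_set_scope.
Local Open Scope ring_scope.

(** * The divisible group Q/Z is injective and separates subgroups *)

Definition int_pred : {pred rat} := fun q => q \is a Num.int.
Lemma int_zmod_closed : zmod_closed int_pred.
Proof. by split => [|x y xZ yZ]; rewrite unfold_in ?rpred0 ?rpredB. Qed.
HB.instance Definition _ := GRing.isZmodClosed.Build rat int_pred int_zmod_closed.

Definition QZ : zmodType := Quotient.quot (int_pred : zmodClosed rat).
Definition QZpi (q : rat) : QZ := (\pi_(Quotient.quot (int_pred : zmodClosed rat)) q)%qT.

Lemma QZpiB : zmod_morphism QZpi.
Proof. by move=> x y; exact: (raddfB (\pi_(Quotient.quot (int_pred : zmodClosed rat)))%qT). Qed.

HB.instance Definition _ := GRing.isZmodMorphism.Build rat QZ QZpi QZpiB.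

Lemma QZpi_eq0 q : (QZpi q = 0) <-> (q \is a Num.int).
Proof.
have -> : (q \is a Num.int) = (QZpi q == QZpi 0).
  by rewrite -[q in LHS]subr0; exact: (@Quotient.idealrBE _ (int_pred : zmodClosed rat)).
by rewrite raddf0; split => [->|/eqP].
Qed.

Lemma QZ_divisible (d : QZ) n : exists e, (0 < n)%N -> e *+ n = d.
Proof.
elim/quotW: d => q; exists (QZpi (q / n%:R)) => n0.
rewrite -(raddfMn QZpi); congr QZpi.
rewrite -[LHS]mulr_natr divfK //.
by rewrite pnatr_eq0 -lt0n.
Qed.

Lemma QZ_torsion n : n != 1%N -> exists2 d : QZ, d != 0 & d *+ n = 0.
Proof.
have H m : (1 < m)%N -> QZpi (m%:R^-1) != 0.
  move=> m1; apply/negP => /eqP/QZpi_eq0/intrP[z] E.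
  have m0 : (0 : rat) < m%:R by rewrite ltr0n ltnW.
  have z0 : 0 < z by rewrite -(ltr0z rat) -E invr_gt0.
  have : (z%:~R : rat) < 1 by rewrite -E invf_lt1// ltr1n.
  by rewrite ltrz1 ltNge -gtz0_ge1 z0.
case: n => [|[//|n]] _.
  by exists (QZpi (2%:R^-1)); [exact: H|rewrite mulr0n].
exists (QZpi (n.+2%:R^-1)); first exact: H.
rewrite -(raddfMn QZpi); apply/QZpi_eq0.
by rewrite -[X in X \is a _]mulr_natr mulVf ?pnatr_eq0.
Qed.

Definition subgroup (B : zmodType) (H : set B) :=
  H 0 /\ forall u v, H u -> H v -> H (u - v).

Section Subgroup.
Variables (B : zmodType) (H : set B).
Hypothesis sH : subgroup H.

Lemma subgroupN u : H u -> H (- u).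
Proof. by move=> Hu; rewrite -sub0r; apply: sH.2 => //; exact: sH.1. Qed.
Lemma subgroupD u v : H u -> H v -> H (u + v).
Proof. by move=> Hu Hv; rewrite -[v]opprK; apply: sH.2 => //; exact: subgroupN. Qed.
Lemma subgroupMn u n : H u -> H (u *+ n).
Proof. by move=> Hu; elim: n => [|n IH]; [exact: sH.1|rewrite mulrS; exact: subgroupD]. Qed.
Lemma subgroupMz u (m : int) : H u -> H (u *~ m).
Proof. by move=> Hu; case: m => n; rewrite ?NegzE ?mulrNz -?pmulrn; [|apply: subgroupN]; exact: subgroupMn. Qed.

(** The integers m with m b in H form a subgroup of Z, so a single generator n
    describes them; n = 0 stands for infinite order modulo H. *)
Lemma subgroup_order b : exists n : nat, forall m : int, H (b *~ m) <-> (n %| m)%Z.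
Proof.
have [[n0]|Hn] := pselect (exists n, (0 < n)%N /\ H (b *+ n)).
  move=> Hn0; have ex : exists n, `[< (0 < n)%N /\ H (b *+ n) >] by exists n0; apply/asboolP.
  have [n /asboolP[n_gt0 Hn] nmin] := ex_minnP ex.
  exists n => m; split => [Hm|/dvdzP[q ->]]; last first.
    by rewrite mulrC mulrzA; apply: subgroupMz; rewrite -pmulrn.
  have : H (b *~ (m %% n)%Z).
    have -> : (m %% n)%Z = m - n%:Z * (m %/ n)%Z.
      by rewrite [X in X - _](divz_eq m n) [n%:Z * _]mulrC addrAC subrr add0r.
    by rewrite mulrzBr; apply: sH.2 => //; rewrite mulrzA; exact: subgroupMz.
  have n0' : n%:Z != 0 by rewrite eqz_nat -lt0n.
  rewrite -(gez0_abs (modz_ge0 m n0')) -pmulrn => Hr.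
  rewrite /dvdz; apply/dvdz_mod0P.
  have [//|r0] := eqVneq (m %% n)%Z 0.
  have /nmin : `[< (0 < `|(m %% n)%Z|)%N /\ H (b *+ `|(m %% n)%Z|) >].
    by apply/asboolP; rewrite absz_gt0.
  have := ltz_mod m n0'; rewrite -{1}(gez0_abs (modz_ge0 m n0')) ltz_nat absz_nat.
  by rewrite ltnNge => /negbTE ->.
exists 0%N => m; split => [Hm|]; last by rewrite dvd0z => /eqP ->; rewrite mulr0z; exact: sH.1.
rewrite dvd0z; apply/negPn/negP => m0; apply: Hn; exists `|m|%N; rewrite absz_gt0 m0; split=> //.
have [m_ge0|m_lt0] := leP 0 m; first by rewrite pmulrn gez0_abs.
by rewrite pmulrn ltz0_abs// mulrNz; exact: subgroupN.
Qed.

End Subgroup.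

(** An additive map to Q/Z defined on a subgroup of B, encoded by its graph, so
    that the maps ordered by extension are sets ordered by inclusion. *)
Definition functional_rel (B : zmodType) (G : set (B * QZ)) :=
  subgroup G /\ forall d, G (0, d) -> d = 0.

Lemma subrACA (B : zmodType) (x y z t : B) : x - y - (z - t) = x - z - (y - t).
Proof. by rewrite !opprD !opprK addrACA. Qed.

Lemma prodMz (B C : zmodType) (x : B) (y : C) (z : int) :
  (x, y) *~ z = (x *~ z, y *~ z).
Proof.
have nat_case i : (x, y) *+ i = (x *+ i, y *+ i).
  by elim: i => [//|i IH]; rewrite !mulrS IH.
by case: z => i; rewrite ?NegzE ?mulrNz -!pmulrn nat_case.
Qed.

(** A partial map extends over b: if n b is the first multiple of b in the
    domain, divisibility provides an n-th part of its image as value at b. *)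
Lemma functional_rel_step (B : zmodType) (G : set (B * QZ)) b : functional_rel G ->
  exists G', [/\ functional_rel G', G `<=` G' & exists d, G' (b, d)].
Proof.
move=> [sG G0].
pose H := [set x : B | exists d, G (x, d)].
have sH : subgroup H.
  split; first by exists 0; exact: sG.1.
  by move=> u v [d Gu] [d' Gv]; exists (d - d'); exact: (sG.2 _ _ Gu Gv).
have [n Hn] := subgroup_order sH b.
have [d Gn] : H (b *~ n) by apply/Hn; exact: dvdzz.
have [e en] := QZ_divisible d n.
have {}en : e *+ n = d.
  have [/en//|n0] := ltnP 0 n.
  by move: Gn; move: n0; rewrite leqn0 => /eqP ->; rewrite mulr0z => /G0 ->; rewrite mulr0n.
have key m d' : G (b *~ m, d') -> d' = e *~ m.
  move=> Gm; have /Hn/dvdzP[q mE] : H (b *~ m) by exists d'.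
  rewrite mE mulrC mulrzA -pmulrn en; apply/eqP; rewrite -subr_eq0; apply/eqP/G0.
  have -> : (0, d' - d *~ q) = (b *~ m, d') - (b *~ n, d) *~ q :> B * QZ.
    rewrite mE mulrC.
    rewrite prodMz -mulrzA; congr pair.
    by rewrite /= subrr.
  by apply: sG.2 => //; exact: subgroupMz.
exists [set u | exists m : int, G (u - (b, e) *~ m)]; split.
- split.
    split; first by exists 0; rewrite mulr0z subr0; exact: sG.1.
    move=> u v [m Gu] [m' Gv]; exists (m - m').
    have -> : u - v - (b, e) *~ (m - m') = (u - (b, e) *~ m) - (v - (b, e) *~ m').
      by rewrite mulrzBr subrACA.
    exact: sG.2.
  move=> d' [m]; have -> : (0, d') - (b, e) *~ m = - (b *~ m, e *~ m - d').
    by rewrite prodMz; congr pair; rewrite /= ?sub0r ?opprB.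
  move=> /(subgroupN sG); rewrite opprK => /key /eqP.
  by rewrite subr_eq addrC -subr_eq subrr => /eqP <-.
- by move=> u Gu; exists 0; rewrite mulr0z subr0.
- by exists e; exists 1; rewrite mulr1z subrr; exact: sG.1.
Qed.

(** Baer's argument: a maximal extension, given by Zorn's lemma, is defined
    everywhere by the previous lemma. *)
Lemma QZ_extends (B : zmodType) (G : set (B * QZ)) : functional_rel G ->
  exists2 h : B -> QZ, zmod_morphism h & forall u, G u -> h u.1 = u.2.
Proof.
move=> fG.
(* the empty set is the union of the empty chain *)
pose Pr X := X = set0 \/ (functional_rel X /\ G `<=` X).
have [F FP Ftot|X [PX Xmax]] := @Zorn_bigcup _ Pr.
  have [[X0 FX0 [u0 Xu0]]|F0] := pselect (exists2 X, F X & X !=set0); last first.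
    left; rewrite -subset0 => u [X FX Xu]; exfalso; apply: F0; exists X => //.
    by exists u.
  have good X : F X -> X !=set0 -> functional_rel X /\ G `<=` X.
    by move=> /FP[->|//] [].
  have {}good X u : F X -> X u -> functional_rel X /\ G `<=` X.
    by move=> FX Xu; apply: good => //; exists u.
  have [[[sX0 _] _] GX0] := good _ _ FX0 Xu0.
  right; split; last by move=> u /GX0; exists X0.
  split; first split.
  - by exists X0.
  - move=> u v [X FX Xu] [Y FY Yv].
    have [[sX _] _] := good _ _ FX Xu; have [[sY _] _] := good _ _ FY Yv.
    have [XY|YX] := Ftot _ _ FX FY.
      by exists Y => //; apply: sY.2 => //; exact: XY.
    by exists X => //; apply: sX.2 => //; exact: YX.
  - by move=> d [X FX Xd]; have [[_ fX] _] := good _ _ FX Xd; exact: fX.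
have {PX} [fX GX] : functional_rel X /\ G `<=` X.
  case: PX => // X0; exfalso; apply: (Xmax G); last by right; split.
  rewrite X0; split; [exact: sub0set|].
  by move=> /(_ (0, 0)); apply; exact: fG.1.1.
have tot b : exists d, X (b, d).
  apply: contrapT => nb.
  have [X' [fX' XX' [d X'd]]] := functional_rel_step b fX.
  apply: (Xmax X'); last by right; split => //; exact: subset_trans XX'.
  by split => // X'X; apply: nb; exists d; exact: X'X.
have unique b d d' : X (b, d) -> X (b, d') -> d = d'.
  move=> Xd Xd'; apply/eqP; rewrite -subr_eq0; apply/eqP/fX.2.
  by rewrite -(subrr b); exact: (fX.1.2 _ _ Xd Xd').
exists (fun b => projT1 (cid (tot b))) => [x y|[b d] /GX Xd].
  case: cid => d /= Xd; case: cid => d1 /= Xd1; case: cid => d2 /= Xd2.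
  by apply: unique Xd _; exact: (fX.1.2 _ _ Xd1 Xd2).
by case: cid => d' /= Xd'; exact: unique Xd.
Qed.

(** On the subgroup generated by H and b, send H to 0 and b to an element of
    Q/Z killed by the order of b modulo H; then extend. *)
Lemma QZ_separates (B : zmodType) (H : set B) b : subgroup H -> ~ H b ->
  exists h : B -> QZ, [/\ zmod_morphism h, forall u, H u -> h u = 0 & h b != 0].
Proof.
move=> sH Hb; have [n Hn] := subgroup_order sH b.
have [|d d0 dn] := @QZ_torsion n.
  by apply/eqP => n1; apply: Hb; rewrite -[b]mulr1z; apply/Hn; rewrite n1.
pose G := [set u : B * QZ | exists m : int, H (u.1 - b *~ m) /\ u.2 = d *~ m].
have fG : functional_rel G.
  split; first split.
  - by exists 0; rewrite !mulr0z subr0; split => //; exact: sH.1.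
  - move=> u v [m [Hu uE]] [m' [Hv vE]]; exists (m - m'); split => /=.
      have -> : (u - v).1 - b *~ (m - m') = (u.1 - b *~ m) - (v.1 - b *~ m').
        by rewrite mulrzBr [(u - v).1]/(u.1 - v.1) subrACA.
      exact: sH.2.
    by rewrite /= uE vE mulrzBr.
  - move=> d' [m [/= + ->]]; rewrite sub0r => /(subgroupN sH).
    rewrite opprK => /Hn/dvdzP[q ->].
    by rewrite mulrC mulrzA -pmulrn dn mul0rz.
have [h ah hG] := QZ_extends fG.
exists h; split => // [u Hu|].
  by rewrite (hG (u, 0))//; exists 0; rewrite !mulr0z subr0.
rewrite (hG (b, d))//; exists 1; rewrite !mulr1z subrr; split=> //; exact: sH.1.
Qed.

(** * Germs, and products of injective skyscrapers *)

Definition opensI (T : topologicalType) (U V : opens T) : opens T :=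
  Opens (openI (opensP U) (opensP V)).
Lemma opensIl (T : topologicalType) (U V : opens T) : opensI U V `<=` U.
Proof. by move=> x []. Qed.
Lemma opensIr (T : topologicalType) (U V : opens T) : opensI U V `<=` V.
Proof. by move=> x []. Qed.
Definition opensT (T : topologicalType) : opens T := Opens (@openT T).

Section Germs.
Variables (k : comNzRingType) (T : topologicalType) (F : sheaf k T) (x : T).

(** The stalk of F at x is needed only as an abelian group: a k-linear map from
    it to Hom(k, Q/Z) amounts to an additive map to Q/Z. *)
Record pregerm := PreGerm {
  pg_open : opens T; pg_mem : oset pg_open x; pg_sec : sec F pg_open }.

HB.instance Definition _ := gen_eqMixin pregerm.
HB.instance Definition _ := gen_choiceMixin pregerm.

Definition germ_rel (a b : pregerm) : bool :=
  `[< exists (W : opens T) (Wa : W `<=` pg_open a) (Wb : W `<=` pg_open b),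
      oset W x /\ res Wa (pg_sec a) = res Wb (pg_sec b) >].

Lemma germ_rel_equiv : equiv_class_of germ_rel.
Proof.
split=> [a|a b|b a c].
- by apply/asboolP; exists (pg_open a), (@subset_refl _ _), (@subset_refl _ _); split => //; exact: pg_mem.
- by apply/asboolP/asboolP => -[W [Wa [Wb [Wx e]]]]; exists W, Wb, Wa.
- move=> /asboolP[W [Wa [Wb [Wx e]]]] /asboolP[W' [Wb' [Wc [Wx' e']]]].
  apply/asboolP; exists (opensI W W').
  exists (subset_trans (@opensIl _ _ _) Wa), (subset_trans (@opensIr _ _ _) Wc); split => //.
  rewrite -(res_comp Wa (@opensIl _ _ _)) e -(res_comp Wc (@opensIr _ _ _)) -e'.
  by rewrite !(res_comp _ _ (subset_trans (@opensIl _ _ _) Wb)).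
Qed.

Canonical germ_equiv := EquivRelPack germ_rel_equiv.
Canonical germ_encModRel := defaultEncModRel germ_rel.

Definition germs := {eq_quot germ_rel}%qT.
HB.instance Definition _ : EqQuotient pregerm germ_rel germs := EqQuotient.on germs.
HB.instance Definition _ := Choice.on germs.

Definition germ (U : opens T) (Ux : oset U x) (s : sec F U) : germs :=
  (\pi_germs (PreGerm Ux s))%qT.

Lemma germ_eqP (U V : opens T) (Ux : oset U x) (Vx : oset V x) s t :
  germ Ux s = germ Vx t <->
  exists (W : opens T) (WU : W `<=` U) (WV : W `<=` V),
    oset W x /\ res WU s = res WV t.
Proof.
split=> [/eqP|h]; first by rewrite piE => /asboolP.
by apply/eqP; rewrite piE; apply/asboolP.
Qed.

Lemma germ_res (U V : opens T) (Ux : oset U x) (Vx : oset V x) (VU : V `<=` U) s :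
  germ Vx (res VU s) = germ Ux s.
Proof.
by apply/germ_eqP; exists V, (@subset_refl _ _), VU; split => //; rewrite res_id.
Qed.

Lemma germ_surj (a : germs) : exists (U : opens T) (Ux : oset U x) s, a = germ Ux s.
Proof.
elim/quotW: a => -[U Ux s]; by exists U, Ux, s.
Qed.

Lemma germ_surj2 (a b : germs) :
  exists (U : opens T) (Ux : oset U x) s t, a = germ Ux s /\ b = germ Ux t.
Proof.
have [U [Ux [s ->]]] := germ_surj a; have [V [Vx [t ->]]] := germ_surj b.
exists (opensI U V), (conj Ux Vx), (res (@opensIl _ _ _) s), (res (@opensIr _ _ _) t).
by rewrite !germ_res.
Qed.

Lemma germ_surj3 (a b c : germs) :
  exists (U : opens T) (Ux : oset U x) s t u,
    [/\ a = germ Ux s, b = germ Ux t & c = germ Ux u].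
Proof.
have [U [Ux [s [t [-> ->]]]]] := germ_surj2 a b; have [V [Vx [u ->]]] := germ_surj c.
exists (opensI U V), (conj Ux Vx).
exists (res (@opensIl _ _ _) s), (res (@opensIl _ _ _) t), (res (@opensIr _ _ _) u).
by rewrite !germ_res.
Qed.

Definition germ0 : germs := germ (U := opensT T) I 0.
Definition germ_opp (a : germs) : germs :=
  let g := repr a in germ (pg_mem g) (- pg_sec g).
Definition germ_add (a b : germs) : germs :=
  let g := repr a in let h := repr b in
  germ (U := opensI (pg_open g) (pg_open h)) (conj (pg_mem g) (pg_mem h))
    (res (@opensIl _ _ _) (pg_sec g) + res (@opensIr _ _ _) (pg_sec h)).

Lemma repr_germ (U : opens T) (Ux : oset U x) s :
  let g := repr (germ Ux s) in germ (pg_mem g) (pg_sec g) = germ Ux s.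
Proof. by move=> g; have := reprK (germ Ux s); rewrite -/g; case: g. Qed.

Lemma germ0E (U : opens T) (Ux : oset U x) : germ Ux 0 = germ0.
Proof.
apply/germ_eqP; exists U, (@subset_refl _ _), (@subsetT _ _); split => //.
by rewrite !raddf0.
Qed.

Lemma germ_oppE (U : opens T) (Ux : oset U x) s : germ_opp (germ Ux s) = germ Ux (- s).
Proof.
rewrite /germ_opp; have /germ_eqP[W [Wg [WU [Wx e]]]] := repr_germ Ux s.
by apply/germ_eqP; exists W, Wg, WU; split => //; rewrite !raddfN /= e.
Qed.

Lemma germ_addE (U : opens T) (Ux : oset U x) s t :
  germ_add (germ Ux s) (germ Ux t) = germ Ux (s + t).
Proof.
rewrite /germ_add; have /= := repr_germ Ux s; have /= := repr_germ Ux t.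
move: (repr (germ Ux s)) (repr (germ Ux t)) => g h.
move=> /germ_eqP[W' [Wg' [WU' [Wx' e']]]] /germ_eqP[W [Wg [WU [Wx e]]]].
apply/germ_eqP; exists (opensI W W').
have I1 : opensI W W' `<=` opensI (pg_open g) (pg_open h).
  by move=> y [Wy Wy']; split; [exact: (Wg y)|exact: (Wg' y)].
have I2 : opensI W W' `<=` U by move=> y [/WU].
exists I1, I2; split => //; rewrite !raddfD /=; congr (_ + _).
  rewrite (res_comp _ _ (subset_trans (@opensIl _ _ _) Wg)).
  by rewrite -(res_comp Wg (@opensIl _ _ _)) e res_comp.
rewrite (res_comp _ _ (subset_trans (@opensIr _ _ _) Wg')).
by rewrite -(res_comp Wg' (@opensIr _ _ _)) e' res_comp.
Qed.

Lemma germ_addA : associative germ_add.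
Proof.
move=> a b c; have [U [Ux [s [t [u [-> -> ->]]]]]] := germ_surj3 a b c.
by rewrite !germ_addE addrA.
Qed.

Lemma germ_addC : commutative germ_add.
Proof.
move=> a b; have [U [Ux [s [t [-> ->]]]]] := germ_surj2 a b.
by rewrite !germ_addE addrC.
Qed.

Lemma germ_add0 : left_id germ0 germ_add.
Proof.
by move=> a; have [U [Ux [s ->]]] := germ_surj a; rewrite -(germ0E Ux) germ_addE add0r.
Qed.

Lemma germ_addN : left_inverse germ0 germ_opp germ_add.
Proof.
move=> a; have [U [Ux [s ->]]] := germ_surj a.
by rewrite germ_oppE germ_addE addNr germ0E.
Qed.

HB.instance Definition _ := GRing.isZmodule.Build germs
  germ_addA germ_addC germ_add0 germ_addN.

Lemma germB (U : opens T) (Ux : oset U x) : zmod_morphism (germ Ux).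
Proof. by move=> s t; rewrite -germ_addE -germ_oppE. Qed.

Lemma germ_eq0 (U : opens T) (Ux : oset U x) s : germ Ux s = 0 <->
  exists (W : opens T) (WU : W `<=` U), oset W x /\ res WU s = 0.
Proof.
rewrite -[0 in X in X <-> _](germ0E Ux); split=> [/germ_eqP[W [WU [WU' [Wx e]]]]|[W [WU [Wx e]]]].
  by exists W, WU; split => //; rewrite e raddf0.
by apply/germ_eqP; exists W, WU, WU; rewrite e raddf0.
Qed.

End Germs.
Arguments germ {k T F x U} Ux s.

Section Dual.
Variable k : comNzRingType.

Definition additive_pred : {pred (k -> QZ)} := fun f => `[< zmod_morphism f >].

Lemma additive_pred_closed : zmod_closed additive_pred.
Proof.
split=> [|f g /asboolP fD /asboolP gD]; first by apply/asboolP => x y; rewrite subr0.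
by apply/asboolP => x y; rewrite !fctE fD gD subrACA.
Qed.
HB.instance Definition _ := GRing.isZmodClosed.Build (k -> QZ) additive_pred
  additive_pred_closed.

(** The k-module Hom(k, Q/Z), an injective cogenerator of the k-modules. *)
Record kdual := KDual { kd_fun :> k -> QZ; kd_funP : kd_fun \in additive_pred }.
HB.instance Definition _ := [isSub of kdual for @kd_fun].
HB.instance Definition _ := [Choice of kdual by <:].
HB.instance Definition _ := [SubChoice_isSubZmodule of kdual by <:].

Lemma kdB (f : kdual) : zmod_morphism f.
Proof. exact/asboolP/kd_funP. Qed.
Lemma kdD (f : kdual) : {morph f : a b / a + b}.
Proof.
have f0 : f 0 = 0 by have := kdB f 0 0; rewrite !subrr.
by move=> a b; rewrite -[b in LHS]opprK kdB -[- b]sub0r kdB f0 sub0r opprK.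
Qed.

Lemma kd_scale_subproof (a : k) (f : kdual) : (fun c => f (a * c)) \in additive_pred.
Proof. by apply/asboolP => x y; rewrite mulrBr kdB. Qed.
Definition kd_scale a f := KDual (kd_scale_subproof a f).

Lemma kdual_eq (f g : kdual) : f =1 g -> f = g.
Proof. by move=> fg; apply/val_inj/funext. Qed.

Lemma kd_scaleA a b f : kd_scale a (kd_scale b f) = kd_scale (a * b) f.
Proof. by apply: kdual_eq => c /=; rewrite mulrCA mulrA. Qed.
Lemma kd_scale1 : left_id 1 kd_scale.
Proof. by move=> f; apply: kdual_eq => c /=; rewrite mul1r. Qed.
Lemma kd_scaleDr : right_distributive kd_scale +%R.
Proof. by move=> a f g; apply: kdual_eq. Qed.
Lemma kd_scaleDl f : {morph kd_scale^~ f : a b / a + b}.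
Proof. by move=> a b; apply: kdual_eq => c /=; rewrite mulrDl kdD. Qed.

HB.instance Definition _ := GRing.Zmodule_isLmodule.Build k kdual
  kd_scaleA kd_scale1 kd_scaleDr kd_scaleDl.

End Dual.

Section Sky.
Variables (k : comNzRingType) (T : topologicalType) (L : Type) (p : L -> T).

(** The product over l in L of the skyscraper sheaves at p l with fibre
    Hom(k, Q/Z); a section over U is extended by 0 to the l with p l outside U. *)
Definition sky_pred (U : opens T) : {pred (L -> kdual k)} :=
  fun f => `[< forall l, ~ oset U (p l) -> f l = 0 >].

Lemma sky_submod U : submod_closed (sky_pred U).
Proof.
split; first by apply/asboolP.
move=> a f g /asboolP f0 /asboolP g0; apply/asboolP=> l lU.
by rewrite !fctE f0// g0// scaler0 addr0.
Qed.

HB.instance Definition _ U := GRing.isSubmodClosed.Build k (L -> kdual k) (sky_pred U)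
  (sky_submod U).

Record sky_type (U : opens T) := Sky {
  sky_fun :> L -> kdual k; sky_funP : sky_fun \in sky_pred U }.

HB.instance Definition _ U := [isSub of sky_type U for @sky_fun U].
HB.instance Definition _ U := [Choice of sky_type U by <:].
HB.instance Definition _ U := [SubChoice_isSubLmodule of sky_type U by <:].

Lemma sky_out U (f : sky_type U) l : ~ oset U (p l) -> f l = 0.
Proof. by have /asboolP := sky_funP f; exact. Qed.

Lemma sky_eq U (f g : sky_type U) : (forall l, oset U (p l) -> f l = g l) -> f = g.
Proof.
move=> fg; apply/val_inj/funext => l /=.
by have [/fg//|nU] := pselect (oset U (p l)); rewrite !sky_out.
Qed.

Lemma sky_cut_subproof (V : opens T) (f : L -> kdual k) :
  (fun l => if `[< oset V (p l) >] then f l else 0) \in sky_pred V.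
Proof. by apply/asboolP => l Vl; case: asboolP. Qed.

Definition sky_cut V f : sky_type V := Sky (sky_cut_subproof V f).

Lemma sky_cutE V f l : oset V (p l) -> sky_cut V f l = f l.
Proof. by move=> Vl /=; rewrite asboolT. Qed.

Definition sky_res (U V : opens T) (VU : V `<=` U) (f : sky_type U) := sky_cut V f.

Lemma sky_res_linear (U V : opens T) (VU : V `<=` U) : linear (sky_res VU).
Proof.
move=> a f g; apply: sky_eq => x Vx; rewrite sky_cutE//.
have E W (f' g' : sky_type W) : (a *: f' + g') x = a *: f' x + g' x by [].
by rewrite !E !sky_cutE.
Qed.

HB.instance Definition _ (U V : opens T) (VU : V `<=` U) :=
  GRing.isLinear.Build k (sky_type U) (sky_type V) *:%R (sky_res VU)
    (sky_res_linear VU).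

Lemma sky_res_id (U : opens T) (UU : U `<=` U) s : sky_res UU s = s.
Proof. by apply: sky_eq => x Ux; rewrite sky_cutE. Qed.

Lemma sky_res_comp (U V W : opens T) (VU : V `<=` U) (WV : W `<=` V)
  (WU : W `<=` U) s : sky_res WV (sky_res VU s) = sky_res WU s.
Proof. by apply: sky_eq => x Wx; rewrite !sky_cutE//; exact: WV. Qed.

Lemma sky_sep (J : Type) (U : opens T) (V : J -> opens T)
    (VU : forall i, V i `<=` U) : U `<=` \bigcup_i V i ->
  forall s t : sky_type U,
  (forall i, sky_res (VU i) s = sky_res (VU i) t) -> s = t.
Proof.
move=> UV s t st; apply: sky_eq => x /UV[i _ Vx].
by have /(congr1 (fun f => sky_fun f x)) := st i; rewrite !sky_cutE.
Qed.

Lemma sky_glue (J : Type) (U : opens T) (V : J -> opens T)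
    (VU : forall i, V i `<=` U) : U `<=` \bigcup_i V i ->
  forall s : (forall i, sky_type (V i)),
  (forall i j (W : opens T) (Wi : W `<=` V i) (Wj : W `<=` V j),
     sky_res Wi (s i) = sky_res Wj (s j)) ->
  exists t : sky_type U, forall i, sky_res (VU i) t = s i.
Proof.
move=> UV s sc.
have sE i j l : oset (V i) (p l) -> oset (V j) (p l) -> s i l = s j l.
  move=> Vil Vjl.
  have := sc i j (opensI (V i) (V j)) (@opensIl _ _ _) (@opensIr _ _ _).
  by move=> /(congr1 (fun f => sky_fun f l)); rewrite !sky_cutE.
pose g l : kdual k := if pselect (exists i, oset (V i) (p l)) is left h
                  then s (projT1 (cid h)) l else 0.
exists (sky_cut U g) => i; apply: sky_eq => l Vl.
rewrite !sky_cutE//; last exact: VU Vl.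
rewrite /g; case: pselect => [h|[]]; last by exists i.
by case: cid => j Vjx /=; exact: sE.
Qed.

Definition sky : sheaf k T :=
  @Sheaf k T (fun U => sky_type U)
    (fun U V VU => sky_res VU : {linear sky_type U -> sky_type V})
    sky_res_id sky_res_comp sky_sep sky_glue.

Lemma sky_flabby (U V : opens T) (VU : V `<=` U) (s : sec sky V) :
  exists t : sec sky U, res VU t = s.
Proof. by exists (sky_cut U s); apply: sky_eq => l Vl /=; rewrite !asboolT//; exact: VU. Qed.

Lemma sky_eq0 (U : opens T) (s : sec sky U) : (forall l, ~ oset U (p l)) -> s = 0.
Proof. by move=> h; apply: sky_eq => l /h. Qed.

End Sky.

Section SkyHom.
Variables (k : comNzRingType) (T : topologicalType) (G : sheaf k T).
Variables (L : Type) (p : L -> T) (m : forall l, germs G (p l) -> QZ).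
Hypothesis mB : forall l, zmod_morphism (@m l).

(** A family of additive maps m l from the stalks G_(p l) to Q/Z is the same as
    a morphism from G to the product of skyscrapers: the component at l sends s
    to the map c |-> m l (c s). *)
Definition germ_fun (U : opens T) (s : sec G U) (l : L) : k -> QZ := fun c =>
  if pselect (oset U (p l)) is left Ul then m (germ Ul (c *: s)) else 0.

Lemma germ_fun_additive U s l : @germ_fun U s l \in @additive_pred k.
Proof.
apply/asboolP => a b; rewrite /germ_fun; case: pselect => [Ul|]; last by rewrite subr0.
by rewrite scalerBl germB mB.
Qed.

Lemma germ_sky_subproof U s :
  (fun l => KDual (@germ_fun_additive U s l)) \in @sky_pred k T L p U.
Proof.
by apply/asboolP => l Ul; apply: kdual_eq => c /=; rewrite /germ_fun; case: pselect.
Qed.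
Definition germ_sky U (s : sec G U) : sky_type k p U := Sky (germ_sky_subproof s).

Lemma germ_skyE U (s : sec G U) l c (Ul : oset U (p l)) :
  germ_sky s l c = m (germ Ul (c *: s)).
Proof.
rewrite /= /germ_fun; case: pselect => // Ul'.
by rewrite (Prop_irrelevance Ul' Ul).
Qed.

Lemma germ_map0 l : m (0 : germs G (p l)) = 0.
Proof. by have := mB (0 : germs G (p l)) 0; rewrite !subrr. Qed.
Lemma germ_mapD l (a b : germs G (p l)) : m (a + b) = m a + m b.
Proof. by rewrite -[b in LHS]opprK mB -[- b]sub0r mB germ_map0 sub0r opprK. Qed.

Lemma germ_sky_linear U : linear (@germ_sky U).
Proof.
move=> a s t; apply: sky_eq => l Ul; apply: kdual_eq => c.
have -> : (a *: germ_sky s + germ_sky t) l c = germ_sky s l (a * c) + germ_sky t l c by [].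
rewrite !(germ_skyE _ _ Ul) -germ_mapD; congr m.
by rewrite [RHS]germ_addE scalerDr scalerA mulrC.
Qed.
HB.instance Definition _ U := GRing.isLinear.Build k (sec G U) (sky_type k p U) *:%R
  (@germ_sky U) (@germ_sky_linear U).

Lemma germ_sky_res (U V : opens T) (VU : V `<=` U) s :
  germ_sky (res VU s) = sky_res VU (germ_sky s).
Proof.
apply: sky_eq => l Vl; apply: kdual_eq => c; rewrite sky_cutE//.
rewrite (germ_skyE _ _ Vl) (germ_skyE _ _ (VU _ Vl)).
have -> : c *: res VU s = res VU (c *: s) by rewrite linearZ.
congr m; exact: germ_res.
Qed.

Definition sky_hom : sheaf_hom G (sky k p) :=
  @SheafHom k T G (sky k p) (fun U => @germ_sky U : {linear _ -> _}) germ_sky_res.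

End SkyHom.

(** A morphism to a product of skyscrapers is a family of additive maps on
    stalks. A monomorphism of sheaves is injective on stalks, so each of them
    extends to the larger stalk. *)
Lemma sky_injective (k : comNzRingType) (T : topologicalType) (L : Type) (p : L -> T) :
  injective_sheaf (sky k p).
Proof.
move=> A B i f i_mono.
have ex l : exists m : germs B (p l) -> QZ, zmod_morphism m /\
   forall (U : opens T) (Ul : oset U (p l)) (a : sec A U), m (germ Ul (i U a)) = f U a l 1.
  pose G := [set u : germs B (p l) * QZ | exists (U : opens T) (Ul : oset U (p l)) (a : sec A U),
     u = (germ Ul (i U a), f U a l 1)].
  have fres (U V : opens T) (VU : V `<=` U) (a : sec A U) (Vl : oset V (p l)) : f V (res VU a) l = f U a l.
    by rewrite happ_res/= asboolT.
  have [|h hB hG] := @QZ_extends _ G; last first.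
    by exists h; split => // U Ul a; apply: (hG (_, _)); exists U, Ul, a.
  split; first split.
  - exists (opensT T), I, 0; rewrite !raddf0; congr pair; exact/esym/germ0E.
  - move=> _ _ [U [Ul [a ->]]] [V [Vl [b ->]]].
    exists (opensI U V), (conj Ul Vl), (res (@opensIl _ _ _) a - res (@opensIr _ _ _) b).
    congr pair.
      by rewrite raddfB germB/= !happ_res !germ_res.
    by rewrite /= -(fres _ _ (@opensIl _ U V) a (conj Ul Vl))
      -(fres _ _ (@opensIr _ U V) b (conj Ul Vl)) raddfB.
  - move=> d [U [Ul [a [/esym/germ_eq0[W [WU [Wl e]]] ->]]]].
    rewrite -(fres _ _ WU)//.
    have -> : res WU a = 0 by apply: (i_mono W); rewrite happ_res e raddf0.
    by rewrite raddf0.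
pose m l := projT1 (cid (ex l)).
have mB l : zmod_morphism (m l) by rewrite /m; case: cid => ? [].
have mE l (U : opens T) (Ul : oset U (p l)) (a : sec A U) : m l (germ Ul (i U a)) = f U a l 1.
  by rewrite /m; case: cid => ? [] /=.
exists (sky_hom mB) => U s; apply: sky_eq => l Ul; apply: kdual_eq => c.
rewrite (germ_skyE mB _ _ Ul) -linearZ mE linearZ.
by rewrite -[RHS](congr1 (f U s l) (mulr1 c)).
Qed.

(** * Injective resolutions with prescribed support *)

(** The stalks of F outside A are zero. *)
Definition supported (k : comNzRingType) (T : topologicalType) (A : set T) (F : sheaf k T) :=
  forall (U : opens T) (s : sec F U) x, oset U x -> ~ A x ->
    exists (V : opens T) (VU : V `<=` U), oset V x /\ res VU s = 0.

Section Cokernel.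
Variables (k : comNzRingType) (T : topologicalType) (A : set T).
Variables (F G : sheaf k T) (f : sheaf_hom F G).

(** All additive maps from the stalk of the cokernel of f to Q/Z at all points of
    A; indexing skyscrapers by them embeds the cokernel without having to
    sheafify it. *)
Record coker_index := CokerIndex {
  ci_pt : T;
  ci_in : A ci_pt;
  ci_m : germs G ci_pt -> QZ;
  ci_mB : zmod_morphism ci_m;
  ci_f : forall (U : opens T) (Ux : oset U ci_pt) (r : sec F U), ci_m (germ Ux (f U r)) = 0
}.

Definition coker_hom : sheaf_hom G (sky k ci_pt) := sky_hom ci_mB.

(** A germ outside the image of f is detected by some additive map to Q/Z that
    kills this image. *)
Lemma coker_exact : supported A G -> sheaf_exact f coker_hom.
Proof.
move=> suppG U t; split=> [et0 x Ux|tf].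
  have [Ax|nAx] := pselect (A x); last first.
    have [V [VU [Vx tV]]] := suppG U t x Ux nAx.
    by exists V, VU, 0; rewrite tV raddf0.
  pose H := [set g : germs G x | exists (V : opens T) (Vx : oset V x) (r : sec F V), g = germ Vx (f V r)].
  have sH : subgroup H.
    split; first by exists U, Ux, 0; rewrite raddf0; exact/esym/germ0E.
    move=> _ _ [V [Vx [r ->]]] [V' [Vx' [r' ->]]].
    exists (opensI V V'), (conj Vx Vx'), (res (@opensIl _ _ _) r - res (@opensIr _ _ _) r').
    by rewrite raddfB germB/= !happ_res !germ_res.
  have [|nH] := pselect (H (germ Ux t)).
    move=> [V [Vx [r /germ_eqP[W [WU [WV [Wx e]]]]]]].
    by exists W, WU, (res WV r); rewrite happ_res.
  have [m [mB mH /eqP]] := QZ_separates sH nH; case.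
  have mf (V : opens T) (Vx : oset V x) (r : sec F V) : m (germ Vx (f V r)) = 0.
    by apply: mH; exists V, Vx, r.
  have E := germ_skyE (l := CokerIndex Ax mB mf) ci_mB t 1 Ux.
  rewrite -[t in germ Ux t]scale1r; apply: etrans (esym E) _.
  exact: (congr1 (fun g : sky_type k ci_pt U => g (CokerIndex Ax mB mf) 1) et0).
apply: sky_eq => l Ul; apply: kdual_eq => c; rewrite (germ_skyE ci_mB t c Ul).
have [V [VU [s [Vl e]]]] := tf _ Ul.
rewrite -(germ_res Ul Vl VU) linearZ -e -linearZ.
exact: ci_f.
Qed.

End Cokernel.

Lemma sep_near (k : comNzRingType) (T : topologicalType) (S : sheaf k T) (U : opens T) (s t : sec S U) :
  (forall x, oset U x -> exists (V : opens T) (VU : V `<=` U), oset V x /\ res VU s = res VU t) ->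
  s = t.
Proof.
move=> st.
pose V (x : {x | oset U x}) := projT1 (cid (st _ (svalP x))).
have V_sub x : V x `<=` U by rewrite /V; case: cid => ? [].
apply: (@sheaf_sep _ _ _ _ _ V V_sub).
  by move=> x Ux; exists (exist _ x Ux) => //; rewrite /V; case: cid => ? [? []].
move=> x; move: (V_sub x); rewrite /V; case: cid => W /= [WU [_ e]] WU'.
by rewrite (Prop_irrelevance WU' WU).
Qed.

Section ZeroHom.
Variables (k : comNzRingType) (T : topologicalType) (F G : sheaf k T).

Definition zero_hom : sheaf_hom F G.
exists (fun U => \0 : {linear sec F U -> sec G U}) => U V VU s.
by rewrite raddf0.
Defined.

Lemma exact_zero_mono (H : sheaf k T) (g : sheaf_hom G H) : sheaf_exact zero_hom g -> sheaf_mono g.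
Proof.
move=> ex U s t gst.
have : g U (s - t) = 0 by rewrite raddfB /= gst subrr.
move=> /ex st0; apply: sep_near => x /st0[V [VU [r [Vx e]]]].
exists V, VU; split => //; have /eqP : res VU (s - t) = 0 := esym e.
by rewrite raddfB subr_eq0 => /eqP.
Qed.

End ZeroHom.

Section Resolution.
Variables (k : comNzRingType) (T : topologicalType) (A : set T) (F : sheaf k T).
Hypothesis closedA : closed A.

(** A resolution is built by iterating the passage from a morphism f to a
    morphism out of its target with kernel the image of f. It starts from the
    zero endomorphism of F, so that the next morphism is a monomorphism. *)
Record arrow := Arrow { asrc : sheaf k T; atgt : sheaf k T; ahom : sheaf_hom asrc atgt }.
Definition next_arrow (a : arrow) := Arrow (@coker_hom k T A _ _ (ahom a)).
Definition nth_arrow (j : nat) := iter j next_arrow (Arrow (zero_hom F F)).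

Lemma sky_supported (L : Type) (p : L -> T) : (forall l, A (p l)) -> supported A (sky k p).
Proof.
move=> pA U s x Ux nAx.
have oAc : open (~` A) by rewrite openC.
exists (opensI U (Opens oAc)), (@opensIl _ _ _); split => //.
by apply: sky_eq0 => l [_]; apply; exact: pA.
Qed.

Lemma nth_arrow_supported : supported A F -> forall j, supported A (atgt (nth_arrow j)).
Proof.
move=> sF [//|j] /=; apply: sky_supported => l; exact: ci_in.
Qed.

Lemma nth_arrow_exact : supported A F -> forall j,
  sheaf_exact (ahom (nth_arrow j)) (ahom (nth_arrow j.+1)).
Proof. by move=> sF j; apply: coker_exact; exact: nth_arrow_supported. Qed.

Definition sky_resolution (sF : supported A F) : injective_resolution F :=
  @InjectiveResolution k T F (fun j => atgt (nth_arrow j.+1))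
    (fun j => ahom (nth_arrow j.+2)) (ahom (nth_arrow 1))
    (fun j => @sky_injective k T _ _)
    (exact_zero_mono (nth_arrow_exact sF (j := 0)))
    (nth_arrow_exact sF (j := 1)) (fun j => nth_arrow_exact sF (j := j.+2)).

Lemma sky_resolution_supported (sF : supported A F) j : supported A (ires (sky_resolution sF) j).
Proof. exact: (nth_arrow_supported sF). Qed.
End Resolution.

(** An injective sheaf embeds in a product of skyscrapers, hence is a retract of
    it, and flabbiness passes to retracts. *)
Lemma injective_flabby (k : comNzRingType) (T : topologicalType) (I : sheaf k T) :
  injective_sheaf I -> forall (U V : opens T) (VU : V `<=` U) (s : sec I V),
  exists t : sec I U, res VU t = s.
Proof.
move=> injI U V VU s.
have suppI : supported setT I by move=> W r x _ [].
have mono := exact_zero_mono (@coker_exact k T setT I I (zero_hom I I) suppI).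
pose id_hom := @SheafHom k T I I (fun U => idfun : {linear sec I U -> sec I U})
  (fun U V VU s => erefl).
have [g gE] := injI _ _ _ id_hom mono.
have [t te] := sky_flabby VU (coker_hom setT (zero_hom I I) V s).
by exists (g U t); rewrite -happ_res te gE.
Qed.

(** * Gluing, supported sheaves and arcs *)

Section SheafLemmas.
Variables (k : comNzRingType) (T : topologicalType).
Implicit Types F G H S : sheaf k T.

Lemma res_eq S (U V : opens T) (h h' : V `<=` U) (s : sec S U) : res h s = res h' s.
Proof. by rewrite (Prop_irrelevance h h'). Qed.

Lemma sec_empty S (U : opens T) (s t : sec S U) : (forall x, ~ oset U x) -> s = t.
Proof.
move=> U0; apply: (@sheaf_sep _ _ _ void U (fun=> U) (fun=> @subset_refl _ _)) => [x /U0//|[]].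
Qed.

Lemma glue2 S (U V1 V2 : opens T) (h1 : V1 `<=` U) (h2 : V2 `<=` U) s1 s2 :
  U `<=` V1 `|` V2 ->
  (forall (W : opens T) (W1 : W `<=` V1) (W2 : W `<=` V2), res W1 s1 = res W2 s2) ->
  exists t : sec S U, res h1 t = s1 /\ res h2 t = s2.
Proof.
move=> UV s12.
pose V (b : bool) := if b then V1 else V2.
have VU b : V b `<=` U by case: b.
pose s (b : bool) : sec S (V b) := if b as b' return sec S (V b') then s1 else s2.
have cov : U `<=` \bigcup_i V i.
  by move=> x /UV[]; [exists true|exists false].
have [|t tE] := sheaf_glue VU cov (s := s).
  case=> -[] W Wi Wj /=; [exact: res_eq|exact: s12|exact/esym/s12|exact: res_eq].
exists t; split; [apply: etrans (tE true)|apply: etrans (tE false)]; exact: res_eq.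
Qed.

Lemma glue2_unique S (U V1 V2 : opens T) (h1 : V1 `<=` U) (h2 : V2 `<=` U) (s t : sec S U) :
  U `<=` V1 `|` V2 -> res h1 s = res h1 t -> res h2 s = res h2 t -> s = t.
Proof.
move=> UV e1 e2; pose V (b : bool) := if b then V1 else V2.
have VU b : V b `<=` U by case: b.
apply: (@sheaf_sep _ _ _ _ _ V VU) => [x /UV[]|[]]; [by exists true|by exists false| |].
  by rewrite !(res_eq (VU true) h1).
by rewrite !(res_eq (VU false) h2).
Qed.

Lemma exact_mono_lift F G H (f : sheaf_hom F G) (g : sheaf_hom G H) :
  sheaf_mono f -> sheaf_exact f g ->
  forall (U : opens T) (t : sec G U), g U t = 0 -> exists s, f U s = t.
Proof.
move=> fm ex U t /ex loc.
pose V (x : {x | oset U x}) := projT1 (cid (loc _ (svalP x))).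
have V_sub x : V x `<=` U by rewrite /V; case: cid => ? [].
have ex_s x : exists s, f (V x) s = res (V_sub x) t.
  move: (V_sub x); rewrite /V; case: cid => W /= [WU [s [_ e]]] WU'.
  by exists s; rewrite e; exact: res_eq.
have cov : U `<=` \bigcup_x V x.
  by move=> x Ux; exists (exist _ x Ux) => //; rewrite /V; case: cid => ? [? [? []]].
pose s x := projT1 (cid (ex_s x)).
have sE x : f (V x) (s x) = res (V_sub x) t by rewrite /s; case: cid.
have [|u uE] := sheaf_glue V_sub cov (s := s).
  move=> i j W Wi Wj; apply: (fm W).
  by rewrite !happ_res !sE !(res_comp _ _ (subset_trans Wi (V_sub i))).
exists u; apply: (@sheaf_sep _ _ _ _ _ V V_sub cov) => x.
by rewrite -happ_res uE sE.
Qed.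

Lemma diff_diff F (I : injective_resolution F) j (U : opens T) (s : sec (ires I j) U) :
  idiff I j.+1 U (idiff I j U s) = 0.
Proof.
apply/(@idiff_exact _ _ _ I j) => x Ux.
by exists U, (@subset_refl _ _), s; split => //; rewrite res_id.
Qed.

Lemma diff_aug F (I : injective_resolution F) (U : opens T) (s : sec F U) :
  idiff I 0 U (iaug I U s) = 0.
Proof.
apply/(@iaug_exact _ _ _ I) => x Ux.
by exists U, (@subset_refl _ _), s; split => //; rewrite res_id.
Qed.

Section Supported.
Variables (A : set T) (S : sheaf k T).
Hypothesis suppS : supported A S.

(** Sections of a sheaf supported in A over U only depend on the trace of U on
    A: this lemma is uniqueness, the next two are existence. *)
Lemma supported_eq (U V : opens T) (VU : V `<=` U) (s t : sec S U) :
  (forall x, oset U x -> A x -> oset V x) -> res VU s = res VU t -> s = t.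
Proof.
move=> AV st; apply: sep_near => x Ux.
have [Ax|nAx] := pselect (A x).
  by exists V, VU; split => //; exact: AV.
have [N [NU [Nx sN]]] := suppS s Ux nAx.
have [N' [NU' [Nx' tN]]] := suppS t Ux nAx.
exists (opensI N N'), (subset_trans (@opensIl _ _ _) NU); split => //.
rewrite -(res_comp NU (@opensIl _ _ _)) sN raddf0.
have := congr1 (res (@opensIr _ N N')) tN; rewrite raddf0 => <-.
by rewrite !(res_comp _ _ (subset_trans (@opensIl _ _ _) NU)).
Qed.

Lemma supported_extend (U V : opens T) (VU : V `<=` U) (s : sec S V) : closed A ->
  (forall x, oset U x -> A x -> oset V x) -> exists t : sec S U, res VU t = s.
Proof.
move=> cA AV.
have oAc : open (~` A) by rewrite openC.
pose V2 := opensI U (Opens oAc).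
have [x Ux||t [tE _]] := @glue2 S U V V2 VU (@opensIl _ _ _) s 0.
- have [/(AV _ Ux)|] := pselect (A x); [by left|by right].
- move=> W W1 W2; rewrite raddf0; apply: sep_near => x Wx.
  have [N [NW [Nx e]]] := suppS (res W1 s) Wx (W2 _ Wx).2.
  by exists N, NW; rewrite e raddf0.
- by exists t.
Qed.

End Supported.

Lemma supported_shrink (A : set T) S (suppS : supported A S) (V : opens T)
  (N : opens T) : closed A ->
  (forall y, oset V y -> A y -> oset N y) ->
  forall (s : sec S N), exists t : sec S V,
  forall (Q : opens T) (QV : Q `<=` V) (QN : Q `<=` N), res QV t = res QN s.
Proof.
move=> cA VN s.
have [|t tE] := supported_extend suppS (@opensIl _ V N) (res (@opensIr _ V N) s) cA.
  by move=> y Vy Ay; split => //; exact: VN.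
exists t => Q QV QN.
have QI : Q `<=` opensI V N by move=> y Qy; split; [exact: QV|exact: QN].
rewrite -(res_comp (@opensIl _ V N) QI) tE.
by rewrite (res_comp _ _ QN).
Qed.

Lemma constant_supported (A : set T) : closed A -> supported A (constant_sheaf k A).
Proof.
move=> cA U s x Ux nAx.
have oAc : open (~` A) by rewrite openC.
exists (opensI U (Opens oAc)), (@opensIl _ _ _); split => //.
apply: csec_eq => y Vy; rewrite cresE//; apply: csec_out => -[_].
by case: Vy.
Qed.

Lemma constant_section (A : set T) (U : opens T) (c : k) : closed A ->
  exists g : csec_type k A U, forall x, oset U x -> A x -> g x = c.
Proof.
move=> cA.
pose g x : k^o := if `[< oset U x /\ A x >] then c else 0.
have gP : g \in csec A U.
  apply/asboolP; split=> x; first by rewrite /g => h; case: asboolP.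
  move=> Ux.
  have nU : nbhs x U by apply: open_nbhs_nbhs; split; [exact: opensP|].
  have [Ax|nAx] := pselect (A x).
    by apply: filterS nU => y Uy Ay; rewrite /g !asboolT.
  have : nbhs x (~` A) by apply: open_nbhs_nbhs; split => //; rewrite openC.
  by apply: filterS => y nAy Ay.
by exists (CSec gP) => x Ux Ax /=; rewrite /g asboolT.
Qed.

End SheafLemmas.

Lemma locally_constant_itv (R : realType) (X : Type) (h : R -> X) (a b : R) :
  (forall t, a < t < b -> \forall s \near t, h s = h t) ->
  forall s t, a < s < b -> a < t < b -> h s = h t.
Proof.
move=> hloc s t sab tab.
have cI : connected `]a, b[%classic by apply/connected_intervalP; exact: interval_is_interval.
pose B := [set u | a < u < b /\ h u = h t].
have op (Q : set X) : open [set u | a < u < b /\ Q (h u)].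
  rewrite openE => u [uab Qu].
  have : nbhs u `]a, b[%classic by apply: open_nbhs_nbhs; split; [exact: interval_open|rewrite /= in_itv].
  by apply: filterS2 (hloc u uab) => v hv; rewrite /= in_itv /= => vab; split => //; rewrite hv.
have : B = `]a, b[%classic.
  apply: cI.
  - by exists t.
  - exists B; first exact: (op [set x | x = h t]).
    by rewrite eqEsubset; split => u => [[uab e]|[_]//]; split; rewrite //= in_itv.
  - exists (~` [set u | a < u < b /\ h u <> h t]); first by rewrite closedC; exact: (op [set x | x <> h t]).
    rewrite eqEsubset; split => u.
      by move=> [uab e]; split; rewrite /= ?in_itv//= => -[].
    rewrite /= in_itv /= => -[uab nu]; split => //.
    by apply: contrapT => ne; apply: nu.
move=> /(congr1 (fun X => X s)) /= e.
suff [] : B s by [].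
by rewrite e in_itv.
Qed.

(** An open set whose trace on A is parametrized homeomorphically by an open
    interval centred at 0; the coordinate is defined on the whole open set. *)
Record arc (R : realType) (T : topologicalType) (A : set T) := Arc {
  arc_open : opens T;
  arc_coord : T -> R;
  arc_par : R -> T;
  arc_rad : R;
  arc_coord_cont : forall x, oset arc_open x -> {for x, continuous arc_coord};
  arc_par_cont : forall t, - arc_rad < t < arc_rad -> {for t, continuous arc_par};
  arc_parP : forall t, - arc_rad < t < arc_rad ->
    [/\ oset arc_open (arc_par t), A (arc_par t) & arc_coord (arc_par t) = t];
  arc_coordP : forall x, oset arc_open x -> A x ->
    - arc_rad < arc_coord x < arc_rad /\ arc_par (arc_coord x) = x
}.

Section Arc.
Variables (R : realType) (T : topologicalType) (A : set T) (C : arc R A).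
Local Notation tau := (arc_coord C).
Local Notation gam := (arc_par C).
Local Notation r := (arc_rad C).

Lemma slice_open a b : open (arc_open C `&` tau @^-1` `]a, b[%classic).
Proof.
rewrite openE => x [Wx xab].
have nI : nbhs (tau x) `]a, b[%classic by apply: open_nbhs_nbhs; split => //; exact: interval_open.
have nt : nbhs x (tau @^-1` `]a, b[%classic) := arc_coord_cont Wx nI.
have nW : nbhs x (arc_open C) by apply: open_nbhs_nbhs; split; [exact: opensP|].
exact: (filterI nW nt).
Qed.

Definition slice a b : opens T := Opens (slice_open a b).

Lemma sliceP a b x : oset (slice a b) x <-> oset (arc_open C) x /\ a < tau x < b.
Proof. by rewrite /= in_itv. Qed.

Lemma slice_sub a b a' b' : a' <= a -> b <= b' -> slice a b `<=` slice a' b'.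
Proof.
move=> aa bb x /sliceP[Wx /andP[ax xb]]; apply/sliceP; split => //.
by rewrite (le_lt_trans aa ax) (lt_le_trans xb bb).
Qed.

Lemma slice_near t (V : opens T) : - r < t < r -> oset V (gam t) ->
  exists2 e, 0 < e & forall x, oset (slice (t - e) (t + e)) x -> A x -> oset V x.
Proof.
move=> tr Vt.
have nV : nbhs (gam t) V by apply: open_nbhs_nbhs; split => //; exact: opensP.
have /nbhs_ballP[e /= e0 be] := arc_par_cont tr nV.
exists e => // x /sliceP[Wx xe] Ax.
have [_ <-] := arc_coordP Wx Ax.
by apply: be; rewrite /ball /= distrC ltr_distl.
Qed.

End Arc.

(** * Local cohomology at the end point of half an arc *)

Section ArcCohomology.
Variables (R : realType) (k : comNzRingType) (T : topologicalType) (A : set T).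
Variables (C : arc R A) (I : injective_resolution (constant_sheaf k A)).
Hypothesis closedA : closed A.
Hypothesis suppI : forall j, supported A (ires I j).
Local Notation tau := (arc_coord C).
Local Notation gam := (arc_par C).
Local Notation r := (arc_rad C).
Local Notation slice := (slice C).

(** The slices [slice a b] only matter through their traces on A, which are the
    arcs parametrized by the intervals. The empty interval a = b is included: it
    occurs as an overlap when a primitive starts growing. *)
Definition cocycles_extend j := forall a b a' b' (aa : a' <= a) (bb : b <= b'),
  - r <= a' -> a <= b -> b' <= r ->
  forall z : sec (ires I j) (slice a b), idiff I j _ z = 0 ->
  exists z' : sec (ires I j) (slice a' b'),
    idiff I j _ z' = 0 /\ res (slice_sub aa bb) z' = z.

Lemma slice_par a b t : - r <= a -> b <= r -> a < t < b -> oset (slice a b) (gam t).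
Proof.
move=> ra br /andP[at_ tb].
have tr : - r < t < r by rewrite (le_lt_trans ra at_) (lt_le_trans tb br).
by have [Wt _ tt] := arc_parP tr; apply/sliceP; rewrite tt at_ tb.
Qed.

Lemma arc_section_constant a b (g : csec_type k A (slice a b)) : - r <= a -> b <= r ->
  exists c, forall x, oset (slice a b) x -> A x -> g x = c.
Proof.
move=> ra br.
exists (g (gam ((a + b) / 2))) => x /[dup] Sx /sliceP[Wx xab] Ax.
have [_ <-] := arc_coordP Wx Ax.
have ab : a < b by case/andP: xab => ax; exact: lt_trans.
apply: (@locally_constant_itv _ _ (fun t => g (gam t)) a b) => //; last first.
  by rewrite midf_lt//= midf_lt.
move=> t tab.
have tr : - r < t < r.
  by case/andP: tab => at_ tb; rewrite (le_lt_trans ra at_) (lt_le_trans tb br).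
have near_g := csec_near g (slice_par ra br tab).
have near_t : \forall s \near t, A (gam s) -> g (gam s) = g (gam t) := arc_par_cont tr near_g.
have nt : nbhs t `]-r, r[%classic.
  by apply: open_nbhs_nbhs; split; [exact: interval_open|rewrite /= in_itv].
apply: filterS2 near_t nt => s gs; rewrite /= in_itv /= => sr.
by apply: gs; have [] := arc_parP sr.
Qed.

(** A cocycle of degree 0 is a section of the constant sheaf, constant along the
    arc because intervals are connected. *)
Lemma cocycles_extend0 : cocycles_extend 0.
Proof.
move=> a b a' b' aa bb ra ab br z dz.
have [g gz] := exact_mono_lift (@iaug_mono _ _ _ I) (@iaug_exact _ _ _ I) dz.
have [c gc] := arc_section_constant g (le_trans ra aa) (le_trans bb br).
have [g' g'c] := @constant_section k T A (slice a' b') c closedA.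
exists (iaug I (slice a' b') g'); split; first exact: diff_aug.
rewrite -happ_res -gz; congr (iaug I _ _).
apply: csec_eq => x Sx; rewrite cresE//.
have [Ax|nAx] := pselect (A x).
  by rewrite (gc _ Sx Ax) g'c//; exact: slice_sub Sx.
by rewrite !csec_out// => -[].
Qed.

Section Step.
Variable j : nat.
Hypothesis extj : cocycles_extend j.
Variables (a b : R) (z : sec (ires I j.+1) (slice a b)).
Hypotheses (ra : - r <= a) (br : b <= r) (dz : idiff I j.+1 _ z = 0).

(** A primitive y of z over ]c, d[ grows past t, which may be an end point: near
    t there is a local primitive; on the overlap of the two intervals it differs
    from y by a cocycle, which extends by the induction hypothesis, so the local
    primitive can be corrected to agree with y there. *)
Lemma primitive_step c d t (ac : a <= c) (ct : c <= t) (td : t <= d) (db : d <= b)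
    (y : sec (ires I j) (slice c d)) :
  a < t < b -> idiff I j _ y = res (slice_sub ac db) z ->
  exists c' d' (ac' : a <= c') (db' : d' <= b) (cc : c' <= c) (dd : d <= d')
    (y' : sec (ires I j) (slice c' d')),
    [/\ c' < t < d', idiff I j _ y' = res (slice_sub ac' db') z & res (slice_sub cc dd) y' = y].
Proof.
move=> tab yz; have [at_ tb] := andP tab.
have tr : - r < t < r by rewrite (le_lt_trans ra at_) (lt_le_trans tb br).
have [V [VS [y1 [Vt y1z]]]] := (@idiff_exact _ _ _ I j _ _).1 dz _ (slice_par ra br tab).
have [e0 e0_gt0 e0V] := slice_near tr Vt.
pose e := Num.min e0 (Num.min (t - a) (b - t)).
have e_gt0 : 0 < e by rewrite !lt_min e0_gt0 !subr_gt0 at_ tb.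
have ee0 : e <= e0 by rewrite ge_min lexx.
have eta : e <= t - a by rewrite !ge_min lexx orbT.
have ebt : e <= b - t by rewrite !ge_min lexx !orbT.
have ate : a <= t - e by rewrite lerBrDl addrC -lerBrDl.
have teb : t + e <= b by rewrite -lerBrDl.
have rte : - r <= t - e := le_trans ra ate.
have ter : t + e <= r := le_trans teb br.
have SV x : oset (slice (t - e) (t + e)) x -> A x -> oset V x.
  move=> Sx; apply: e0V; apply: slice_sub Sx; first by rewrite lerD2l lerN2.
  by rewrite lerD2l.
have [y2 y2E] := supported_shrink (@suppI j) closedA SV y1.
have y2z : idiff I j _ y2 = res (slice_sub ate teb) z.
  apply: (supported_eq (@suppI j.+1) (VU := @opensIl _ _ V)) => [x Sx Ax|].
    by split => //; exact: SV.
  rewrite -happ_res (y2E _ _ (@opensIr _ _ V)) happ_res y1z.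
  by rewrite (res_comp _ _ (subset_trans (@opensIr _ _ V) VS))
    (res_comp _ _ (subset_trans (@opensIr _ _ V) VS)).
pose c1 := Num.max c (t - e); pose d1 := Num.min d (t + e).
have c1t : c1 <= t by rewrite ge_max ct lerBlDr lerDl ltW.
have td1 : t <= d1 by rewrite le_min td lerDl ltW.
have cc1 : c <= c1 by rewrite le_max lexx.
have d1d : d1 <= d by rewrite ge_min lexx.
have tc1 : t - e <= c1 by rewrite le_max lexx orbT.
have d1t : d1 <= t + e by rewrite ge_min lexx orbT.
pose w := res (slice_sub cc1 d1d) y - res (slice_sub tc1 d1t) y2.
have [|u [du uw]] := extj tc1 d1t rte (le_trans c1t td1) ter (z := w).
  rewrite raddfB/= !happ_res yz y2z !(res_comp _ _ (slice_sub (le_trans ac cc1) (le_trans d1d db))).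
  by rewrite subrr.
pose c' := Num.min c (t - e); pose d' := Num.max d (t + e).
have cc : c' <= c by rewrite ge_min lexx.
have dd : d <= d' by rewrite le_max lexx.
have ct' : c' <= t - e by rewrite ge_min lexx orbT.
have dt' : t + e <= d' by rewrite le_max lexx orbT.
have ac' : a <= c' by rewrite le_min ac.
have db' : d' <= b by rewrite ge_max db.
have cov : slice c' d' `<=` slice c d `|` slice (t - e) (t + e).
  move=> x /sliceP[Wx]; rewrite gt_min lt_max => xcd.
  have [xc|cx] := leP (tau x) c.
    right; apply/sliceP; split => //; move: xcd; rewrite ltNge xc/= => /andP[-> _]/=.
    by rewrite (le_lt_trans xc)// (le_lt_trans ct)// ltrDl.
  have [dx|xd] := leP d (tau x).
    right; apply/sliceP; split => //; move: xcd; rewrite [X in _ && (X || _)]ltNge dx/= => /andP[_ ->].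
    by rewrite andbT (lt_le_trans _ dx)// (lt_le_trans _ td)// ltrBlDr ltrDl.
  by left; apply/sliceP; rewrite cx xd.
have [|y' [y'y y'y2]] := glue2 (slice_sub cc dd) (slice_sub ct' dt') (s1 := y) (s2 := y2 + u) cov.
  move=> W W1 W2.
  have W12 : W `<=` slice c1 d1.
    move=> x Wx; have /sliceP[_ /andP[cx xd]] := W1 _ Wx.
    have /sliceP[WCx /andP[tx xt]] := W2 _ Wx.
    by apply/sliceP; rewrite gt_max lt_min cx xd tx xt.
  rewrite -(res_comp (slice_sub cc1 d1d) W12) raddfD/=.
  rewrite -[res W2 u](res_comp (slice_sub tc1 d1t) W12) -[res W2 y2](res_comp (slice_sub tc1 d1t) W12).
  by rewrite uw -raddfD/= /w addrC subrK.
exists c', d', ac', db', cc, dd, y'; split => //.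
  by rewrite gt_min lt_max ltrBlDr !ltrDl e_gt0 !orbT.
apply: (glue2_unique (h1 := slice_sub cc dd) (h2 := slice_sub ct' dt') cov).
  by rewrite -happ_res y'y yz (res_comp _ _ (slice_sub ac db)).
rewrite -happ_res y'y2 raddfD/= du addr0 y2z.
by rewrite (res_comp _ _ (slice_sub ate teb)).
Qed.

(** All these intervals contain m, so that the union of a chain of them is an
    interval; at the start of the construction the interval is empty. *)
Record partial_primitive (m : R) := PartialPrimitive {
  pp_l : R; pp_r : R;
  pp_al : a <= pp_l; pp_lm : pp_l <= m; pp_mr : m <= pp_r; pp_rb : pp_r <= b;
  pp_sec : sec (ires I j) (slice pp_l pp_r);
  pp_eq : idiff I j _ pp_sec = res (slice_sub pp_al pp_rb) z
}.

Definition pp_le m (u v : partial_primitive m) : bool :=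
  `[< exists (l : pp_l v <= pp_l u) (r : pp_r u <= pp_r v),
      res (slice_sub l r) (pp_sec v) = pp_sec u >].

Lemma pp_chain m (P : set (partial_primitive m)) : P !=set0 ->
  total_on P (@pp_le m) -> exists v, forall u, P u -> pp_le u v.
Proof.
move=> [u0 Pu0] totP.
pose Ls := [set pp_l u | u in P]; pose Rs := [set pp_r u | u in P].
have hL : has_inf Ls by split; [exists (pp_l u0), u0|exists a => _ [u _ <-]; exact: pp_al].
have hR : has_sup Rs by split; [exists (pp_r u0), u0|exists b => _ [u _ <-]; exact: pp_rb].
have l_le u : P u -> inf Ls <= pp_l u by move=> Pu; apply: (ge_inf hL.2); exists u.
have r_le u : P u -> pp_r u <= sup Rs by move=> Pu; apply: (ub_le_sup hR.2); exists u.
have al : a <= inf Ls by apply: (lb_le_inf hL.1) => _ [u _ <-]; exact: pp_al.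
have rb : sup Rs <= b by apply: (ge_sup hR.1) => _ [u _ <-]; exact: pp_rb.
pose V (u : {u | P u}) : opens T := slice (pp_l (sval u)) (pp_r (sval u)).
have VS u : V u `<=` slice (inf Ls) (sup Rs).
  by apply: slice_sub; [apply: l_le|apply: r_le]; exact: svalP.
have cov : slice (inf Ls) (sup Rs) `<=` \bigcup_u V u.
  move=> x /sliceP[Wx /andP[lx xr]].
  have [_ [u Pu <-] ux] := inf_lt hL.1 lx.
  have [_ [v Pv <-] xv] := sup_gt hR.1 xr.
  have [/asboolP[l1 [r1 _]]|/asboolP[l1 [r1 _]]] := totP _ _ Pu Pv.
    exists (exist _ v Pv) => //; apply/sliceP; split => //=.
    by rewrite xv (le_lt_trans l1).
  exists (exist _ u Pu) => //; apply/sliceP; split => //=.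
  by rewrite ux (lt_le_trans xv).
have [|y yE] := sheaf_glue VS cov (s := fun u => pp_sec (sval u)).
  have H (u v : {u | P u}) (W : opens T) (Wi : W `<=` V u) (Wj : W `<=` V v) :
      pp_le (sval u) (sval v) -> res Wi (pp_sec (sval u)) = res Wj (pp_sec (sval v)).
    by move=> /asboolP[l [r' <-]]; rewrite (res_comp _ _ Wj).
  move=> u v W Wi Wj; have [uv|vu] := totP _ _ (svalP u) (svalP v); first exact: H.
  exact/esym/H.
have yz : idiff I j _ y = res (slice_sub al rb) z.
  apply: (@sheaf_sep _ _ _ _ _ V VS cov) => u.
  rewrite -happ_res yE pp_eq (res_comp _ _ (slice_sub (pp_al (sval u)) (pp_rb (sval u)))).
  by [].
exists (PartialPrimitive (le_trans (l_le _ Pu0) (pp_lm u0))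
   (le_trans (pp_mr u0) (r_le _ Pu0)) yz) => u Pu.
apply/asboolP; exists (l_le _ Pu), (r_le _ Pu) => /=.
by rewrite -(yE (exist _ u Pu)) /=; exact: res_eq.
Qed.

(** By [primitive_step] a maximal partial primitive is defined on all of ]a, b[. *)
Lemma primitive : a < b -> exists y : sec (ires I j) (slice a b), idiff I j _ y = z.
Proof.
move=> ab; pose m := (a + b) / 2.
have am : a < m by rewrite midf_lt. have mb : m < b by rewrite midf_lt.
have e0 : idiff I j (slice m m) 0 = res (slice_sub (ltW am) (ltW mb)) z.
  by apply: sec_empty => x /sliceP[_ /andP[mx xm]]; move: (lt_trans mx xm); rewrite ltxx.
pose u0 := PartialPrimitive (lexx m) (lexx m) e0.
have [u||P totP|u umax] := ZL_preorder u0 (R := @pp_le m).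
- apply/asboolP; exists (lexx _), (lexx _); exact: res_id.
- move=> v u w /asboolP[l [r1 vu]] /asboolP[l' [r1' vw]].
  apply/asboolP; exists (le_trans l' l), (le_trans r1 r1').
  by rewrite -vu -vw (res_comp _ _ (slice_sub (le_trans l' l) (le_trans r1 r1'))).
- have [P0|/nonemptyPn P0] := pselect (P !=set0); first exact: pp_chain.
  by exists u0 => u; rewrite P0.
have grow t : a < t < b -> pp_l u <= t <= pp_r u -> pp_l u < t < pp_r u.
  move=> tab /andP[lt_ tr].
  have [c' [d' [ac' [db' [cc [dd [y' [ct yz yu]]]]]]]] :=
    primitive_step lt_ tr tab (pp_eq u).
  have [/andP[c't td']] := (ct).
  have := umax (PartialPrimitive (le_trans cc (pp_lm u)) (le_trans (pp_mr u) dd) yz).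
  have -> : pp_le u (PartialPrimitive (le_trans cc (pp_lm u)) (le_trans (pp_mr u) dd) yz).
    by apply/asboolP; exists cc, dd.
  move=> /(_ isT)/asboolP[/= l [r1 _]].
  by rewrite (le_lt_trans l c't) (lt_le_trans td' r1).
have lr : pp_l u <= pp_r u := le_trans (pp_lm u) (pp_mr u).
have la : pp_l u <= a.
  rewrite leNgt; apply/negP => al; have := grow (pp_l u).
  by rewrite al (le_lt_trans (pp_lm u) mb) lexx lr ltxx => /(_ isT isT).
have br' : b <= pp_r u.
  rewrite leNgt; apply/negP => rb; have := grow (pp_r u).
  by rewrite rb (lt_le_trans am (pp_mr u)) lexx lr ltxx andbF => /(_ isT isT).
exists (res (slice_sub la br') (pp_sec u)).
rewrite happ_res pp_eq (res_comp _ _ (@subset_refl _ _)).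
exact: res_id.
Qed.

End Step.

Lemma cocycles_extendS j : cocycles_extend j -> cocycles_extend j.+1.
Proof.
move=> extj a b a' b' aa bb ra ab br z dz.
have [ab'|ba] := ltP a b; last first.
  exists 0; rewrite !raddf0; split => //; apply: sec_empty => x /sliceP[_ /andP[ax xb]].
  by move: (lt_le_trans (lt_trans ax xb) ba); rewrite ltxx.
have [y yz] := primitive extj (le_trans ra aa) (le_trans bb br) dz ab'.
have [y' y'y] := injective_flabby (@ires_inj _ _ _ I j) (slice_sub aa bb) y.
by exists (idiff I j _ y'); rewrite diff_diff -happ_res y'y.
Qed.

Lemma cocycles_extendP j : cocycles_extend j.
Proof.
by elim: j => [|j]; [exact: cocycles_extend0|exact: cocycles_extendS].
Qed.

Section Support.
Variables (U Z : set T).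
Hypothesis openUZ : open (U `\` Z).

(** Support in Z is a condition on open sets that avoid Z; for a sheaf supported
    in A it is enough to avoid the points of Z that lie in A. *)
Lemma supported_in_res0 j (V Q : opens T) (QV : Q `<=` V) (s : sec (ires I j) V) :
  V `<=` U -> supported_in Z s -> (forall x, oset Q x -> A x -> ~ Z x) -> res QV s = 0.
Proof.
move=> VU sZ QZ; pose N := opensI Q (Opens openUZ).
have NV : N `<=` V by move=> x [/QV].
apply: (supported_eq (@suppI j) (VU := @opensIl _ Q (Opens openUZ))) => [x Qx Ax|].
  by split => //; split; [exact/VU/QV|exact: QZ Ax].
rewrite raddf0 (res_comp _ _ NV); apply: sZ.
by rewrite -subset0 => x [[_ [_ nZ]] /nZ].
Qed.

(** In positive degree the cocycle s has a primitive t' near the end point. It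
    is a cocycle on the negative half of the arc, where s vanishes; extending
    this cocycle across 0 to a cocycle u, the primitive t' - u vanishes on the
    negative half. In degree 0, s is locally constant and vanishes on that half. *)
Lemma half_arc_acyclic : 0 < r ->
  (forall t, - r < t < r -> (Z (gam t) <-> 0 <= t)) ->
  forall j, local_cohomology_stalk_zero I U Z (gam 0) j.
Proof.
move=> r0 gamZ j V s VU V0 sZ ds.
have zr : - r < 0 < r by rewrite oppr_lt0 r0.
have negZ e x : e <= r -> oset (slice (0 - e) 0) x -> A x -> ~ Z x.
  move=> er /sliceP[Wx /andP[_ x0]] Ax; have [xr <-] := arc_coordP Wx Ax.
  by move=> /(gamZ _ xr); rewrite leNgt x0.
case: j s sZ ds => [|j] s sZ ds.
  have [g gs] := exact_mono_lift (@iaug_mono _ _ _ I) (@iaug_exact _ _ _ I) ds.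
  have [N [oN N0] NV] : exists2 N, open_nbhs (gam 0) N & N `<=` [set y | A y -> g y = g (gam 0)].
    have : nbhs (gam 0) [set y | A y -> g y = g (gam 0)] := csec_near g V0.
    by rewrite nbhsE => -[N ? ?]; exists N.
  pose W := opensI V (Opens oN).
  have [e0 e0_gt0 e0W] := @slice_near _ _ _ C 0 W zr (conj V0 N0).
  have [e [e_gt0 ee0 er]] : exists e, [/\ 0 < e, e <= e0 & e <= r].
    by exists (Num.min e0 r); rewrite lt_min e0_gt0 r0 !ge_min !lexx orbT.
  have he : 0 - e < - e / 2 < 0.
    by rewrite sub0r mulNr ltrN2 oppr_lt0 divr_gt0// andbT ltr_pdivrMr// ltr_pMr// ltr1n.
  have hr : - r < - e / 2 < r.
    case/andP: he => h1 h2; rewrite (le_lt_trans _ h1) ?(lt_trans h2)//.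
    by rewrite sub0r lerN2.
  have [Cq Aq tq] := arc_parP hr.
  have qW : oset W (gam (- e / 2)).
    apply: e0W => //; apply/sliceP; rewrite tq; split => //; case/andP: he => h1 h2.
    apply/andP; split; last by rewrite add0r (lt_trans h2).
    by apply: le_lt_trans h1; rewrite lerD2l lerN2.
  have g0 : g (gam 0) = 0.
    rewrite -(NV _ qW.2 Aq); pose Q := opensI V (slice (0 - e) 0).
    have QV : Q `<=` V by move=> x [].
    have Qq : oset Q (gam (- e / 2)) by split; [exact: qW.1|apply/sliceP; rewrite tq].
    have gQ : res QV g = 0.
      apply: (@iaug_mono _ _ _ I); rewrite happ_res gs raddf0.
      by apply: supported_in_res0 => // x [_ Sx]; exact: negZ er Sx.
    by have := congr1 (fun f : csec_type k A Q => f (gam (- e / 2))) gQ; rewrite cresE.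
  exists W, (@opensIl _ _ _); split; first exact: (conj V0 N0).
  rewrite -gs -happ_res; have -> : res (@opensIl _ V (Opens oN)) g = 0; last by rewrite raddf0.
  apply: csec_eq => x Wx; rewrite cresE//; have [Ax|nAx] := pselect (A x).
    by rewrite (NV _ Wx.2 Ax) g0.
  by apply: csec_out => -[].
have [V1 [V1V [t [V10 ts]]]] := (@idiff_exact _ _ _ I j _ _).1 ds _ V0.
have [e0 e0_gt0 e0V] := slice_near zr V10.
have [e [e_gt0 ee0 er]] : exists e, [/\ 0 < e, e <= e0 & e <= r].
  by exists (Num.min e0 r); rewrite lt_min e0_gt0 r0 !ge_min !lexx orbT.
have SV x : oset (slice (0 - e) (0 + e)) x -> A x -> oset V1 x.
  by move=> Sx; apply: e0V; apply: slice_sub Sx; rewrite lerD2l// lerN2.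
have [t' t't] := supported_shrink (@suppI j) closedA SV t.
have e0e : 0 <= 0 + e by rewrite add0r ltW.
have re : - r <= 0 - e by rewrite sub0r lerN2.
have e0' : 0 - e <= 0 by rewrite sub0r oppr_le0 ltW.
have er' : 0 + e <= r by rewrite add0r.
have [|u [du ut]] := cocycles_extendP (lexx (0 - e)) e0e re e0' er'
    (z := res (slice_sub (lexx _) e0e) t').
  apply: (supported_eq (@suppI j.+1) (VU := @opensIl _ _ V1)) => [x Sx Ax|].
    by split => //; apply: SV => //; apply: slice_sub Sx.
  rewrite raddf0 -!happ_res (res_comp _ _ (subset_trans (@opensIl _ _ V1) (slice_sub (lexx _) e0e))).
  rewrite (t't _ _ (@opensIr _ _ V1)) happ_res ts (res_comp _ _ (subset_trans (@opensIr _ _ V1) V1V)).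
  by apply: supported_in_res0 => // x [Sx _]; exact: negZ er Sx.
pose O := opensI V1 (slice (0 - e) (0 + e)).
have OV : O `<=` V by move=> x [/V1V].
exists O, OV; split.
  split => //; apply/sliceP; have [W0 A0 ->] := arc_parP zr.
  by split => //; rewrite sub0r add0r oppr_lt0 e_gt0.
exists (res (@opensIr _ _ _) (t' - u)); split.
  move=> Q QO QZ; have QS : Q `<=` slice (0 - e) (0 + e) by move=> x /QO[].
  rewrite (res_comp _ _ QS).
  apply: (supported_eq (@suppI j) (VU := @opensIl _ _ (slice (0 - e) 0))) => [x Qx Ax|].
    split => //; have /sliceP[Wx xe] := QS _ Qx; apply/sliceP; split => //.
    case/andP: xe => -> _ /=; rewrite ltNge; apply/negP => x0.
    have [xr gx] := arc_coordP Wx Ax.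
    suff : (Q `&` Z) x by rewrite QZ.
    by split => //; rewrite -gx; exact/(gamZ _ xr).
  rewrite raddf0 (res_comp _ _ (subset_trans (@opensIr _ _ _) (slice_sub (lexx _) e0e))).
  by rewrite -(res_comp (slice_sub (lexx _) e0e) (@opensIr _ _ _)) raddfB /= ut subrr raddf0.
rewrite happ_res raddfB /= du subr0 -happ_res (t't _ _ (@opensIl _ _ _)) happ_res ts.
by rewrite (res_comp _ _ OV).
Qed.

End Support.
End ArcCohomology.

(** * Vanishing and non-vanishing criteria for the extension by zero of a constant sheaf *)

Section StalkCriteria.
Variables (k : comNzRingType) (T : topologicalType) (A : set T).
Hypothesis closedA : closed A.
Local Notation kA := (constant_sheaf k A).

Lemma RGamma_zero_off (U Z : set T) p : ~ A p -> RGamma_stalk_zero kA U Z p.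
Proof.
move=> nAp; have sA := constant_supported (k := k) closedA.
exists (sky_resolution closedA sA) => j V s VU Vp sZ ds.
have [W [WV [Wp sW]]] := sky_resolution_supported (sF := sA) s Vp nAp.
exists W, WV; split=> //; case: j s sZ ds sW => // j s _ _ sW.
exists 0; rewrite raddf0; split => // Q QW _; exact: raddf0.
Qed.

Lemma RGamma_zero_arc (R : realType) (C : arc R A) (U Z : set T) : 0 < arc_rad C ->
  open (U `\` Z) ->
  (forall t, - arc_rad C < t < arc_rad C -> (Z (arc_par C t) <-> 0 <= t)) ->
  RGamma_stalk_zero kA U Z (arc_par C 0).
Proof.
move=> r0 oUZ gZ; have sA := constant_supported (k := k) closedA.
exists (sky_resolution closedA sA); apply: half_arc_acyclic => // j.
exact: sky_resolution_supported.
Qed.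

(** The section 1 of k_A near x is supported in Z, and it is not zero at x. *)
Lemma H0_nonzero (I : injective_resolution kA) (U Z : set T) (V : opens T) x :
  A x -> oset V x -> V `<=` U -> (forall y, oset V y -> A y -> Z y) ->
  ~ local_cohomology_stalk_zero I U Z x 0.
Proof.
move=> Ax Vx VU AZ /(_ V); have [g g1] := @constant_section k T A V 1 closedA.
move=> /(_ (iaug I V g) VU Vx)[].
- move=> W WV WZ; rewrite -happ_res -[RHS](raddf0 (iaug I W)); congr (iaug I _ _).
  apply: csec_eq => y Wy; rewrite cresE//; apply: csec_out => -[Vy Ay].
  suff : (W `&` Z) y by rewrite WZ.
  by split => //; exact: AZ.
- exact: diff_aug.
move=> W [WV [Wx]]; rewrite -happ_res => gW0.
have : res WV (g : sec kA V) = 0 by apply: (@iaug_mono _ _ _ I); rewrite gW0 raddf0.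
move=> /(congr1 (fun f : csec_type k A W => f x)); rewrite cresE// g1//.
by move/eqP; rewrite oner_eq0.
Qed.

(** Off Z let g be 1 after the point t of the arc and 0 before. By flabbiness
    it extends to a cochain s, whose differential is supported in Z. If this
    differential were that of a cochain supported in Z, then g would extend to a
    section of k_A near the point, equal to the same constant on both sides. *)
Lemma H1_nonzero (R : realType) (C : arc R A) (I : injective_resolution kA) (U Z : set T) t :
  - arc_rad C < t < arc_rad C -> open U -> open (U `\` Z) ->
  U (arc_par C t) -> Z (arc_par C t) ->
  (forall e, 0 < e -> exists s, t - e < s < t /\ ~ Z (arc_par C s)) ->
  (forall e, 0 < e -> exists s, t < s < t + e /\ ~ Z (arc_par C s)) ->
  ~ local_cohomology_stalk_zero I U Z (arc_par C t) 1.
Proof.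
move=> tr oU oUZ Ut Zt left_out right_out H1.
have [Ct At tt] := arc_parP tr.
pose V := opensI (arc_open C) (Opens oU).
have oVZ : open (V `\` Z).
  have -> : V `\` Z = (arc_open C : set T) `&` (U `\` Z).
    by rewrite eqEsubset; split => x [] => [[Cx Ux] nZ|Cx [Ux nZ]].
  by apply: openI => //; exact: opensP.
pose N := Opens oVZ.
have NV : N `<=` V by move=> x [].
(* near the points of N the function g is constant on A, as t is not a coordinate there *)
pose g x : k^o := if `[< (oset N x /\ A x) /\ t < arc_coord C x >] then 1 else 0.
have gP : g \in csec A N.
  apply/asboolP; split=> x; first by rewrite /g => nx; case: asboolP => // -[].
  move=> Nx; have nN : nbhs x N by apply: open_nbhs_nbhs; split; [exact: opensP|].
  have [Ax|nAx] := pselect (A x); last first.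
    have : nbhs x (~` A) by apply: open_nbhs_nbhs; split => //; rewrite openC.
    by apply: filterS => y nAy Ay.
  have [[Cx _] nZx] := Nx.
  have [_ gx] := arc_coordP Cx Ax.
  have cx := arc_coord_cont Cx.
  have [xt|tx|tx] := ltgtP (arc_coord C x) t.
  - have nx : nbhs x (arc_coord C @^-1` `]-oo, t[%classic).
      by apply: cx; apply: open_nbhs_nbhs; split => //; exact: interval_open.
    apply: filterS nx => y; rewrite /= in_itv /= => yt Ay.
    by rewrite /g !asboolF// => -[_]; rewrite ltNge ltW.
  - have nx : nbhs x (arc_coord C @^-1` `]t, +oo[%classic).
      by apply: cx; apply: open_nbhs_nbhs; split; [exact: interval_open|rewrite /= in_itv /= tx].
    apply: filterS2 nN nx => y Ny; rewrite /= in_itv /= andbT => yt Ay.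
    by rewrite /g !asboolT.
  - by exfalso; apply: nZx; rewrite -gx tx.
have [s sN] := injective_flabby (@ires_inj _ _ _ I 0) NV (iaug I N (CSec gP)).
have [|| W [WV [Wt [u [uZ us]]]]] := H1 V (idiff I 0 V s) (@opensIr _ _ (Opens oU)) (conj Ct Ut).
- move=> Q QV QZ; have QN : Q `<=` N.
    by move=> x Qx; split; [exact: QV|move=> Zx; have : (Q `&` Z) x by []; rewrite QZ].
  by rewrite -happ_res -(res_comp NV QN) sN -happ_res diff_aug.
- exact: diff_diff.
have [h hE] : exists h, iaug I W h = res WV s - u.
  apply: (exact_mono_lift (@iaug_mono _ _ _ I) (@iaug_exact _ _ _ I)).
  by rewrite raddfB /= happ_res us subrr.
have hg x : oset W x -> ~ Z x -> h x = g x.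
  move=> Wx nZx; pose Q := opensI W N.
  have Qx : oset Q x by split => //; split => //; exact: (WV x).
  have QZ : Q `&` Z = set0 by rewrite -subset0 => y [[_ [_ nZ]] /nZ].
  have e : res (@opensIl _ W N) h = res (@opensIr _ W N) (CSec gP : sec kA N).
    apply: (@iaug_mono _ _ _ I); rewrite !happ_res hE raddfB /= (uZ _ _ QZ) subr0 -sN.
    by rewrite (res_comp _ _ (subset_trans (@opensIr _ W N) NV))
      (res_comp _ _ (subset_trans (@opensIr _ W N) NV)).
  by have := congr1 (fun f : csec_type k A Q => f x) e; rewrite !cresE.
have [B [oB Bt] BW] : exists2 B, open_nbhs (arc_par C t) B & B `<=` [set y | A y -> h y = h (arc_par C t)].
  have : nbhs (arc_par C t) [set y | A y -> h y = h (arc_par C t)] := csec_near h Wt.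
  by rewrite nbhsE => -[B' ? ?]; exists B'.
have [e0 e0_gt0 e0W] := @slice_near _ _ _ C t (opensI W (Opens oB)) tr (conj Wt Bt).
have [e [e_gt0 ee0 te et]] : exists e, [/\ 0 < e, e <= e0, - arc_rad C <= t - e & t + e <= arc_rad C].
  have [rt tr'] := andP tr.
  exists (Num.min e0 (Num.min (t + arc_rad C) (arc_rad C - t))).
  split; first by rewrite !lt_min e0_gt0 subr_gt0 tr' -ltrBlDr sub0r rt.
  - by rewrite ge_min lexx.
  - by rewrite lerBrDl lerBlDr !ge_min lexx !orbT.
  - by rewrite -lerBrDl !ge_min lexx !orbT.
have hA x : oset (slice C (t - e) (t + e)) x -> A x -> oset W x /\ h x = h (arc_par C t).
  move=> Sx Ax; have [] := e0W x _ Ax.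
    by apply: slice_sub Sx; rewrite lerD2l// lerN2.
  by move=> Wx Bx; split => //; exact: BW.
have [s1 [/andP[s1l s1r] nZ1]] := left_out _ e_gt0.
have [s2 [/andP[s2l s2r] nZ2]] := right_out _ e_gt0.
have s1C : - arc_rad C < s1 < arc_rad C.
  by rewrite (le_lt_trans te s1l) (lt_trans s1r)//; case/andP: tr.
have s2C : - arc_rad C < s2 < arc_rad C.
  by rewrite (lt_le_trans s2r et) (lt_trans _ s2l)//; case/andP: tr.
have [C1 A1 t1] := arc_parP s1C; have [C2 A2 t2] := arc_parP s2C.
have [|W1 h1] := hA (arc_par C s1) _ A1.
  by apply/sliceP; rewrite t1 s1l (lt_trans s1r)// ltrDl.
have [|W2 h2] := hA (arc_par C s2) _ A2.
  by apply/sliceP; rewrite t2 s2r (lt_trans _ s2l)// ltrBlDr ltrDl.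
have : g (arc_par C s2) = g (arc_par C s1) by rewrite -!hg// h1 h2.
rewrite /g asboolT ?t2; last by do 2!split => //; split => //; exact: (WV _ W2).
rewrite asboolF; last by rewrite t1 => -[_]; rewrite ltNge ltW.
by move/eqP; rewrite oner_eq0.
Qed.

End StalkCriteria.

(** * Strict differentiability *)

Section StrictDiff.
Variable R : realType.

(** Uniformity in both points is what secants require: in the Whitney cone both
    end points of the secant vary. *)
Definition strict_diff (V W : normedModType R) (f : V -> W) (a : V) (L : V -> W) :=
  forall e, 0 < e -> exists2 d, 0 < d & forall x y, `|x - a| < d -> `|y - a| < d ->
    `|f y - f x - L (y - x)| <= e * `|y - x|.

Lemma coord_norm n (v : 'rV[R]_n) i : `|v 0 i| <= `|v|.
Proof.
rewrite [leRHS]/Num.Def.normr /= mx_normrE.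
exact: (le_bigmax _ (fun j : 'I_1 * 'I_n => `|v j.1 j.2|) (0, i)).
Qed.

Lemma row_norm_le n (v : 'rV[R]_n) c : 0 <= c -> (forall i, `|v 0 i| <= c) -> `|v| <= c.
Proof.
move=> c0 vc; rewrite [leLHS]/Num.Def.normr /= mx_normrE; apply: bigmax_le => // -[i j] _.
by rewrite /= ord1.
Qed.

Lemma linear_bound n (W : normedModType R) (L : {linear 'rV[R]_n -> W}) :
  exists2 c, 0 < c & forall v, `|L v| <= c * `|v|.
Proof.
exists (1 + \sum_i `|L (delta_mx 0 i)|).
  by rewrite ltr_wpDr// sumr_ge0.
move=> v; rewrite {1}[v]row_sum_delta linear_sum; apply: le_trans (ler_norm_sum _ _ _) _.
rewrite mulrDl mul1r mulr_suml -[leLHS]add0r lerD//; apply: ler_sum => i _.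
by rewrite linearZ normrZ mulrC ler_wpM2l// coord_norm.
Qed.

Lemma linear_rV_continuous n (W : normedModType R) (L : {linear 'rV[R]_n -> W}) : continuous L.
Proof.
have [c c0 cP] := linear_bound L.
apply: bounded_linear_continuous; apply/linear_boundedP; near=> M => v.
by rewrite (le_trans (cP v))// ler_wpM2r//; near: M; exact: nbhs_pinfty_ge.
Unshelve. all: by end_near. Qed.

Lemma strict_diff_diff n (W : normedModType R) (f : 'rV[R]_n -> W) a (L : {linear 'rV[R]_n -> W}) :
  strict_diff f a L -> differentiable f a /\ 'd f a = L :> ('rV[R]_n -> W).
Proof.
move=> fL.
have cL : continuous L by exact: linear_rV_continuous.
have E : f \o shift a = cst (f a) + L +o_ 0 id.
  apply/eqaddoP => e e0; have [d d0 fd] := fL e e0.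
  apply/nbhs_ballP; exists d => // x; rewrite -ball_normE /= sub0r normrN => xd.
  rewrite !fctE /=.
  have -> : f (x + a) - (f a + L x) = f (x + a) - f a - L ((x + a) - a).
    by rewrite addrK opprD addrA.
  by rewrite (le_trans (fd _ _ _ _)) ?addrK ?subrr ?normr0.
have dL := diff_unique cL E.
by split => //; apply/diff_locallyP; rewrite dL.
Unshelve. all: by end_near. Qed.

Lemma strict_diff_lipschitz n (W : normedModType R) (f : 'rV[R]_n -> W) a (L : {linear 'rV[R]_n -> W}) :
  strict_diff f a L -> exists c d, [/\ 0 < c, 0 < d &
    forall x y, `|x - a| < d -> `|y - a| < d -> `|f y - f x| <= c * `|y - x|].
Proof.
move=> fL; have [c c0 cL] := linear_bound L; have [d d0 fd] := fL 1 ltr01.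
exists (1 + c), d; split => //; first by rewrite addr_gt0.
move=> x y xa ya; rewrite -(subrK (L (y - x)) (f y - f x)) mulrDl.
by rewrite (le_trans (ler_normD _ _))// lerD// fd.
Qed.

Lemma strict_diff_comp n m (W : normedModType R) (f : 'rV[R]_n -> 'rV[R]_m) (g : 'rV[R]_m -> W) a
    (L : {linear 'rV[R]_n -> 'rV[R]_m}) (K : {linear 'rV[R]_m -> W}) :
  strict_diff f a L -> strict_diff g (f a) K -> strict_diff (g \o f) a (K \o L).
Proof.
move=> fL gK e e0.
have [c [d [c0 d0 lip]]] := strict_diff_lipschitz fL.
have [k k0 kK] := linear_bound K.
have e1_gt0 : 0 < e / 2 / c by rewrite !divr_gt0.
have e2_gt0 : 0 < e / 2 / k by rewrite !divr_gt0.
have [d1 d1_gt0 g1] := gK _ e1_gt0.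
have [d2 d2_gt0 f2] := fL _ e2_gt0.
exists (Num.min d (Num.min d2 (d1 / c))); first by rewrite !lt_min d0 d2_gt0 divr_gt0.
have near_f x : `|x - a| < Num.min d (Num.min d2 (d1 / c)) -> `|f x - f a| < d1.
  rewrite !lt_min => /and3P[xd _ xd1]; rewrite (le_lt_trans (lip _ _ _ xd))//.
    by rewrite subrr normr0.
  by rewrite mulrC -ltr_pdivlMr.
move=> x y xa ya; move: (near_f _ xa) (near_f _ ya) => fx fy.
move: xa ya; rewrite !lt_min => /and3P[xd xd2 _] /and3P[yd yd2 _].
rewrite /= -(subrK (K (f y - f x)) (g (f y) - g (f x))) -addrA -linearB.
rewrite (le_trans (ler_normD _ _))// [e]splitr mulrDl lerD//.
  rewrite (le_trans (g1 _ _ fx fy))// -(ler_pM2l (x := (e / 2 / c)^-1)) ?invr_gt0//.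
  rewrite mulKf ?gt_eqF// (le_trans (lip _ _ xd yd))// mulrA ler_wpM2r// invf_div.
  by rewrite divfK// gt_eqF// divr_gt0.
rewrite (le_trans (kK _))// mulrC -ler_pdivlMr// (le_trans (f2 _ _ xd2 yd2))//.
by rewrite mulrAC.
Qed.

Lemma strict_diff_near (V W : normedModType R) (f g : V -> W) a (L : V -> W) :
  (\forall x \near a, f x = g x) -> strict_diff f a L -> strict_diff g a L.
Proof.
move=> /nbhs_ballP[d0 /= d0_gt0 fg] fL e e0; have [d d_gt0 fd] := fL e e0.
have fgE x : `|x - a| < Num.min d0 d -> f x = g x.
  by rewrite lt_min => /andP[xa _]; apply: fg; rewrite -ball_normE /= distrC.
exists (Num.min d0 d) => [|x y xa ya]; first by rewrite lt_min d0_gt0.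
rewrite -!fgE//; move: xa ya; rewrite !lt_min => /andP[_ xd] /andP[_ yd].
exact: fd.
Qed.

Lemma strict_diff_unique n (W : normedModType R) (f : 'rV[R]_n -> W) a
  (L K : {linear 'rV[R]_n -> W}) : strict_diff f a L -> strict_diff f a K -> L =1 K.
Proof. by move=> /strict_diff_diff[_ <-] /strict_diff_diff[_ <-]. Qed.

Lemma strict_diff_id (V : normedModType R) (a : V) : strict_diff idfun a idfun.
Proof. by move=> e e0; exists 1 => // x y _ _; rewrite subrr normr0 mulr_ge0// ltW. Qed.

Lemma strict_diff_rows n m (f : 'rV[R]_n -> 'rV[R]_m) a (L : 'rV[R]_n -> 'rV[R]_m) :
  (forall i, strict_diff (fun x => f x 0 i : R^o) a (fun v => L v 0 i)) -> strict_diff f a L.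
Proof.
move=> fL e e0.
pose d i := s2val (cid2 (fL i e e0)).
have dP i : 0 < d i /\ forall x y, `|x - a| < d i -> `|y - a| < d i ->
    `|f y 0 i - f x 0 i - L (y - x) 0 i| <= e * `|y - x|.
  by rewrite /d; case: cid2.
exists (\big[Num.min/1]_i d i).
  by elim/big_ind : _ => // [x y x0 y0|i _]; [rewrite lt_min x0 y0|exact: (dP i).1].
move=> x y xa ya; apply: row_norm_le => [|i]; first by rewrite mulr_ge0// ltW.
have le_d : \big[Num.min/1]_i d i <= d i by exact: bigmin_le_cond.
by rewrite !mxE; apply: (dP i).2; exact: lt_le_trans le_d.
Qed.

(** The mean value theorem, in the form of a bound on the deviation from the
    slope D. *)
Lemma mean_value_bound (g dg : R -> R) (a b D e : R) : a <= b ->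
  (forall t, a <= t <= b -> is_derive t 1 g (dg t)) ->
  (forall t, a <= t <= b -> `|dg t - D| <= e) ->
  `|g b - g a - (b - a) * D| <= e * (b - a).
Proof.
move=> ab gdg dgD.
have [| |c] := @MVT_segment R g dg a b ab.
- by move=> t; rewrite in_itv /= => /andP[/ltW at_ /ltW tb]; apply: gdg; rewrite at_ tb.
- apply: derivable_within_continuous => t; rewrite in_itv /= => tab.
  by have := gdg t tab; case.
rewrite in_itv /= => cab ->; rewrite [_ * D]mulrC -mulrBl normrM.
by rewrite [`|b - a|]ger0_norm ?subr_ge0// ler_wpM2r ?subr_ge0// dgD.
Qed.

Lemma line_derive (V : normedModType R) (f : V -> R) (x e : V) t :
  derivable (f : V -> R^o) (x + t *: e) e ->
  is_derive t (1 : R) (fun s => f (x + s *: e)) ('D_e (f : V -> R^o) (x + t *: e)).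
Proof.
move=> df; pose g s := f (x + s *: e).
have E : (fun h : R => h^-1 *: ((g \o shift t) (h *: (1 : R)) - g t)) =
         (fun h : R => h^-1 *: ((f \o shift (x + t *: e)) (h *: e) - f (x + t *: e))).
  rewrite funeqE => h /=; rewrite /g; congr (_ *: (f _ - _)).
  by rewrite scalerDl [h *: 1]mulr1 addrCA.
by split; rewrite /derivable /derive E.
Qed.

(** From x to y the coordinates are changed one at a time. The norm is the
    maximum norm, so its balls are boxes, and the intermediate points stay in
    the ball on which the partial derivatives are close to those at a. *)
Lemma C1_strict_diff n (f : 'rV[R]_n -> R) (U : set 'rV[R]_n) a : open U -> U a ->
  (forall i x, U x -> derivable (f : 'rV[R]_n -> R^o) x (delta_mx 0 i)) ->
  (forall i, {for a, continuous ('D_(delta_mx 0 i) (f : 'rV[R]_n -> R^o))}) ->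
  strict_diff (f : 'rV[R]_n -> R^o) a
    (fun v => \sum_i v 0 i * 'D_(delta_mx 0 i) (f : 'rV[R]_n -> R^o) a).
Proof.
move=> oU Ua df cf e e0.
pose D i := 'D_(delta_mx 0 i) (f : 'rV[R]_n -> R^o).
pose e1 := e / n.+1%:R.
have e1_gt0 : 0 < e1 by rewrite divr_gt0.
have [d d_gt0 dP] : exists2 d, 0 < d & forall x, `|x - a| < d ->
    U x /\ forall i, `|D i x - D i a| <= e1.
  have : \forall x \near a, U x /\ forall i, `|D i x - D i a| <= e1.
    have nU : nbhs a U by exact: open_nbhs_nbhs.
    have nD : \forall x \near a, forall i, `|D i x - D i a| <= e1.
      apply: (@filter_forall _ 'I_n (fun i x => is_true (`|D i x - D i a| <= e1)) (nbhs a) _) => i.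
      have /cvgrPdist_le/(_ _ e1_gt0) := cf i.
      by apply: filterS => x; rewrite distrC.
    by apply: filterS2 nU nD => x.
  move=> /nbhs_ballP[d /= d_gt0 aP]; exists d => // x xa.
  by apply: aP; rewrite -ball_normE /= distrC.
exists (d / 2); first by rewrite divr_gt0.
move=> x y xa ya.
pose h k := \row_i (if (i < k)%N then y 0 i else x 0 i).
have h0 : h 0 = x by apply/rowP => i; rewrite mxE.
have hn : h n = y by apply/rowP => i; rewrite mxE ltn_ord.
have coordd (z : 'rV[R]_n) i : `|z - a| < d / 2 -> `|z 0 i - a 0 i| <= d / 2.
  by move=> za; have := coord_norm (z - a) i; rewrite !mxE => /le_trans; apply; exact: ltW.
pose de (k : 'I_n) := y 0 k - x 0 k.
have hS (k : 'I_n) : h k.+1 = h k + de k *: delta_mx 0 k.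
  apply/rowP => i; rewrite !mxE eqxx /= ltnS leq_eqVlt.
  have [->|ik] := eqVneq i k; first by rewrite eqxx ltnn mulr1 /de subrKC.
  by rewrite (inj_eq val_inj) (negbTE ik) mulr0 addr0.
have inball (k : 'I_n) s : (0 <= s <= de k) || (de k <= s <= 0) ->
    `|h k + s *: delta_mx 0 k - a| < d.
  move=> sde; apply: (@le_lt_trans _ _ (d / 2)); last first.
    by rewrite ltr_pdivrMr// ltr_pMr// ltr1n.
  apply: row_norm_le => [|i]; first by rewrite divr_ge0 ?ltW.
  rewrite !mxE eqxx /=; have [->|ik] := eqVneq i k; last first.
    by rewrite mulr0 addr0; case: ifP => _; exact: coordd.
  rewrite ltnn mulr1.
  have := coordd _ k xa; have := coordd _ k ya; rewrite !ler_distl.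
  move: sde; rewrite /de.
  move=> /orP[/andP[s0 s1]|/andP[s0 s1]] /andP[y1 y2] /andP[x1 x2]; apply/andP; split.
  - by rewrite (le_trans x1)// lerDl.
  - by rewrite (le_trans _ y2)// -lerBrDl.
  - by rewrite (le_trans y1)// -lerBlDl.
  - by rewrite (le_trans _ x2)// gerDl.
have step (k : 'I_n) : `|f (h k.+1) - f (h k) - de k * D k a| <= e1 * `|de k|.
  pose g s := f (h k + s *: delta_mx 0 k).
  pose dg s := D k (h k + s *: delta_mx 0 k).
  have gdg s : (0 <= s <= de k) || (de k <= s <= 0) -> is_derive s (1 : R) g (dg s) /\ `|dg s - D k a| <= e1.
    move=> /inball/dP[Us Ds]; split; last exact: Ds.
    by apply: line_derive; exact: df.
  have gS : f (h k.+1) = g (de k) by rewrite /g hS.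
  have g0 : f (h k) = g 0 by rewrite /g scale0r addr0.
  have [de0|de0] := leP 0 (de k).
    have := @mean_value_bound g dg 0 (de k) (D k a) e1 de0; rewrite subr0 gS g0 (ger0_norm de0).
    by apply => s ss; have [] := gdg s; rewrite ?ss.
  have := @mean_value_bound g dg (de k) 0 (D k a) e1 (ltW de0).
  have -> : g 0 - g (de k) - (0 - de k) * D k a = - (f (h k.+1) - f (h k) - de k * D k a).
    by rewrite sub0r mulNr !opprD !opprK gS g0 [- _ + _]addrC.
  rewrite normrN sub0r (ltr0_norm de0).
  by apply => s ss; have [] := gdg s; rewrite ?ss ?orbT.
have -> : f y - f x = \sum_(k < n) (f (h k.+1) - f (h k)).
  by rewrite -(big_mkord xpredT (fun k => f (h k.+1) - f (h k))) telescope_sumr// hn h0.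
rewrite -sumrB (le_trans (ler_norm_sum _ _ _))//.
apply: (@le_trans _ _ (\sum_(k < n) e1 * `|y - x|)).
  apply: ler_sum => k _; rewrite !mxE (le_trans (step k))//.
  by rewrite ler_pM2l//; have := coord_norm (y - x) k; rewrite !mxE.
rewrite sumr_const card_ord -[leLHS]mulr_natl mulrA ler_wpM2r//.
by rewrite /e1 mulrCA ger_pMr// ler_pdivrMr// mul1r ler_nat.
Qed.

End StrictDiff.

(** * Differentials in the charts of a manifold *)

Section Pairing.
Variables (R : realType) (n : nat).
Implicit Types xi v : 'rV[R]_n.

Definition pair_with xi v : R^o := pairing xi v.

Lemma pair_with_linear xi : linear (pair_with xi).
Proof.
move=> a u v; rewrite /pair_with /pairing scaler_sumr -big_split; apply: eq_bigr => i _ /=.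
by rewrite !mxE mulrDr mulrCA.
Qed.
HB.instance Definition _ xi := GRing.isLinear.Build R 'rV[R]_n R^o *:%R (pair_with xi)
  (pair_with_linear xi).

Lemma pairingB xi u v : pairing xi (u - v) = pairing xi u - pairing xi v.
Proof. exact: (linearB (pair_with xi)). Qed.
Lemma pairingZ a xi v : pairing xi (a *: v) = a * pairing xi v.
Proof. by rewrite -[LHS]/(pair_with xi (a *: v)) linearZ. Qed.
Lemma pairing0 xi : pairing xi 0 = 0.
Proof. exact: (linear0 (pair_with xi)). Qed.

Lemma pairing_mulmx xi v (J : 'M[R]_n) : pairing xi (v *m J) = pairing (xi *m J^T) v.
Proof.
rewrite /pairing; under eq_bigr do rewrite mxE mulr_sumr.
under [RHS]eq_bigr do rewrite mxE mulr_suml.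
rewrite exchange_big; apply: eq_bigr => i _; apply: eq_bigr => j _.
by rewrite !mxE mulrCA mulrC.
Qed.

Lemma pairing_bound xi v : `|pairing xi v| <= n%:R * `|xi| * `|v|.
Proof.
apply: le_trans (ler_norm_sum _ _ _) _.
apply: (@le_trans _ _ (\sum_(i < n) `|xi| * `|v|)).
  by apply: ler_sum => i _; rewrite normrM ler_pM// coord_norm.
by rewrite sumr_const card_ord -[leLHS]mulr_natl mulrA.
Qed.

Lemma pairingBl xi eta v : pairing (xi - eta) v = pairing xi v - pairing eta v.
Proof. by rewrite /pairing -sumrB; apply: eq_bigr => i _; rewrite !mxE mulrBl. Qed.

Lemma pairing_inj xi eta : (forall v, pairing xi v = pairing eta v) -> xi = eta.
Proof.
move=> h; apply/rowP => i; have := h (delta_mx 0 i).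
rewrite /pairing (bigD1 i)//= [in RHS](bigD1 i)//= !big1 ?addr0 => [|j ji|j ji].
- by rewrite !mxE !eqxx !mulr1.
- by rewrite !mxE (negbTE ji) mulr0.
- by rewrite !mxE (negbTE ji) mulr0.
Qed.
End Pairing.

Section SmoothStrict.
Variables (R : realType) (n : nat).

Lemma smooth_strict_diff (f : 'rV[R]_n -> R^o) U a : open U -> U a -> smooth_on f U ->
  exists xi, strict_diff f a (pair_with xi).
Proof.
move=> oU Ua /(_ 1%N)[_ df].
exists (\row_i 'D_(delta_mx 0 i) f a) => e e0.
have [d d0 fd] : exists2 d, 0 < d & forall x y, `|x - a| < d -> `|y - a| < d ->
    `|f y - f x - \sum_i (y - x) 0 i * 'D_(delta_mx 0 i) f a| <= e * `|y - x|.
  apply: (C1_strict_diff oU Ua) => // [i x Ux|i]; first exact: (df i).1.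
  exact: (df i).2.1.
exists d => // x y xa ya; rewrite /pair_with /pairing.
under eq_bigr do rewrite mxE mulrC.
exact: fd.
Qed.

Lemma smooth_strict_diff_row (F : 'rV[R]_n -> 'rV[R]_n) U a : open U -> U a -> smooth_on F U ->
  strict_diff F a (mulmxr (jacobian F a)).
Proof.
move=> oU Ua /(_ 1%N)[_ dF].
pose J := \matrix_(k, i) 'D_(delta_mx 0 k) (fun x => F x 0 i : R^o) a.
have sJ : strict_diff F a (mulmxr J).
  apply: strict_diff_rows => i e e0.
  have comp k x : U x -> derivable (fun x => F x 0 i : R^o) x (delta_mx 0 k).
    by move=> Ux; have := (dF k).1 x Ux => /derivable_mxP; exact.
  have [||d d0 fd] := C1_strict_diff (f := fun x => F x 0 i) oU Ua _ _ e0.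
  - by move=> k x; exact: comp.
  - move=> k; have cont := (dF k).2.1 a Ua.
    have E x : U x -> 'D_(delta_mx 0 k) (fun x => F x 0 i : R^o) x = ('D_(delta_mx 0 k) F x) 0 i.
      by move=> Ux; rewrite (derive_mx ((dF k).1 x Ux)) mxE.
    have nU : nbhs a U by exact: open_nbhs_nbhs.
    rewrite /prop_for /continuous_at (E a Ua).
    have c1 : ('D_(delta_mx 0 k) F x) 0 i @[x --> a] --> ('D_(delta_mx 0 k) F a) 0 i.
      exact: (cvg_comp _ _ cont (@coord_continuous R 1 n 0 i ('D_(delta_mx 0 k) F a))).
    have nE : \forall x \near a, ('D_(delta_mx 0 k) F x) 0 i =
        'D_(delta_mx 0 k) (fun x => F x 0 i : R^o) x.
      by apply: filterS nU => x Ux; rewrite E.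
    by apply: cvg_trans c1; exact: (near_eq_cvg nE).
  - exists d => // x y xa ya; have := fd x y xa ya.
    have -> : mulmxr J (y - x) 0 i = \sum_k (y - x) 0 k * 'D_(delta_mx 0 k) (fun x => F x 0 i : R^o) a.
      by rewrite mxE; apply: eq_bigr => k _; rewrite !mxE.
    by [].
have [_ dE] := strict_diff_diff sJ.
suff -> : jacobian F a = J by [].
by apply/row_matrixP => i; rewrite /jacobian !rowE mul_rV_lin1 /= dE.
Qed.
End SmoothStrict.

Section Charts.
Variables (R : realType) (n : nat) (P : manifold R n).
Implicit Types (c d : local_chart R P n) (p : P).

Lemma chart_cod_open c (U : set P) : open U -> open (lcod c `&` linv c @^-1` U).
Proof.
move=> oU; rewrite openE => y [cy Uy].
have n1 : nbhs y (linv c @^-1` U).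
  by apply: (linv_continuous cy); exact: open_nbhs_nbhs.
have n2 : nbhs y (lcod c) by apply: open_nbhs_nbhs; split => //; exact: lcod_open.
exact: (filterI n2 n1).
Qed.

Lemma chart_cod_mem c (U : set P) p : ldom c p -> U p -> (lcod c `&` linv c @^-1` U) (c p).
Proof. by move=> cp Up; split; [exact: lmap_cod|rewrite /= lmapK]. Qed.

Lemma chart_nbhs c p (N : set P) : ldom c p -> nbhs p N ->
  exists2 d, 0 < d & forall x, ldom c x -> `|c x - c p| < d -> N x.
Proof.
move=> cp Np; have : nbhs (c p) (linv c @^-1` N).
  by apply: (linv_continuous (lmap_cod cp)); rewrite lmapK.
move=> /nbhs_ballP[d /= d0 dN]; exists d => // x cx xd.
by rewrite -(lmapK cx); apply: dN; rewrite -ball_normE /= distrC.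
Qed.

Lemma chart_near c p e : ldom c p -> 0 < e -> nbhs p [set x | ldom c x /\ `|c x - c p| < e].
Proof.
move=> cp e0.
have n1 : nbhs p (c @^-1` ball (c p) e) by apply: (lmap_continuous cp); exact: nbhsx_ballx.
have n2 : nbhs p (ldom c) by apply: open_nbhs_nbhs; split => //; exact: ldom_open.
by apply: filterS2 n2 n1 => x cx; rewrite /= -ball_normE /= distrC.
Qed.

Lemma transition_strict_diff c d p : atlas c -> atlas d -> ldom c p -> ldom d p ->
  strict_diff (d \o linv c) (c p) (mulmxr (jacobian (d \o linv c) (c p))).
Proof.
move=> ac ad cp dp; apply: smooth_strict_diff_row (atlas_compatible ac ad).
  by apply: chart_cod_open; exact: ldom_open.
exact: chart_cod_mem.
Qed.

(** Strict derivatives compose and are unique, and the two transition maps are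
    inverse to each other near the point. *)
Lemma transition_jacobianK c d p : atlas c -> atlas d -> ldom c p -> ldom d p ->
  jacobian (d \o linv c) (c p) *m jacobian (c \o linv d) (d p) = 1%:M.
Proof.
move=> ac ad cp dp.
have s1 := transition_strict_diff ac ad cp dp.
have s2 := transition_strict_diff ad ac dp cp.
have dcp : (d \o linv c) (c p) = d p by rewrite /= lmapK.
rewrite -{1}dcp in s2; have s3 := strict_diff_comp s1 s2.
have sid : strict_diff ((c \o linv d) \o (d \o linv c)) (c p) (idfun : {linear 'rV[R]_n -> 'rV[R]_n}).
  apply: strict_diff_near (@strict_diff_id _ _ (c p)).
  have oV := chart_cod_open (c := c) (ldom_open d).
  have : nbhs (c p) (lcod c `&` linv c @^-1` ldom d).
    by apply: open_nbhs_nbhs; split => //; exact: chart_cod_mem.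
  by apply: filterS => y [cy dy]; rewrite /= (lmapK dy) linvK.
apply/row_matrixP => i; rewrite !rowE mulmxA mulmx1.
exact: (strict_diff_unique s3 sid (delta_mx 0 i)).
Qed.

End Charts.

(** * Covectors bounded below on secants *)

Section Noncharacteristic.
Variables (R : realType) (n : nat) (P : manifold R n) (M : set P).
Implicit Types (c d : local_chart R P n) (p : P).

(** The quantitative form of: xi kills no nonzero vector of the Whitney cone of
    M at p. *)
Definition noncharacteristic c (xi : 'rV[R]_n) p :=
  exists2 e, 0 < e & exists2 N, nbhs p N & forall x y, N x -> N y -> M x -> M y ->
    e * `|c y - c x| <= `|pairing xi (c y - c x)|.

Lemma pairing_bound1 (xi v : 'rV[R]_n) : `|pairing xi v| <= (n%:R * `|xi| + 1) * `|v|.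
Proof. by apply: le_trans (pairing_bound _ _) _; rewrite ler_wpM2r// lerDl. Qed.

(** Secants in the two charts differ by the differential of the transition map,
    up to a small multiple of their length. *)
Lemma noncharacteristic_transfer c d xi p : atlas c -> atlas d -> ldom c p -> ldom d p ->
  noncharacteristic d xi p ->
  noncharacteristic c (xi *m (jacobian (d \o linv c) (c p))^T) p.
Proof.
move=> ac ad cp dp [e e0 [N Np NM]].
have sT := transition_strict_diff ac ad cp dp.
(* l bounds secants in c by those in d, C bounds the norm of xi *)
have [l [r [l0 r0 lip]]] := strict_diff_lipschitz (transition_strict_diff ad ac dp cp).
pose C := n%:R * `|xi| + 1; have C0 : 0 < C by rewrite ltr_wpDl// mulr_ge0.
have [s s0 sP] := sT (e / (2 * l) / C) ltac:(by rewrite !divr_gt0// mulr_gt0).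
exists (e / (2 * l)); first by rewrite divr_gt0// mulr_gt0.
exists (N `&` ([set x | ldom c x /\ `|c x - c p| < s] `&` [set x | ldom d x /\ `|d x - d p| < r])).
  by apply: filterI => //; apply: filterI; exact: chart_near.
move=> x y [Nx [[cx xs] [dx xr]]] [Ny [[cy ys] [dy yr]]] Mx My.
rewrite -pairing_mulmx.
have h1 := NM x y Nx Ny Mx My.
have h2 := sP (c x) (c y) xs ys; rewrite /= !lmapK// in h2.
have h3 := lip (d x) (d y) xr yr; rewrite /= !lmapK// in h3.
set u := c y - c x in h2 h3 *; set w := d y - d x in h1 h2 h3.
have h4 : `|pairing xi w - pairing xi (u *m jacobian (d \o linv c) (c p))| <= e / (2 * l) * `|u|.
  rewrite -pairingB (le_trans (pairing_bound1 _ _))// -/C mulrC -ler_pdivlMr//.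
  by rewrite (le_trans h2)// mulrAC.
have h5 : e / l * `|u| <= e * `|w|.
  by rewrite mulrAC ler_pdivrMr// -mulrA ler_pM2l// mulrC.
have h6 : e / l * `|u| - e / (2 * l) * `|u| = e / (2 * l) * `|u|.
  rewrite -mulrBl; congr (_ * _); rewrite invfM mulrCA [e / l as X in X - _ = _]splitr.
  by rewrite [2^-1 * _]mulrC addrK.
rewrite -h6 lerBlDr (le_trans h5)// (le_trans h1)//.
rewrite -lerBlDl; apply: le_trans h4.
exact: lerB_dist.
Qed.

Lemma ball_dist m (x y : 'rV[R]_m) e : ball x e y <-> `|y - x| < e.
Proof. by rewrite -ball_normE /= distrC. Qed.

Lemma noncharacteristic_near c xi p : ldom c p -> noncharacteristic c xi p ->
  \forall z \near (c p, xi), forall q, ldom c q -> c q = z.1 -> noncharacteristic c z.2 q.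
Proof.
move=> cp [e e0 [N Np NM]].
have [d d0 dN] := chart_nbhs cp Np.
have n0 : 0 < e / 2 / n.+1%:R by rewrite !divr_gt0.
apply/nbhs_ballP; exists (Num.min d (e / 2 / n.+1%:R)); first by rewrite /= lt_min d0.
move=> [b eta] [/= /ball_dist + /ball_dist].
rewrite !lt_min => /andP[bd _] /andP[_ etad].
move=> q cq cqb; exists (e / 2); first by rewrite divr_gt0.
exists [set x | ldom c x /\ `|c x - c q| < d - `|b - c p|].
  by apply: chart_near => //; rewrite subr_gt0.
have inN x : ldom c x -> `|c x - c q| < d - `|b - c p| -> N x.
  move=> cx xq; apply: dN => //; rewrite -(subrKA (c q)) (le_lt_trans (ler_normD _ _))//.
  by rewrite -ltrBrDr; move: xq; rewrite cqb.
move=> x y [cx xq] [cy yq] Mx My.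
have := NM x y (inN _ cx xq) (inN _ cy yq) Mx My.
set u := c y - c x => h.
have h2 : `|pairing xi u - pairing eta u| <= e / 2 * `|u|.
  rewrite -pairingBl (le_trans (pairing_bound _ _))// ler_wpM2r//.
  rewrite distrC; apply: (@le_trans _ _ (n%:R * (e / 2 / n.+1%:R))).
    by rewrite ler_wpM2l// ltW.
  by rewrite mulrCA ger_pMr ?divr_gt0// ler_pdivrMr// mul1r ler_nat.
have h3 : e * `|u| = e / 2 * `|u| + e / 2 * `|u| by rewrite -mulrDl -splitr.
rewrite -(lerD2r (e / 2 * `|u|)) -h3 (le_trans h)// -lerBlDl.
exact: le_trans (lerB_dist _ _) h2.
Qed.

Lemma small_invS (e : R) : 0 < e -> \forall m \near \oo, (m.+1%:R^-1 : R) < e.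
Proof. by move=> e0; exact: (near_infty_natSinv_lt (PosNum e0)). Qed.

(** If the bound fails for every constant, the failing secants, scaled to unit
    length, accumulate at a unit vector by compactness; it belongs to the cone
    and is killed by the covector. *)
Lemma noncharacteristicPn (w : cotangent P) : ~ top_set (whitney_cone M M) w ->
  noncharacteristic (chart_at (cbase w)) (covec w) (cbase w).
Proof.
case: w => p xi /= ntop; apply: contrapT => nnc; apply: ntop.
set c := chart_at p in nnc *; have cp : ldom c p := chart_at_dom p.
have ex k : exists z : P * P, [/\ M z.1, M z.2,
    ldom c z.1 /\ `|c z.1 - c p| < k.+1%:R^-1, ldom c z.2 /\ `|c z.2 - c p| < k.+1%:R^-1 &
    `|pairing xi (c z.2 - c z.1)| < k.+1%:R^-1 * `|c z.2 - c z.1| ].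
  apply: contrapT => nex; apply: nnc; exists k.+1%:R^-1; first by rewrite invr_gt0.
  exists [set x | ldom c x /\ `|c x - c p| < k.+1%:R^-1].
    by apply: chart_near => //; rewrite invr_gt0.
  move=> x y Nx Ny Mx My; rewrite leNgt; apply/negP => lt.
  by apply: nex; exists (x, y).
pose z k := projT1 (cid (ex k)).
pose D k := c (z k).2 - c (z k).1.
have zM k : M (z k).1 /\ M (z k).2 by rewrite /z; case: cid => ? [].
have zN k : [/\ ldom c (z k).1, `|c (z k).1 - c p| < k.+1%:R^-1,
    ldom c (z k).2 & `|c (z k).2 - c p| < k.+1%:R^-1].
  by rewrite /z; case: cid => ? [? ? [? ?] [? ?]].
have zD k : `|pairing xi (D k)| < k.+1%:R^-1 * `|D k|.
  by rewrite /D /z; case: cid => ? [].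
have D0 k : 0 < `|D k|.
  rewrite normr_gt0; apply/eqP => D0; have := zD k.
  by rewrite D0 pairing0 !normr0 mulr0 ltxx.
pose u k := `|D k|^-1 *: D k.
have u1 k : `|u k| = 1 by rewrite normrZ normfV normr_id mulVf// gt_eqF.
pose S := [set v : 'rV[R]_n | `|v| = 1].
have cS : compact S.
  apply: bounded_closed_compact.
    by exists 1; split => // r r1 v /= ->; exact: ltW.
  have -> : S = Num.norm @^-1` [set 1 : R] by [].
  by apply: preimage_closed; [move=> v _; exact: norm_continuous|exact: closed_eq].
have uS : (u @ \oo) S by exists 0%N => // k _; exact: u1.
have [v [Sv clv]] := cS _ _ uS.
have exk m : exists k, (m <= k)%N /\ `|u k - v| < m.+1%:R^-1.
  have [||_ [[k /= mk <-]]] := clv (u @` [set k | (m <= k)%N]) (ball v m.+1%:R^-1).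
  - by exists m => // k mk; exists k.
  - have m0 : 0 < m.+1%:R^-1 :> R by rewrite invr_gt0.
    by apply/nbhs_ballP; exists m.+1%:R^-1.
  by move=> /ball_dist kv; exists k.
pose K m := projT1 (cid (exk m)).
have Kge m : (m <= K m)%N by rewrite /K; case: cid => ? [].
have Kv m : `|u (K m) - v| < m.+1%:R^-1 by rewrite /K; case: cid => ? [].
have Kinv m : ((K m).+1%:R^-1 : R) <= m.+1%:R^-1 by rewrite lef_pV2 ?posrE// ler_nat ltnS.
exists v; split.
- exists (fun m => (z (K m)).1), (fun m => (z (K m)).2), (fun m => `|D (K m)|^-1); split.
  + by move=> m; exact: (zM _).1.
  + by move=> m; exact: (zM _).2.
  + by move=> m; rewrite invr_gt0.
  + split.
    * move=> N /(chart_nbhs cp)[d d0 dN]; apply: filterS (small_invS d0) => m md.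
      have [h1 h2 _ _] := zN (K m); apply: dN => //.
      by rewrite (lt_trans h2)// (le_lt_trans (Kinv m)).
    * move=> N /(chart_nbhs cp)[d d0 dN]; apply: filterS (small_invS d0) => m md.
      have [_ _ h1 h2] := zN (K m); apply: dN => //.
      by rewrite (lt_trans h2)// (le_lt_trans (Kinv m)).
    * apply/cvgrPdist_lt => e e0; apply: filterS (small_invS e0) => m me.
      by rewrite distrC (lt_trans (Kv m)).
- by rewrite -normr_gt0 Sv.
- apply/eqP; rewrite -normr_le0 leNgt; apply/negP => pos.
  pose C := n%:R * `|xi| + 1; have C0 : 0 < C by rewrite ltr_wpDl// mulr_ge0.
  have C1 : 0 < 1 + C by apply: addr_gt0.
  have [m _ /(_ m (leqnn m)) mC] : \forall m \near \oo, (m.+1%:R^-1 : R) < `|pairing xi v| / (1 + C).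
    by apply: small_invS; rewrite divr_gt0// addr_gt0.
  move: mC; rewrite (ltr_pdivlMr _ _ C1) ltNge => /negP; apply.
  rewrite -(subrK (pairing xi (u (K m))) (pairing xi v)) (le_trans (ler_normD _ _))//.
  rewrite mulrDr mulr1 addrC lerD//.
    rewrite pairingZ normrM normfV normr_id -ler_pdivlMl ?invr_gt0// invrK mulrC.
    by rewrite (le_trans (ltW (zD _)))// ler_wpM2r.
  by rewrite -pairingB (le_trans (pairing_bound1 _ _))// -/C mulrC ler_wpM2r// ?ltW// distrC.
Qed.

End Noncharacteristic.

(** * Continuous injective functions on an interval *)

Section ArcFlip.
Variables (R : realType) (T : topologicalType) (A : set T) (C : arc R A).

Lemma flip_itv (r t : R) : (- r < - t < r) = (- r < t < r).
Proof. by rewrite ltrN2 ltrNl andbC. Qed.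

Program Definition arc_flip : arc R A := @Arc R T A (arc_open C)
  (fun x => - arc_coord C x) (fun t => arc_par C (- t)) (arc_rad C) _ _ _ _.
Next Obligation.
by move=> x Wx; apply: continuousN; exact: arc_coord_cont.
Qed.
Next Obligation.
move=> t tr; apply: continuous_comp; first exact: opp_continuous.
by apply: arc_par_cont; rewrite flip_itv.
Qed.
Next Obligation.
move=> t tr; have [|? ? ->] := @arc_parP _ _ _ C (- t); first by rewrite flip_itv.
by rewrite opprK.
Qed.
Next Obligation.
by move=> x Wx Ax; have [? ?] := arc_coordP Wx Ax; rewrite flip_itv opprK.
Qed.
End ArcFlip.

Section RealLemmas.
Variable R : realType.

Lemma one_between (a b c : R) : [\/ Num.min a b <= c <= Num.max a b,
  Num.min b c <= a <= Num.max b c | Num.min a c <= b <= Num.max a c].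
Proof.
rewrite !ge_min !le_max.
have [ab|/ltW ba] := leP a b; have [bc|/ltW cb] := leP b c; have [ac|/ltW ca] := leP a c.
- by apply: Or33; rewrite ?ab ?bc ?orbT.
- by apply: Or33; rewrite ?ab ?bc ?orbT.
- by apply: Or31; rewrite ?ac ?cb ?orbT.
- by apply: Or32; rewrite ?ca ?ab ?orbT.
- by apply: Or32; rewrite ?ba ?ac ?orbT.
- by apply: Or31; rewrite ?bc ?ca ?orbT.
- by apply: Or33; rewrite ?cb ?ba ?orbT.
- by apply: Or33; rewrite ?cb ?ba ?orbT.
Qed.

Lemma IVT_at (g : R -> R) (a b v : R) : a <= b ->
  (forall t, a <= t <= b -> {for t, continuous g}) ->
  Num.min (g a) (g b) <= v <= Num.max (g a) (g b) ->
  exists2 c, a <= c <= b & g c = v.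
Proof.
move=> ab gc gv; have [|c + <-] := IVT ab _ gv.
  apply: continuous_in_subspaceT => t; rewrite inE /= in_itv /=; exact: gc.
by rewrite in_itv /=; exists c.
Qed.

(** Otherwise, for some s < 0 < t, one of g s and g t would lie between 0 and
    the other; the intermediate value theorem would then yield this value a
    second time. *)
Lemma injective_signs (g : R -> R) (r : R) : 0 < r -> g 0 = 0 ->
  (forall t, - r < t < r -> {for t, continuous g}) ->
  (forall s t, - r < s < r -> - r < t < r -> g s = g t -> s = t) ->
  (forall t, - r < t < r -> (0 <= g t <-> 0 <= t)) \/
  (forall t, - r < t < r -> (0 <= g t <-> t <= 0)).
Proof.
move=> r0 g0 gc gi.
have zr : - r < 0 < r by rewrite oppr_lt0 r0.
have opp s t : - r < s < 0 -> 0 < t < r -> (g s < 0) && (0 < g t) || (g t < 0) && (0 < g s).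
  move=> /andP[rs s0] /andP[t0 tr].
  have sr : - r < s < r by rewrite rs (lt_trans s0).
  have tr' : - r < t < r by rewrite (lt_trans _ t0) ?oppr_lt0.
  have gs0 : g s != 0 by apply/eqP; rewrite -g0 => /(gi _ _ sr zr) s0'; move: s0; rewrite s0' ltxx.
  have gt0 : g t != 0 by apply/eqP; rewrite -g0 => /(gi _ _ tr' zr) t0'; move: t0; rewrite t0' ltxx.
  have [h|h|h] := one_between (g s) (g t) (g 0).
  - move: h; rewrite g0 ge_min le_max.
    have [gs|gs|/eqP] := ltgtP (g s) 0; last by rewrite (negbTE gs0).
      by have [gt|gt|/eqP] := ltgtP (g t) 0; rewrite //= (negbTE gt0).
    by have [gt|gt|/eqP] := ltgtP (g t) 0; rewrite //= (negbTE gt0).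
  - rewrite minC maxC in h; have [|c /andP[c0 ct] gcs] := IVT_at (ltW t0) _ h.
      by move=> u /andP[u0 ut]; apply: gc; rewrite (lt_le_trans _ u0) ?(le_lt_trans ut) ?oppr_lt0.
    have := gi c s _ sr gcs; rewrite (lt_le_trans _ c0) ?(le_lt_trans ct) ?oppr_lt0// => /(_ isT) cs.
    by move: s0; rewrite -cs ltNge c0.
  - have [|c /andP[cs c0] gct] := IVT_at (ltW s0) _ h.
      by move=> u /andP[su u0]; apply: gc; rewrite (lt_le_trans rs su) (le_lt_trans u0).
    have := gi c t _ tr' gct; rewrite (lt_le_trans rs cs) (le_lt_trans c0)// => /(_ isT) ct.
    by move: t0; rewrite -ct ltNge c0.
have r2 : 0 < r / 2 < r by rewrite divr_gt0// ltr_pdivrMr// ltr_pMr// ltr1n.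
have r2' : - r < - (r / 2) < 0 by rewrite ltrN2 oppr_lt0 andbC.
have [pos|neg] := ltP 0 (g (r / 2)).
- have neg s : - r < s < 0 -> g s < 0.
    by move=> sr; have := opp s _ sr r2; rewrite pos [g (r / 2) < 0]ltNge (ltW pos) /= andbT orbF.
  have post t : 0 < t < r -> 0 < g t.
    move=> tr; have := opp _ t r2' tr.
    by rewrite (neg _ r2') /= [0 < g (- _)]ltNge (ltW (neg _ r2')) /= andbF orbF.
  left=> t /andP[rt tr]; have [t0|t0|->] := ltgtP t 0; last by rewrite g0 lexx.
  + by rewrite leNgt neg// rt.
  + by rewrite ltW// post// t0.
- have pos s : - r < s < 0 -> 0 < g s.
    by move=> sr; have := opp s _ sr r2; rewrite [0 < g (r / 2)]ltNge neg andbF /= => /andP[].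
  have negt t : 0 < t < r -> g t < 0.
    move=> tr; have := opp _ t r2' tr.
    by rewrite [g (- _) < 0]ltNge (ltW (pos _ r2')) /= => /andP[].
  right=> t /andP[rt tr]; have [t0|t0|->] := ltgtP t 0; last by rewrite g0 lexx.
  + by rewrite ltW// pos// rt.
  + by rewrite leNgt negt// t0.
Qed.

End RealLemmas.

(** * Locally flat subsets near a point *)

Section FlatCharts.
Variables (R : realType) (n : nat) (P : manifold R n) (M : set P).
Implicit Types p : P.

Lemma norm_delta_le (i : 'I_n) (t : R) : `|t *: (delta_mx 0 i : 'rV[R]_n)| <= `|t|.
Proof.
apply: row_norm_le => // j; rewrite !mxE normrM; case: (_ && _) => /=.
  by rewrite normr1 mulr1.
by rewrite normr0 mulr0.
Qed.

Lemma chart_ball (h : local_chart R P n) p (N : set P) : ldom h p -> nbhs p N ->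
  exists2 r, 0 < r & forall u : 'rV[R]_n, `|u| < r -> lcod h (h p + u) /\ N (linv h (h p + u)).
Proof.
move=> hp Np; have [d d0 dN] := chart_nbhs hp Np.
have : nbhs (h p) (lcod h) by apply: open_nbhs_nbhs; split; [exact: lcod_open|exact: lmap_cod].
move=> /nbhs_ballP[e /= e0 eC].
exists (Num.min d e); first by rewrite lt_min d0.
move=> u; rewrite lt_min => /andP[ud ue].
have cu : lcod h (h p + u).
  by apply: eC; rewrite -ball_normE /= distrC addrAC subrr add0r.
split=> //; apply: dN; first exact: linv_dom.
by rewrite linvK// addrAC subrr add0r.
Qed.

(** In a flat chart M is a coordinate axis near p; the arc is the part of it
    over a small ball, with the first coordinate as parameter. *)
Lemma flat1_arc p (N : set P) : M p -> locally_flat_at M 1 p -> nbhs p N ->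
  exists C : arc R M, [/\ 0 < arc_rad C, arc_par C 0 = p &
    forall x, oset (arc_open C) x -> N x].
Proof.
move=> Mp [n0 [h [hp hM]]] Np.
pose i0 := Ordinal n0; pose E : 'rV[R]_n := delta_mx 0 i0.
have [r r0 rP] := chart_ball hp Np.
have hp0 (i : 'I_n) : (1 <= i)%N -> h p 0 i = 0 by exact: ((hM p hp).1 Mp).
have oW : open [set x | ldom h x /\ `|h x - h p| < r].
  rewrite openE => x [hx xr].
  have nx := chart_near hx (e := r - `|h x - h p|) ltac:(by rewrite subr_gt0).
  apply: filterS nx => y [hy yr]; split => //.
  by rewrite -(subrKA (h x)) (le_lt_trans (ler_normD _ _))// -ltrBrDr.
pose tau x := h x 0 i0 - h p 0 i0.
pose gam t := linv h (h p + t *: E).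
have tau_cont x : oset (Opens oW) x -> {for x, continuous tau}.
  move=> [hx _]; apply: (@continuousB _ _ _ (fun x => h x 0 i0 : R^o) (cst (h p 0 i0)));
    last exact: cst_continuous.
  apply: (continuous_comp (f := h) (g := fun v : 'rV[R]_n => v 0 i0 : R^o)); first exact: lmap_continuous.
  exact: coord_continuous.
have small t : - r < t < r -> `|t *: E| < r.
  by move=> tr; rewrite (le_lt_trans (norm_delta_le _ _))// ltr_norml.
have gam_cont t : - r < t < r -> {for t, continuous gam}.
  move=> /small/rP[ct _].
  apply: (@continuous_comp R 'rV[R]_n P (fun t => h p + t *: E) (linv h) t); last exact: linv_continuous.
  apply: (@continuousD _ _ _ (cst (h p)) (fun t : R => t *: E)); first exact: cst_continuous.
  exact: scalel_continuous.
have gamP t : - r < t < r -> [/\ oset (Opens oW) (gam t), M (gam t) & tau (gam t) = t].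
  move=> tr; have [ct _] := rP _ (small t tr); have hg : ldom h (gam t) by exact: linv_dom.
  split.
  - by split => //=; rewrite /gam linvK// addrAC subrr add0r; exact: small.
  - apply/(hM _ hg) => i i1; rewrite /gam linvK// !mxE hp0// eqxx /=.
    have -> : i == i0 = false by apply/negP => /eqP ii; move: i1; rewrite ii.
    by rewrite mulr0 addr0.
  - by rewrite /tau /gam linvK// !mxE !eqxx /= mulr1 addrAC subrr add0r.
have tauP x : oset (Opens oW) x -> M x -> - r < tau x < r /\ gam (tau x) = x.
  move=> [hx xr] Mx; split.
    by rewrite -ltr_norml (le_lt_trans _ xr)//; have := coord_norm (h x - h p) i0; rewrite !mxE.
  rewrite /gam -[RHS](lmapK hx); congr (linv h _); apply/rowP => i; rewrite !mxE eqxx /=.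
  have [->|ii] := eqVneq i i0; first by rewrite mulr1 /tau subrKC.
  have i1 : (1 <= i)%N by rewrite lt0n; apply: contra ii => /eqP i0E; apply/eqP/val_inj.
  by rewrite mulr0 addr0 hp0//; apply/esym; exact: ((hM x hx).1 Mx).
exists (@Arc R P M (Opens oW) tau gam r tau_cont gam_cont gamP tauP); split => //=.
  by rewrite /gam scale0r addr0 lmapK.
move=> x [hx xr]; have [_ Nx] := rP (h x - h p) xr.
by rewrite subrKC lmapK in Nx.
Qed.

(** Take a triangle in the plane of the first two coordinates. The vertex with
    the middle value is not on the opposite edge, but by the intermediate value
    theorem its value is taken on this edge. *)
Lemma flat2_not_injective p (N : set P) m (f : P -> R) : M p -> (2 <= m)%N ->
  locally_flat_at M m p -> nbhs p N ->
  (forall x, N x -> {for x, continuous f}) ->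
  (forall x y, N x -> N y -> M x -> M y -> f x = f y -> x = y) -> False.
Proof.
move=> Mp m2 [mn [h [hp hM]]] Np fc fi.
have n1 : (1 < n)%N := leq_trans m2 mn.
pose i0 := Ordinal (ltnW n1); pose i1 := Ordinal n1.
have [r r0 rP] := chart_ball hp Np.
pose S := [set u : 'rV[R]_n | `|u| < r /\ forall i : 'I_n, (m <= i)%N -> u 0 i = 0].
pose q u := linv h (h p + u).
have qS u : S u -> N (q u) /\ M (q u).
  move=> [ur um]; have [cu Nu] := rP u ur; split => //.
  apply/(hM _ (linv_dom cu)) => i im; rewrite /q linvK// mxE um// addr0.
  exact: ((hM p hp).1 Mp).
have G_inj u v : S u -> S v -> f (q u) = f (q v) -> u = v.
  move=> Su Sv /fi; have [Nu Mu] := qS u Su; have [Nv Mv] := qS v Sv.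
  move=> /(_ Nu Nv Mu Mv) /(congr1 h).
  have [cu _] := rP u Su.1; have [cv _] := rP v Sv.1.
  by rewrite /q !linvK// => /addrI.
have G_cont u : S u -> {for u, continuous (fun u => f (q u))}.
  move=> Su; apply: (continuous_comp (f := q) (g := f)); last exact: fc (qS u Su).1.
  apply: (continuous_comp (f := fun u => h p + u) (g := linv h)).
    apply: (@continuousD _ _ _ (cst (h p)) id); first exact: cst_continuous.
    exact: cvg_id.
  by have [cu _] := rP u Su.1; exact: linv_continuous.
(* a point of an edge has norm at most 3 e < r *)
pose e := r / 4; have e0 : 0 < e by rewrite divr_gt0.
pose a : 'rV[R]_n := 0; pose b : 'rV[R]_n := e *: delta_mx 0 i0; pose c : 'rV[R]_n := e *: delta_mx 0 i1.
pose vertex (u : 'rV[R]_n) := `|u| <= e /\ forall i : 'I_n, (m <= i)%N -> u 0 i = 0.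
have [va vb vc] : [/\ vertex a, vertex b & vertex c].
  split; split; rewrite /a /b /c.
  - by rewrite normr0 ltW.
  - by move=> i _; rewrite mxE.
  - by rewrite (le_trans (norm_delta_le _ _))// gtr0_norm.
  - move=> i im; rewrite !mxE eqxx /=; have [ii|_] := eqVneq i i0; last by rewrite mulr0.
    by move: im; rewrite ii leqNgt (ltnW m2).
  - by rewrite (le_trans (norm_delta_le _ _))// gtr0_norm.
  - move=> i im; rewrite !mxE eqxx /=; have [ii|_] := eqVneq i i1; last by rewrite mulr0.
    by move: im; rewrite ii leqNgt m2.
have segS x y (t : R) : vertex x -> vertex y -> 0 <= t <= 1 -> S (x + t *: (y - x)).
  move=> [xe xm] [ye ym] /andP[t0 t1]; split; last first.
    by move=> i im; rewrite !mxE xm// ym// subrr mulr0 addr0.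
  apply: (@le_lt_trans _ _ (e + (e + e))).
    rewrite (le_trans (ler_normD _ _))// lerD// normrZ ger0_norm//.
    rewrite (@le_trans _ _ `|y - x|)// ?ler_piMl//.
    by rewrite (le_trans (ler_normB _ _))// lerD.
  have -> : r = e + (e + (e + e)) by rewrite /e; field.
  by rewrite !ltrD2l// ltrDl.
have opposite x y z : vertex x -> vertex y -> vertex z ->
    (forall t : R, x + t *: (y - x) <> z) ->
    ~ (Num.min (f (q x)) (f (q y)) <= f (q z) <= Num.max (f (q x)) (f (q y))).
  move=> vx vy vz nseg mid.
  pose g t := f (q (x + t *: (y - x))).
  have [||t t01 gt] := @IVT_at R g 0 1 (f (q z)) ler01.
  - move=> t t01; apply: (continuous_comp (f := fun t : R => x + t *: (y - x)) (g := fun u => f (q u))).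
      apply: (@continuousD _ _ _ (cst x) (fun t : R => t *: (y - x))); first exact: cst_continuous.
      exact: scalel_continuous.
    exact: G_cont (segS _ _ _ vx vy t01).
  - by rewrite /g scale0r addr0 scale1r subrKC.
  apply: (nseg t); apply: G_inj gt; first exact: segS.
  have := segS z z 0 vz vz; rewrite scale0r addr0; apply.
  by rewrite lexx ler01.
have i01 : (i0 == i1) = false by [].
have i10 : (i1 == i0) = false by [].
have ne0 : e <> 0 by move=> e00; move: e0; rewrite e00 ltxx.
(* the coordinates i0 and i1 show that no edge contains the opposite vertex *)
have [h1|h1|h1] := one_between (f (q a)) (f (q b)) (f (q c)); apply: opposite h1 => // t.
- move=> /rowP /(_ i1); rewrite !mxE !eqxx i10 /= ?(mulr0, mulr1, addr0, add0r, subr0) => /esym//.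
- move=> /rowP E; have := E i0; have := E i1.
  rewrite !mxE !eqxx i10 i01 /= ?(mulr0, mulr1, addr0, add0r, subr0, sub0r).
  move=> E1; rewrite mulrN E1 subr0 => //.
- move=> /rowP /(_ i0); rewrite !mxE !eqxx i01 /= ?(mulr0, mulr1, addr0, add0r, subr0) => /esym//.
Qed.

End FlatCharts.

(** * The microsupport of a submanifold is contained in the annihilator of its secants *)

Section Inclusion.
Variables (R : realType) (k : comNzRingType) (n : nat) (P : manifold R n) (M : set P).
Hypothesis M_closed : closed M.
Implicit Types (p : P) (w : cotangent P).

Lemma atlas_at p : atlas (chart_at p). Proof. exact: chart_at_atlas. Qed.

Lemma smooth_function_continuous (phi : P -> R) (U : set P) x :
  smooth_function_on phi U -> U x -> {for x, continuous phi}.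
Proof.
move=> sm Ux; set c := chart_at x; have cx : ldom c x := chart_at_dom x.
have [h _] := sm c (atlas_at x) 0%N.
have cc : {for c x, continuous (phi \o linv c)} := h (c x) (chart_cod_mem cx Ux).
have h2 : {for x, continuous ((phi \o linv c) \o c)}.
  by apply: continuous_comp => //; exact: lmap_continuous.
have nE : \forall y \near x, ((phi \o linv c) \o c) y = phi y.
  have nc : nbhs x (ldom c) by apply: open_nbhs_nbhs; split => //; exact: ldom_open.
  by apply: filterS nc => y cy; rewrite /= lmapK.
rewrite /prop_for /continuous_at -(nbhs_singleton nE).
apply: cvg_trans h2; exact: (near_eq_cvg nE).
Qed.

Lemma open_sublevel (phi : P -> R) (U : set P) : open U -> smooth_function_on phi U ->
  open (U `\` [set x | U x /\ 0 <= phi x]).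
Proof.
move=> oU sm; rewrite openE => x [Ux nZ].
have xneg : phi x < 0 by rewrite ltNge; apply/negP => x0; apply: nZ.
have nU : nbhs x U by exact: open_nbhs_nbhs.
have nphi : nbhs x (phi @^-1` `]-oo, 0[%classic).
  apply: (smooth_function_continuous sm Ux).
  by apply: open_nbhs_nbhs; split; [exact: interval_open|rewrite /= in_itv].
apply: filterS2 nU nphi => y Uy; rewrite /= in_itv /= => y0; split => // -[_].
by rewrite leNgt y0.
Qed.

Lemma smooth_function_strict_diff (phi : P -> R) (U : set P) c p : open U -> U p ->
  atlas c -> ldom c p -> smooth_function_on phi U ->
  exists xi, strict_diff (phi \o linv c : 'rV[R]_n -> R^o) (c p) (pair_with xi).
Proof.
move=> oU Up ac cp sm; apply: (smooth_strict_diff (chart_cod_open (c := c) oU) _ (sm c ac)).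
exact: chart_cod_mem.
Qed.

Lemma has_differential_strict_diff (phi : P -> R) (U : set P) w : open U -> U (cbase w) ->
  smooth_function_on phi U -> has_differential phi w ->
  strict_diff (phi \o linv (chart_at (cbase w)) : 'rV[R]_n -> R^o) (chart_at (cbase w) (cbase w))
    (pair_with (covec w)).
Proof.
move=> oU Up sm dphi.
have [xi sx] := smooth_function_strict_diff oU Up (atlas_at _) (chart_at_dom _) sm.
suff -> : covec w = xi by [].
apply: pairing_inj => v; rewrite -dphi.
by have [_ ->] := strict_diff_diff sx.
Qed.

(** On secants of M near the point, phi differs from the covector by at most
    half of the lower bound. *)
Lemma noncharacteristic_injective (phi : P -> R) (U : set P) w : open U -> U (cbase w) ->
  smooth_function_on phi U -> has_differential phi w ->
  noncharacteristic M (chart_at (cbase w)) (covec w) (cbase w) ->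
  exists N, [/\ nbhs (cbase w) N, N `<=` U &
    forall x y, N x -> N y -> M x -> M y -> phi x = phi y -> x = y].
Proof.
move=> oU Up sm dphi [e e0 [N Np NM]].
have sd := has_differential_strict_diff oU Up sm dphi.
set c := chart_at _ in sd NM; have cp : ldom c (cbase w) := chart_at_dom _.
have e2 : 0 < e / 2 by rewrite divr_gt0.
have [d d0 dP] := sd _ e2.
exists (N `&` U `&` [set x | ldom c x /\ `|c x - c (cbase w)| < d]); split.
- by apply: filterI; [apply: filterI => //; exact: open_nbhs_nbhs|exact: chart_near].
- by move=> x [[]].
move=> x y [[Nx _] [cx xd]] [[Ny _] [cy yd]] Mx My phixy.
have := dP _ _ xd yd; rewrite /= !lmapK// phixy subrr sub0r normrN => h.
have le2 := le_trans (NM x y Nx Ny Mx My) h.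
have [u0|u0] := eqVneq (c y - c x) 0.
  by rewrite -(lmapK cx) -(lmapK cy); congr (linv c _); apply/esym/eqP; rewrite -subr_eq0 u0.
exfalso; move: le2; rewrite ler_pM2r ?normr_gt0// leNgt => /negP; apply.
by rewrite ltr_pdivrMr// ltr_pMr// ltr1n.
Qed.

Lemma noncharacteristic_Ppg w : C0_submanifold M ->
  (forall p, M p -> ~ locally_flat_at M 0 p) ->
  noncharacteristic M (chart_at (cbase w)) (covec w) (cbase w) ->
  Ppg (constant_sheaf k M) w.
Proof.
move=> M_C0 M_pos nc U phi oU Up sm phi0 dphi.
have [Mp|nMp] := pselect (M (cbase w)); last exact: RGamma_zero_off.
have [N [Np NU Ninj]] := noncharacteristic_injective oU Up sm dphi nc.
have Nc x : N x -> {for x, continuous phi}.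
  by move=> /NU; exact: smooth_function_continuous sm.
have oUZ := open_sublevel oU sm.
have [[|[|m]] flat] := M_C0 _ Mp.
- by have := M_pos _ Mp.
- have [C [r0 C0 CN]] := flat1_arc Mp flat Np.
  have CNp t : - arc_rad C < t < arc_rad C -> N (arc_par C t) /\ M (arc_par C t).
    by move=> /arc_parP[? ? _]; split => //; exact: CN.
  have [|||posi|nega] := @injective_signs R (phi \o arc_par C) _ r0.
  + by rewrite /= C0.
  + move=> t tr; apply: continuous_comp; first exact: arc_par_cont.
    by apply: Nc; have [] := CNp t tr.
  + move=> s t sr tr /= st; have [Ns Ms] := CNp s sr; have [Nt Mt] := CNp t tr.
    have e := Ninj _ _ Ns Nt Ms Mt st.
    by have [_ _ <-] := arc_parP sr; have [_ _ <-] := arc_parP tr; rewrite e.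
  + rewrite -C0; apply: RGamma_zero_arc => // t tr; rewrite -(posi t tr) /=.
    by split => [[]//|]; split => //; apply: NU; have [] := CNp t tr.
  + have := @RGamma_zero_arc k P M M_closed R (arc_flip C) U [set x | U x /\ 0 <= phi x] r0 oUZ.
    rewrite /= oppr0 C0; apply => t tr.
    have tr' : - arc_rad C < - t < arc_rad C by rewrite flip_itv.
    have := nega _ tr'; rewrite /= oppr_le0 => <-.
    by split => [[]//|]; split => //; apply: NU; have [] := CNp _ tr'.
- exfalso; exact: flat2_not_injective Mp _ flat Np Nc Ninj.
Qed.

(** Openness in the topology of the cotangent bundle is tested in an arbitrary
    chart, hence the change of chart on the way there and on the way back. *)
Lemma noncharacteristic_open :
  open [set w | noncharacteristic M (chart_at (cbase w)) (covec w) (cbase w)].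
Proof.
move=> c ac w /= ncw cw.
have nc1 : noncharacteristic M c (covec_in c w) (cbase w).
  by apply: noncharacteristic_transfer => //; [exact: atlas_at|exact: chart_at_dom].
apply: filterS (noncharacteristic_near cw nc1) => z zP w' cw' zE.
have := zP (cbase w') cw'; rewrite -zE /= => /(_ erefl) nc2.
have := noncharacteristic_transfer (atlas_at (cbase w')) ac (chart_at_dom _) cw' nc2.
rewrite /covec_in -mulmxA -trmx_mul transition_jacobianK ?trmx1 ?mulmx1//.
- exact: atlas_at.
- exact: chart_at_dom.
Qed.

Lemma musupp_subset : C0_submanifold M ->
  (forall p, M p -> ~ locally_flat_at M 0 p) ->
  musupp_set k M `<=` top_set (whitney_cone M M).
Proof.
move=> M_C0 M_pos w cl; apply: contrapT => /noncharacteristicPn nc.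
have [v [nP]] := cl _ (open_nbhs_nbhs (conj noncharacteristic_open nc)).
by move=> /(noncharacteristic_Ppg M_C0 M_pos)/nP.
Qed.

End Inclusion.

(** * Interior extrema, and smoothness of affine functions of a chart *)

Section Extremum.
Variable R : realType.

Definition local_min_at (g : R -> R) t :=
  exists2 e, 0 < e & forall s, t - e < s < t + e -> g t <= g s.

(** Weaker than a strict local maximum, but available without perturbing g, and
    enough to separate the complement of {g >= g t}. *)
Definition descends_on_both_sides (g : R -> R) t :=
  (forall e, 0 < e -> exists2 s, t - e < s < t & g s < g t) /\
  (forall e, 0 < e -> exists2 s, t < s < t + e & g s < g t).

Lemma local_min_itv (g : R -> R) l u t : l < t < u ->
  (forall s, l < s < u -> g t <= g s) -> local_min_at g t.
Proof.
move=> /andP[lt_ tu] gt; exists (Num.min (t - l) (u - t)).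
  by rewrite lt_min !subr_gt0 lt_ tu.
move=> s /andP[ls su]; apply: gt; apply/andP; split.
  apply: le_lt_trans ls; rewrite lerBrDl -lerBrDr.
  by rewrite ge_min lexx.
apply: lt_le_trans su _; rewrite -lerBrDl.
by rewrite ge_min lexx orbT.
Qed.

(** A minimum below g a is interior. Otherwise take a maximum: if it exceeds g a
    it is interior, and if g does not descend on one of its sides, then g is
    constant on an interval there, all of whose points are local minima. *)
Lemma interior_extremum (g : R -> R) a b : a < b ->
  (forall t, a <= t <= b -> {for t, continuous g}) -> g a = g b ->
  exists2 t, a < t < b & local_min_at g t \/ descends_on_both_sides g t.
Proof.
move=> ab gc gab.
have gw : {within `[a, b], continuous g}.
  by apply: continuous_in_subspaceT => t; rewrite inE /= in_itv /=; exact: gc.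
have interior t : a <= t <= b -> g t <> g a -> a < t < b.
  move=> /andP[at_ tb] ne; rewrite !lt_neqAle at_ tb !andbT; apply/andP; split; apply/eqP => e; apply: ne.
    by rewrite -e.
  by rewrite e gab.
have [m + mmin] := EVT_min (ltW ab) gw; rewrite in_itv /= => mab.
have [gma|gma] := ltP (g m) (g a).
  have mi : a < m < b by apply: interior => // e; move: gma; rewrite e ltxx.
  exists m => //; left; apply: (local_min_itv mi) => s /andP[as_ sb].
  by apply: mmin; rewrite in_itv /= !ltW.
have ge_ga t : a <= t <= b -> g a <= g t.
  by move=> tab; apply: (le_trans gma); apply: mmin; rewrite in_itv.
have [M + Mmax] := EVT_max (ltW ab) gw; rewrite in_itv /= => Mab.
have {}Mmax t : a <= t <= b -> g t <= g M by move=> tab; apply: Mmax; rewrite in_itv.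
have [gMa|gaM] := leP (g M) (g a).
  exists ((a + b) / 2); first by rewrite !midf_lt.
  have mid : a < (a + b) / 2 < b by rewrite !midf_lt.
  left; apply: (local_min_itv mid) => s /andP[as_ sb].
  case/andP: mid => am mb.
  apply: (@le_trans _ _ (g a)); last by apply: ge_ga; rewrite !ltW.
  by apply: (le_trans _ gMa); apply: Mmax; rewrite !ltW.
have /andP[aM Mb] : a < M < b by apply: interior => // e; move: gaM; rewrite e ltxx.
have flat l u : a <= l -> l < u -> u <= b -> (forall s, l < s < u -> g M <= g s) ->
    exists2 t, a < t < b & local_min_at g t.
  move=> al lu ub gM; have mid : l < (l + u) / 2 < u by rewrite !midf_lt.
  case/andP: (mid) => lm mu; exists ((l + u) / 2).
    by rewrite (le_lt_trans al lm) (lt_le_trans mu ub).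
  apply: (local_min_itv mid) => s slu; apply: le_trans (gM _ slu); apply: Mmax.
  by rewrite (le_trans al (ltW lm)) (le_trans (ltW mu) ub).
have [left_acc|nleft] := pselect (forall e, 0 < e -> exists2 s, M - e < s < M & g s < g M); last first.
  have [e [e0 eM]] : exists e, 0 < e /\ forall s, M - e < s < M -> g M <= g s.
    apply: contrapT => no; apply: nleft => e e0; apply: contrapT => no2; apply: no.
    by exists e; split => // s sM; rewrite leNgt; apply/negP => lt; apply: no2; exists s.
  have [||||t tab tmin] := flat (Num.max a (M - e)) M.
  - by rewrite le_max lexx.
  - by rewrite gt_max aM ltrBlDr ltrDl.
  - exact: ltW.
  - by move=> s; rewrite gt_max => /andP[/andP[_ Ms] sM]; apply: eM; rewrite Ms.
  - by exists t => //; left.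
have [right_acc|nright] := pselect (forall e, 0 < e -> exists2 s, M < s < M + e & g s < g M); last first.
  have [e [e0 eM]] : exists e, 0 < e /\ forall s, M < s < M + e -> g M <= g s.
    apply: contrapT => no; apply: nright => e e0; apply: contrapT => no2; apply: no.
    by exists e; split => // s sM; rewrite leNgt; apply/negP => lt; apply: no2; exists s.
  have [||||t tab tmin] := flat M (Num.min b (M + e)).
  - exact: ltW.
  - by rewrite lt_min Mb ltrDl.
  - by rewrite ge_min lexx.
  - by move=> s; rewrite lt_min => /andP[Ms /andP[_ sM]]; apply: eM; rewrite Ms.
  - by exists t => //; left.
by exists M; [rewrite aM|right].
Qed.

End Extremum.

Section CkAffine.
Variables (R : realType) (n : nat).

Lemma Ck_local (V : normedModType R) j (f g : 'rV[R]_n -> V) U : open U ->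
  (forall x, U x -> f x = g x) -> Ck j f U -> Ck j g U.
Proof.
move=> oU; elim: j f g => [|j IH] f g fg /= [fc fd].
  split=> // x Ux; have nE : \forall y \near x, f y = g y.
    by apply: filterS fg _; exact: open_nbhs_nbhs.
  rewrite /prop_for /continuous_at -(fg x Ux).
  by apply: cvg_trans (fc x Ux); exact: (near_eq_cvg nE).
have nE x : U x -> \forall y \near x, f y = g y.
  by move=> Ux; apply: filterS fg _; exact: open_nbhs_nbhs.
split=> [x Ux|i].
  rewrite /prop_for /continuous_at -(fg x Ux).
  by apply: cvg_trans (fc x Ux); exact: (near_eq_cvg (nE x Ux)).
have [dv Cj] := fd i; split=> [x Ux|].
  exact: near_eq_derivable (nE x Ux) (dv x Ux).
apply: IH Cj => x Ux; exact: near_eq_derive (nE x Ux).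
Qed.

Lemma derive_linear_comp m (W : normedModType R) (L : {linear 'rV[R]_m -> W})
    (F : 'rV[R]_n -> 'rV[R]_m) (y0 : 'rV[R]_m) x v : derivable F x v ->
  derivable (fun x => L (F x - y0)) x v /\ 'D_v (fun x => L (F x - y0)) x = L ('D_v F x).
Proof.
move=> dF.
have E : (fun h : R => h^-1 *: (((fun x => L (F x - y0)) \o shift x) (h *: v) - L (F x - y0))) =
    (L \o (fun h : R => h^-1 *: ((F \o shift x) (h *: v) - F x))).
  by rewrite funeqE => h /=; rewrite -linearB -linearZ/=; congr (L (_ *: _)); rewrite opprB addrA subrK.
have cvgL : (L \o (fun h : R => h^-1 *: ((F \o shift x) (h *: v) - F x))) @ 0^' --> L ('D_v F x).
  by apply: cvg_comp; [exact: dF|exact: linear_rV_continuous].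
split; rewrite /derivable /derive E; first by apply/cvg_ex; exists (L ('D_v F x)).
exact: cvg_lim.
Qed.

Lemma Ck_linear_comp m (W : normedModType R) (L : {linear 'rV[R]_m -> W}) j
    (F : 'rV[R]_n -> 'rV[R]_m) y0 U : open U ->
  Ck j F U -> Ck j (fun x => L (F x - y0)) U.
Proof.
move=> oU; elim: j F y0 => [|j IH] F y0 /= [Fc Fd].
  split=> // x Ux; apply: (@continuous_comp _ _ _ (fun x => F x - y0) L); last exact: linear_rV_continuous.
  by apply: continuousB; [exact: Fc|exact: cst_continuous].
split=> [x Ux|i].
  apply: (@continuous_comp _ _ _ (fun x => F x - y0) L); last exact: linear_rV_continuous.
  by apply: continuousB; [exact: Fc|exact: cst_continuous].
have [dv Cj] := Fd i; split=> [x Ux|]; first by have [] := derive_linear_comp L y0 (dv x Ux).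
apply: (@Ck_local _ _ (fun x => L ('D_(delta_mx 0 i) F x - 0)) _ _ oU) => [x Ux|]; last exact: IH.
by rewrite subr0; have [_ ->] := derive_linear_comp L y0 (dv x Ux).
Qed.

End CkAffine.

(** * Equality for curves *)

Section Equality.
Variables (R : realType) (k : comNzRingType) (n : nat) (P : manifold R n) (M : set P).
Hypothesis M_closed : closed M.
Implicit Types (p q : P) (w : cotangent P).

(** The inclusion excludes isolated points, where M would be flat of dimension
    0; on a curve there are none. *)
Lemma dimension1_not0 p : M p -> locally_flat_at M 1 p -> ~ locally_flat_at M 0 p.
Proof.
move=> Mp flat1 [_ [h [hp hM]]].
have Nh : nbhs p (ldom h) by apply: open_nbhs_nbhs; split => //; exact: ldom_open.
have [C [r0 C0 CN]] := flat1_arc Mp flat1 Nh.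
have r2 : - arc_rad C < arc_rad C / 2 < arc_rad C.
  by rewrite (lt_trans (y := 0)) ?oppr_lt0 ?divr_gt0//= ltr_pdivrMr// ltr_pMr// ltr1n.
have zr : - arc_rad C < 0 < arc_rad C by rewrite oppr_lt0 r0.
have [/CN hx Mx tx] := arc_parP r2; have [_ _ t0] := arc_parP zr.
have E x : ldom h x -> M x -> h x = 0.
  by move=> hx' Mx'; apply/rowP => i; rewrite mxE; exact: ((hM x hx').1 Mx').
have : arc_par C (arc_rad C / 2) = p by rewrite -(lmapK hx) -(lmapK hp) !E.
rewrite -C0 => /(congr1 (arc_coord C)); rewrite tx t0 => /eqP.
by rewrite gt_eqF// divr_gt0.
Qed.

Lemma jacobian_transition_id c p : atlas c -> ldom c p -> jacobian (c \o linv c) (c p) = 1%:M.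
Proof.
move=> ac cp; have s1 := transition_strict_diff ac ac cp cp.
have sid : strict_diff (c \o linv c) (c p) (idfun : {linear 'rV[R]_n -> 'rV[R]_n}).
  apply: strict_diff_near (@strict_diff_id _ _ (c p)).
  have : nbhs (c p) (lcod c).
    by apply: open_nbhs_nbhs; split; [exact: lcod_open|exact: lmap_cod].
  by apply: filterS => y cy; rewrite /= linvK.
apply/row_matrixP => i; rewrite !rowE mulmx1.
exact: (strict_diff_unique s1 sid (delta_mx 0 i)).
Qed.

(** The covector at q whose coordinates in the chart c are eta. *)
Definition cotangent_in (c : local_chart R P n) q (eta : 'rV[R]_n) : cotangent P :=
  Cotangent q (eta *m (jacobian (c \o linv (chart_at q)) (chart_at q q))^T).

Lemma covec_in_cotangent_in c q eta : atlas c -> ldom c q ->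
  covec_in c (cotangent_in c q eta) = eta.
Proof.
move=> ac cq; rewrite /covec_in /= -mulmxA -trmx_mul.
by rewrite transition_jacobianK ?trmx1 ?mulmx1//; [exact: atlas_at|exact: chart_at_dom].
Qed.

(** The test functions for the lower bound on the microsupport are affine in a
    fixed chart c. *)
Lemma affine_smooth c q eta : atlas c ->
  smooth_function_on (fun x => pairing eta (c x - c q)) (ldom c).
Proof.
move=> ac d ad j.
exact: (Ck_linear_comp (pair_with eta) (c q) (chart_cod_open (c := d) (ldom_open c))
  (atlas_compatible ad ac j)).
Qed.

Lemma affine_differential c q eta : atlas c -> ldom c q ->
  has_differential (fun x => pairing eta (c x - c q)) (cotangent_in c q eta).
Proof.
move=> ac cq; rewrite /has_differential /=; set d := chart_at q.
have dq : ldom d q := chart_at_dom q.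
have s1 := transition_strict_diff (atlas_at q) ac dq cq.
have s2 : strict_diff (fun y => pairing eta (y - c q) : R^o) ((c \o linv d) (d q)) (pair_with eta).
  move=> e e0; exists 1 => // x y _ _.
  by rewrite /pair_with -!pairingB opprB addrA subrK subrr pairing0 normr0 mulr_ge0// ltW.
have [_ ->] := strict_diff_diff (strict_diff_comp s1 s2).
move=> v; exact: pairing_mulmx.
Qed.

Lemma extremum_not_Ppg (C : arc R M) c eta t : atlas c ->
  - arc_rad C < t < arc_rad C -> ldom c (arc_par C t) ->
  local_min_at (fun s => pairing eta (c (arc_par C s))) t \/
    descends_on_both_sides (fun s => pairing eta (c (arc_par C s))) t ->
  ~ Ppg (constant_sheaf k M) (cotangent_in c (arc_par C t) eta).
Proof.
move=> ac tr cq ext; set q := arc_par C t in cq ext *.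
have [Cq Mq tq] := arc_parP tr.
pose phi x := pairing eta (c x - c q).
have sm : smooth_function_on phi (ldom c) by exact: affine_smooth.
have oUZ := open_sublevel (ldom_open c) sm.
move=> /(_ (ldom c) phi (ldom_open c) cq sm)[].
- by rewrite /phi /= subrr pairing0.
- exact: affine_differential.
move=> /= I vanish; case: ext => [[e e0 tmin]|[lacc racc]].
  pose V := opensI (slice C (t - e) (t + e)) (Opens (ldom_open c)).
  apply: (H0_nonzero M_closed (V := V) Mq _ _ _ (vanish 0)).
  - by split => //; apply/sliceP; rewrite tq ltrBlDr !ltrDl e0.
  - by move=> x [].
  - move=> y [/sliceP[Cy ye] cy] My; split => //; rewrite /phi pairingB subr_ge0.
    by have [_ <-] := arc_coordP Cy My; exact: tmin.
apply: (H1_nonzero M_closed tr (ldom_open c) oUZ cq _ _ _ (vanish 1%N)).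
- by split => //; rewrite /phi subrr pairing0.
- move=> e /lacc[s se lt]; exists s; split => // -[_].
  by rewrite /phi pairingB subr_ge0 leNgt lt.
- move=> e /racc[s se lt]; exists s; split => // -[_].
  by rewrite /phi pairingB subr_ge0 leNgt lt.
Qed.

Lemma secant_extremum (C : arc R M) c eta x y : (forall z, oset (arc_open C) z -> ldom c z) ->
  oset (arc_open C) x -> oset (arc_open C) y -> M x -> M y -> x <> y ->
  pairing eta (c y - c x) = 0 -> atlas c ->
  exists2 q, oset (arc_open C) q & ~ Ppg (constant_sheaf k M) (cotangent_in c q eta).
Proof.
move=> CN Cx Cy Mx My xy exy ac.
pose g s := pairing eta (c (arc_par C s)).
have gc s : - arc_rad C < s < arc_rad C -> {for s, continuous g}.
  move=> sr; have [Cs Ms _] := arc_parP sr.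
  apply: (@continuous_comp R P R (arc_par C) (fun z => pairing eta (c z)) s); first exact: arc_par_cont.
  apply: (@continuous_comp P 'rV[R]_n R c (pair_with eta)); last exact: linear_rV_continuous.
  by apply: lmap_continuous; exact: CN.
have main a b : - arc_rad C < a -> a < b -> b < arc_rad C -> g a = g b ->
    exists2 q, oset (arc_open C) q & ~ Ppg (constant_sheaf k M) (cotangent_in c q eta).
  move=> ra ab br gab.
  have [|s /andP[as_ sb] ext] := interior_extremum ab _ gab.
    by move=> s /andP[as_ sb]; apply: gc; rewrite (lt_le_trans ra as_) (le_lt_trans sb br).
  have sr : - arc_rad C < s < arc_rad C by rewrite (lt_trans ra as_) (lt_trans sb br).
  have [Cs Ms _] := arc_parP sr.
  exists (arc_par C s) => //; apply: extremum_not_Ppg => //; exact: CN.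
have [/andP[rx xr] gx] := arc_coordP Cx Mx; have [/andP[ry yr] gy] := arc_coordP Cy My.
have gxy : g (arc_coord C x) = g (arc_coord C y).
  by rewrite /g gx gy; apply/eqP; rewrite eq_sym -subr_eq0 -pairingB exy.
have [lt|lt|e] := ltgtP (arc_coord C x) (arc_coord C y).
- exact: main lt yr gxy.
- exact: main lt xr (esym gxy).
- by exfalso; apply: xy; rewrite -gx -gy e.
Qed.

(** Subtract from xi the multiple of a covector dual to v that makes it vanish
    on u; this multiple is small when u is close to v. *)
Lemma tilted_covector (xi v : 'rV[R]_n) d : v != 0 -> pairing xi v = 0 -> 0 < d ->
  exists2 e, 0 < e & forall u, `|v - u| < e -> u != 0 /\
    exists eta, pairing eta u = 0 /\ `|eta - xi| < d.
Proof.
move=> v0 xiv d0.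
have [j vj] : exists j, v 0 j != 0.
  apply: contrapT => no; move/eqP: v0; apply; apply/rowP => j; rewrite mxE.
  by apply: contrapT => vj; apply: no; exists j; apply/eqP.
pose dual : 'rV[R]_n := (v 0 j)^-1 *: delta_mx 0 j.
have dualE u : pairing dual u = u 0 j / v 0 j.
  rewrite /pairing (bigD1 j)//= big1 ?addr0 => [|i ij].
    by rewrite !mxE !eqxx mulr1 mulrC.
  by rewrite !mxE (negbTE ij) mulr0 mul0r.
pose K := n%:R * `|dual| + 1; have K0 : 0 < K by rewrite ltr_wpDl// mulr_ge0.
pose X := n%:R * `|xi| + 1; have X0 : 0 < X by rewrite ltr_wpDl// mulr_ge0.
pose D := `|dual| + 1; have D0 : 0 < D by rewrite ltr_wpDl.
(* the first bound gives <dual, u> > 1/2, the second |<xi, u>| < d / (2 D) *)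
exists (Num.min (2^-1 / K) (d / (2 * X * D))).
  by rewrite lt_min !divr_gt0// ?invr_gt0// !mulr_gt0.
move=> u; rewrite lt_min => /andP[uK ud].
have h1 : 2^-1 < pairing dual u.
  have : `|pairing dual v - pairing dual u| < 2^-1.
    rewrite -pairingB (le_lt_trans (pairing_bound1 _ _))// -/K mulrC -ltr_pdivlMr//.
  rewrite [pairing dual v]dualE divff// ltr_distlC => /andP[+ _].
  have -> : 1 - 2^-1 = 2^-1 :> R by field.
  by [].
have pos : 0 < pairing dual u by rewrite (lt_trans _ h1)// invr_gt0.
split; first by apply/eqP => u0; move: pos; rewrite u0 pairing0 ltxx.
exists (xi - (pairing xi u / pairing dual u) *: dual); split.
  rewrite pairingBl.
  have -> : pairing ((pairing xi u / pairing dual u) *: dual) u =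
      (pairing xi u / pairing dual u) * pairing dual u.
    by rewrite /pairing mulr_sumr; apply: eq_bigr => i _; rewrite mxE mulrA.
  by rewrite divfK ?subrr// gt_eqF.
rewrite addrAC subrr add0r normrN normrZ normrM normfV (gtr0_norm pos).
have hx : `|pairing xi u| < d / (2 * D).
  have -> : pairing xi u = - pairing xi (v - u) by rewrite pairingB xiv sub0r opprK.
  rewrite normrN (le_lt_trans (pairing_bound1 _ _))// -/X mulrC -ltr_pdivlMr// (lt_le_trans ud)//.
  by rewrite le_eqVlt; apply/orP; left; apply/eqP; rewrite -mulrA [X * D]mulrC mulrA invfM mulrA.
have hd : (pairing dual u)^-1 <= 2 by rewrite -[leRHS]invrK lef_pV2 ?posrE ?invr_gt0// ltW.
apply: (@le_lt_trans _ _ (`|pairing xi u| * 2 * D)).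
  by apply: ler_pM; rewrite ?mulr_ge0 ?invr_ge0 ?(ltW pos) // ?ler_wpM2l// /D lerDl.
by rewrite -mulrA -ltr_pdivlMr// mulr_gt0.
Qed.

(** The secants approach the given tangent vector, so their tilted covectors
    approach the given covector, and the corresponding extremal points q lie on
    a short arc near p. *)
Lemma top_subset_musupp : has_dimension M 1 ->
  top_set (whitney_cone M M) `<=` musupp_set k M.
Proof.
move=> M1 [p xi] [v [[x [y [s [xM yM s0 [xp yp uv]]]]] /= v0 xiv]].
set c := chart_at p in uv; have cp : ldom c p := chart_at_dom p; have ac : atlas c := atlas_at p.
have Mp : M p.
  apply: contrapT => nMp.
  have [i _ /(_ i (leqnn i))] := xp _ (open_nbhs_nbhs (conj (closed_openC M_closed) nMp)).
  by move=> /(_ (xM i)).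
move=> B; rewrite nbhsE => -[W [oW Ww] WB].
have covE : covec_in c (Cotangent p xi) = xi.
  by rewrite /covec_in /= jacobian_transition_id// trmx1 mulmx1.
have /nbhs_ballP[d /= d0 dW] := oW c ac _ Ww cp.
rewrite covE /= in dW.
have [C [r0 C0 CN]] := flat1_arc Mp (M1 p Mp) (chart_near cp d0).
have [e e0 eP] := tilted_covector v0 xiv d0.
have Cp : nbhs p (arc_open C).
  apply: open_nbhs_nbhs; split; first exact: opensP.
  have zr : - arc_rad C < 0 < arc_rad C by rewrite oppr_lt0 r0.
  by have [] := arc_parP zr; rewrite C0.
have uv' : \forall i \near \oo, `|v - s i *: (c (y i) - c (x i))| < e.
  by move/cvgrPdist_lt : uv => /(_ e e0).
have xC : \forall i \near \oo, oset (arc_open C) (x i) := xp _ Cp.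
have yC : \forall i \near \oo, oset (arc_open C) (y i) := yp _ Cp.
have [i [ue [Cx Cy]]] : exists i, `|v - s i *: (c (y i) - c (x i))| < e /\
    oset (arc_open C) (x i) /\ oset (arc_open C) (y i).
  have [i _ /(_ i (leqnn i))] := filterI uv' (filterI xC yC).
  by exists i.
have [u0 [eta [etau etad]]] := eP _ ue.
have xy : x i <> y i by move=> xy; move/eqP: u0; rewrite xy subrr scaler0.
have exy : pairing eta (c (y i) - c (x i)) = 0.
  by apply/eqP; move/eqP: etau; rewrite pairingZ mulf_eq0 gt_eqF.
have [q Cq nq] := secant_extremum (fun z Cz => (CN z Cz).1) Cx Cy (xM i) (yM i) xy exy ac.
have [cq qd] := CN q Cq.
exists (cotangent_in c q eta); split=> //; apply: WB.
apply: (dW (c q, eta)) => //; last by rewrite covec_in_cotangent_in.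
by split; apply/ball_dist.
Qed.

End Equality.

Theorem proposition7p4
  (R : realType) (k : comNzRingType) (hk : finite_global_dimension k)
  (n : nat) (P : manifold R n) (M : set P)
  (M_closed : closed M) (M_C0 : C0_submanifold M) :
  ((forall p, M p -> ~ locally_flat_at M 0 p) ->
     musupp_set k M `<=` top_set (whitney_cone M M)) /\
  (has_dimension M 1 ->
     musupp_set k M = top_set (whitney_cone M M)).
Proof.
split=> [M_pos|M1]; first exact: musupp_subset.
rewrite eqEsubset; split; last exact: top_subset_musupp.
by apply: musupp_subset => // p Mp; exact: dimension1_not0 (M1 p Mp).
Qed.
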